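(* Let $n>3$ be an integer and $p\ge 3$ an odd integer, let $q$ be an integer, and let $G\in\mathcal{G}(\{p,q\})$ satisfy $\alpha_l(G)<n$. (a) If $q=2p+1$, then $\operatorname{def}(G)\le 3n-8$. Moreover, if $G$ is deficiency-critical, then $\operatorname{def}(G)=3n-8$ if and only if $G\cong T_{n-2}^p$. (b) If $q=2p-1$, then $\operatorname{def}(G)\le n^2-3n+1$. Moreover, if $G$ is deficiency-critical, then $\operatorname{def}(G)=n^2-3n+1$ if and only if $G\cong S_{n-1}^p$.
   Context: All graphs are finite and simple. The deficiency $\operatorname{def}(G)$ is the number of vertices not saturated by a maximum matching of $G$. The local independence number $\alpha_l(G)$ is the largest $t$ such that $G$ has an induced subgraph isomorphic to $K_{1,t}$. For $i\ge 2$, $P_i$ is the path on $i$ vertices and the bone $B_i$ is the tree obtained from $P_i$ by attaching two pendent edges (edges to new degree-one vertices) to each of its two end vertices. For $A\subseteq\{2,3,\dots\}$, $\mathcal{G}(A)$ is the family of connected graphs $G$ such that every induced subgraph of $G$ isomorphic to a bone $B_i$ has $i\in A$. A connected graph $G$ is deficiency-critical if $\operatorname{def}(G')<\operatorname{def}(G)$ for every proper connected induced subgraph $G'$ of $G$. For positive integers $k,p$, $D_k^p$ is the tree obtained by attaching $k$ pendent edges at one end vertex of the path $P_p$; the other end vertex of $P_p$ is called the end of $D_k^p$ (when $p=1$ the single path vertex is the end). Attaching $D_k^p$ at a vertex $v$ of a graph means taking a disjoint copy of $D_k^p$ and identifying its end with $v$. $T_k^p$ is the graph obtained from $K_{2,k}$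 by attaching one copy of $D_k^p$ at each of the two vertices of degree $k$. $S_k^p$ is the tree obtained by taking $k$ pairwise disjoint copies of $D_{k-1}^p$ and identifying all their ends into one common vertex. *)

(* Defs.v *)
From mathcomp Require Import all_boot.
Set Implicit Arguments.
Unset Strict Implicit.
Unset Printing Implicit Defensive.

Record sgraph := SGraph {
  svertex :> finType;
  sedge : rel svertex;
  sedge_sym : symmetric sedge;
  sedge_irr : irreflexive sedge }.
Arguments sedge {s}.

Definition giso (G H : sgraph) : bool :=
  [exists f : {ffun G -> H},
    [&& injectiveb f, [forall y, y \in codom f]
      & [forall x, forall y, sedge (f x) (f y) == sedge x y]]].
Notation "G ≅ H" := (giso G H) (at level 70).

Lemma gisoP (G H : sgraph) :
  reflect (exists2 f : G -> H, bijective f & {mono f : x y / sedge x y})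
          (G ≅ H).
Proof.
apply: (iffP existsP) => [[f /and3P[/injectiveP inj /forallP sur /forallP mon]]|].
  exists f => [|x y]; last by move: (mon x) => /forallP/(_ y)/eqP.
  exists (fun y => iinv (sur y)) => [x|y]; last exact: f_iinv.
  by apply: inj; rewrite f_iinv.
case=> f bij mon; exists (finfun f); apply/and3P; split.
- by apply/injectiveP => x y; rewrite !ffunE => /(bij_inj bij).
- have [g fK gK] := bij; apply/forallP => y.
  by apply/codomP; exists (g y); rewrite ffunE gK.
- by apply/forallP => x; apply/forallP => y; rewrite !ffunE mon.
Qed.

Section Induced.
Variables (G : sgraph) (S : {set G}).
Definition induced_rel : rel {x : G | x \in S} :=
  fun x y => sedge (val x) (val y).
Lemma induced_sym : symmetric induced_rel.
Proof. by move=> x y; apply: sedge_sym. Qed.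
Lemma induced_irr : irreflexive induced_rel.
Proof. by move=> x; apply: sedge_irr. Qed.
Definition induced : sgraph := SGraph induced_sym induced_irr.
End Induced.

Definition has_induced (G H : sgraph) : bool :=
  [exists S : {set G}, induced S ≅ H].

(* The graph with no vertices is not connected. *)
Definition gconnected (G : sgraph) : bool :=
  (0 < #|G|) && [forall x : G, forall y : G, connect sedge x y].

Definition edges (G : sgraph) : {set {set G}} :=
  [set A | [exists x : G, exists y : G, sedge x y && (A == [set x; y])]].

Definition matching (G : sgraph) (M : {set {set G}}) : bool :=
  (M \subset edges G) && trivIset M.

Definition deficiency (G : sgraph) : nat :=
  #|~: cover [arg max_(M > set0 | @matching G M) #|M|]|.

Lemma matching0 (G : sgraph) : @matching G set0.
Proof. by rewrite /matching sub0set; apply/trivIsetP => A B; rewrite inE. Qed.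

Lemma card_cover_matching (G : sgraph) (M : {set {set G}}) :
  matching M -> #|cover M| = #|M| * 2.
Proof.
case/andP=> /subsetP sub /eqP <-; rewrite -sum_nat_const.
apply: eq_bigr => A /sub; rewrite inE => /existsP[x /existsP[y /andP[xy /eqP->]]].
by rewrite cards2; case: eqP xy => // ->; rewrite sedge_irr.
Qed.

(* The deficiency does not depend on the maximum matching. *)
Lemma deficiencyE (G : sgraph) (M : {set {set G}}) :
    matching M ->
    (forall M' : {set {set G}}, matching M' -> #|M'| <= #|M|) ->
  deficiency G = #|~: cover M|.
Proof.
move=> mM maxM; rewrite /deficiency.
case: arg_maxnP => [|M' mM' maxM']; first exact: matching0.
have cardC (N : {set {set G}}) : matching N -> #|~: cover N| = #|G| - #|N| * 2.
  by move=> /card_cover_matching <-; rewrite -(cardsC (cover N)) addKn.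
rewrite (cardC _ mM) (cardC _ mM'); congr (_ - _ * _).
by apply/eqP; rewrite eqn_leq maxM //=; exact: maxM'.
Qed.

Definition deficiency_critical (G : sgraph) : Prop :=
  gconnected G /\
  forall S : {set G}, S \proper [set: G] -> gconnected (induced S) ->
    deficiency (induced S) < deficiency G.

Section CompleteBipartite.
Variables a b : nat.
Definition biclique_rel : rel ('I_a + 'I_b) := fun x y =>
  match x, y with
  | inl _, inr _ | inr _, inl _ => true
  | _, _ => false
  end.
Lemma biclique_sym : symmetric biclique_rel.
Proof. by move=> [x|x] [y|y]. Qed.
Lemma biclique_irr : irreflexive biclique_rel.
Proof. by case. Qed.
Definition biclique : sgraph := SGraph biclique_sym biclique_irr.
End CompleteBipartite.

(* An induced K_{1,t} has t.+1 vertices, so t < #|G|; see local_indep_max. *)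
Definition local_indep (G : sgraph) : nat :=
  \max_(t < #|G| | has_induced G (biclique 1 t)) t.

Lemma local_indep_max (G : sgraph) (t : nat) :
  has_induced G (biclique 1 t) -> t <= local_indep G.
Proof.
move=> ht; have lt_t : t < #|G|.
  case/existsP: ht => S /gisoP[f bij _].
  have := bij_eq_card bij; rewrite /= card_sum !card_ord add1n card_sig => <-.
  exact: max_card.
exact: (@leq_bigmax_cond _ _ (fun t : 'I_#|G| => t : nat) (Ordinal lt_t)).
Qed.

(* The path on p vertices, for p >= 1: the vertex set is 'I_p, written so that
   the end vertices ord0 and ord_max exist. *)
Section PathGraph.
Variable p : nat.
Definition path_rel : rel 'I_(p.-1.+1) := fun x y =>
  (x.+1 == y :> nat) || (y.+1 == x :> nat).
Lemma path_sym : symmetric path_rel.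
Proof. by move=> x y; rewrite /path_rel orbC. Qed.
Lemma path_irr : irreflexive path_rel.
Proof. by move=> x; rewrite /path_rel orbb gtn_eqF. Qed.
Definition path_graph : sgraph := SGraph path_sym path_irr.
End PathGraph.

(* G with k pendent edges attached at v. *)
Section Pendent.
Variables (G : sgraph) (v : G) (k : nat).
Definition pendent_rel : rel (G + 'I_k) := fun x y =>
  match x, y with
  | inl a, inl b => sedge a b
  | inl a, inr _ | inr _, inl a => a == v
  | inr _, inr _ => false
  end.
Lemma pendent_sym : symmetric pendent_rel.
Proof. by move=> [x|x] [y|y] //=; apply: sedge_sym. Qed.
Lemma pendent_irr : irreflexive pendent_rel.
Proof. by case=> x //=; apply: sedge_irr. Qed.
Definition pendent : sgraph := SGraph pendent_sym pendent_irr.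
End Pendent.

(* B_i, for i >= 2. *)
Definition bone (i : nat) : sgraph :=
  @pendent (@pendent (path_graph i) ord0 2) (inl ord_max) 2.

Definition bone_family (A : {pred nat}) (G : sgraph) : Prop :=
  gconnected G /\
  forall i : nat, 2 <= i -> has_induced G (bone i) -> i \in A.

(* The disjoint union of G and H with u : H identified with v : G. *)
Section Attach.
Variables (G : sgraph) (v : G) (H : sgraph) (u : H).
Definition attach_rel : rel (G + {y : H | y != u}) := fun x y =>
  match x, y with
  | inl a, inl b => sedge a b
  | inl a, inr b | inr b, inl a => (a == v) && sedge u (val b)
  | inr a, inr b => sedge (val a) (val b)
  end.
Lemma attach_sym : symmetric attach_rel.
Proof. by move=> [x|x] [y|y] //=; apply: sedge_sym. Qed.
Lemma attach_irr : irreflexive attach_rel.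
Proof. by case=> x /=; apply: sedge_irr. Qed.
Definition attach : sgraph := SGraph attach_sym attach_irr.
End Attach.

(* k disjoint copies of H with all the copies of u : H identified; None is the
   common vertex. *)
Section Bouquet.
Variables (k : nat) (H : sgraph) (u : H).
Definition bouquet_rel : rel (option ('I_k * {y : H | y != u})) := fun x y =>
  match x, y with
  | None, None => false
  | None, Some (_, b) | Some (_, b), None => sedge u (val b)
  | Some (i, a), Some (j, b) => (i == j) && sedge (val a) (val b)
  end.
Lemma bouquet_sym : symmetric bouquet_rel.
Proof. by move=> [[i x]|] [[j y]|] //=; rewrite eq_sym sedge_sym. Qed.
Lemma bouquet_irr : irreflexive bouquet_rel.
Proof. by case=> [[i x]|] //=; rewrite sedge_irr andbF. Qed.
Definition bouquet : sgraph := SGraph bouquet_sym bouquet_irr.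
End Bouquet.

(* D_k^p and its end, for p >= 1. *)
Definition broom (k p : nat) : sgraph := @pendent (path_graph p) ord0 k.
Definition broom_end (k p : nat) : broom k p := inl ord_max.

(* T_k^p; for k = 2, where K_{2,2} is 2-regular, the two attachment vertices
   are those of one side of the bipartition. *)
Definition T_graph (k p : nat) : sgraph :=
  @attach (@attach (biclique 2 k) (inl ord0) _ (broom_end k p))
          (inl (inl ord_max)) _ (broom_end k p).

Definition S_graph (k p : nat) : sgraph := bouquet k (broom_end k.-1 p).

(* Main.v *)
(* By Tutte-Berge there is a barrier S, i.e. a set with at least |S| + def(G) odd
   components in G - S; take one of minimum size.  By parity every vertex of S
   is adjacent to at least three odd components.  We may replace G by a critical
   induced subgraph.  If x in S does not separate the rest of S, criticality
   forces two odd components to be attached to x only ("leaves" of x); call such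
   vertices x endpoints.  They end bones along every induced path towards the
   rest of S, so any two endpoints are joined by induced paths with p or q
   vertices only.  Joining a third endpoint to such a path by a shortest path
   produces a triangle (impossible, as all bones have odd size), a claw or a
   path, and comparing sizes shows that for q = 2p+1 there are exactly two
   endpoints, whereas for q = 2p-1 all endpoints lie at the tips of a "spider",
   legs with p-1 vertices around one center, so that there are at most n-1 of
   them.  A vertex of S that is not an endpoint separates endpoints, which pins
   its position: there are at most two such vertices for q = 2p+1 and at most
   one for q = 2p-1.  Counting every odd component with the weight
   (number of its neighbours in S) + [it is a leaf] >= 2 gives the bounds.  In
   case of equality all estimates are tight and an induced copy of the extremal
   graph appears; by criticality it is the whole graph. *)
Require Import Defs.
From mathcomp Require Import all_boot zify.
Set Implicit Arguments.
Unset Strict Implicit.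
Unset Printing Implicit Defensive.

(** * Matchings as involutions and the Tutte-Berge formula *)

(** Put N = n - 1. An endpoint has weight at most 2N - 1: it sees at most N odd components, and at
    most N - 1 leaves, because one more neighbour leads to the rest of the barrier. In the extremal
    configurations every other barrier vertex has weight at most N. Two endpoints and two further
    vertices give 2(def + 4) <= 2(2N - 1) + 2N, so def <= 3N - 5; N endpoints and one center give
    2(def + N + 1) <= N(2N - 1) + N, so def <= N^2 - N - 1. The two values of q differ by
    arithmetic: a third endpoint yields a path between endpoints, split at a vertex, such that both
    halves (each counting that vertex) and the whole have sizes in {p, q}. Only p + p - 1 = 2p - 1
    can be such a total, which excludes q = 2p + 1 and forces halves of p vertices for q = 2p - 1.
    The recurrent obstacle is that pendent edges of a bone must be nonadjacent to the path and to
    each other. They are therefore taken in parts of G - x that do not contain the other end; one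
    such pair at x then serves every induced path in that direction. *)

Lemma odd_card_fixed (T : finType) (m : T -> T) (A : {set T}) :
  involutive m -> {in A, forall x, m x \in A} ->
  odd #|A| = odd #|[set x in A | m x == x]|.
Proof.
move=> mK; have [k] := ubnP #|A|; elim: k A => // k IH A ltA mA.
have [/existsP[x /andP[xA mx]]|] := boolP [exists x in A, m x != x]; last first.
  move/existsPn=> fixA; congr odd; apply: eq_card => x; rewrite !inE.
  by move: (fixA x); rewrite negb_and negbK; case: (x \in A).
have mxA := mA x xA.
pose B := A :\ x :\ m x.
have cA : #|A| = #|B|.+2.
  by rewrite (cardsD1 x A) xA (cardsD1 (m x) (A :\ x)) !inE mx mxA.
rewrite cA /= negbK IH; last 2 first.
- by move: ltA; rewrite cA; lia.
- move=> y; rewrite !inE => /and3P[y1 y2 yA]; rewrite mA // andbT.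
  by rewrite (can_eq mK) y2 (inv_eq mK) y1.
congr odd; apply: eq_card => y; rewrite !inE.
case: (eqVneq y x) => [->|yx]; first by rewrite (negPf mx) !andbF.
case: (eqVneq y (m x)) => [->|//]; first by rewrite mK eq_sym (negPf mx) !andbF.
Qed.

Section Mates.
Variable G : sgraph.
Implicit Types (x y : G) (S U K : {set G}).

(** Matchings become involutions that move vertices along edges, with the unsaturated vertices as
    fixed points. Parity arguments and edge exchanges then act on functions. *)
Definition mate (m : {ffun G -> G}) :=
  [forall x, (m (m x) == x) && ((m x == x) || sedge x (m x))].

Lemma mateP (m : {ffun G -> G}) :
  reflect (involutive m /\ forall x, m x != x -> sedge x (m x)) (mate m).
Proof.
apply: (iffP forallP) => [h|[h1 h2] x].
  split=> x; first by have /andP[/eqP] := h x.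
  by have /andP[_ /orP[->|]] := h x.
by rewrite h1 eqxx /=; case: eqVneq => //= /h2.
Qed.

Lemma deficiency_mate :
  exists2 m : {ffun G -> G}, mate m & deficiency G = #|[set x | m x == x]|.
Proof.
rewrite /deficiency; case: arg_maxnP => [|M /andP[/subsetP sM tM] _].
  exact: matching0.
have pairE x y : [set x; y] \in M -> x != y.
  move/sM; rewrite inE => /existsP[a /existsP[b /andP[ab /eqP e]]].
  apply/eqP => xy; move: ab; have /esym := e; rewrite xy setUid => e'.
  have: a \in [set y] by rewrite -e' !inE eqxx.
  have: b \in [set y] by rewrite -e' !inE eqxx orbT.
  by rewrite !inE => /eqP-> /eqP->; rewrite sedge_irr.
have uniqM x y z : [set x; y] \in M -> [set x; z] \in M -> y = z.
  move=> y1 z1; have e : [set x; y] = [set x; z].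
    apply: etrans (esym (def_pblock (x := x) tM y1 _)) (def_pblock tM z1 _);
    by rewrite !inE eqxx.
  have: y \in [set x; z] by rewrite -e !inE eqxx orbT.
  rewrite !inE => /orP[/eqP yx|/eqP//].
  by move: (pairE _ _ y1); rewrite yx eqxx.
pose m := [ffun x => odflt x [pick y | [set x; y] \in M]].
have mE x y : [set x; y] \in M -> m x = y.
  move=> xy; rewrite ffunE; case: pickP => [z /= xz|/(_ y)]; last by rewrite xy.
  exact: uniqM xz xy.
have mV x : m x = x \/ [set x; m x] \in M.
  by rewrite ffunE; case: pickP => [z /= xz|_]; [right|left].
exists m.
  apply/mateP; split=> x.
    case: (mV x) => [e|xm]; first by rewrite !e.
    by apply: mE; rewrite setUC.
  case: (mV x) => [->|/sM]; first by rewrite eqxx.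
  rewrite inE => /existsP[a /existsP[b /andP[ab /eqP e]]] xmx.
  have: x \in [set a; b] by rewrite -e !inE eqxx.
  have: m x \in [set a; b] by rewrite -e !inE eqxx orbT.
  rewrite !inE => /orP[]/eqP h1 /orP[]/eqP h2; move: xmx; rewrite h1 h2 ?eqxx //.
  by rewrite sedge_sym.
apply: eq_card => x; rewrite !inE; apply/idP/eqP => [xM|mx].
  case: (mV x) => // xm; case/negP: xM; apply/bigcupP.
  by exists [set x; m x] => //; rewrite !inE eqxx.
apply/negP => /bigcupP[A AM xA].
have := sM _ AM; rewrite inE => /existsP[a /existsP[b /andP[ab /eqP e]]].
have [y xy] : exists y, [set x; y] \in M.
  move: xA; rewrite e !inE => /orP[]/eqP->; first by exists b; rewrite -e.
  by exists a; rewrite setUC -e.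
by move: (pairE _ _ xy); rewrite -(mE _ _ xy) mx eqxx.
Qed.

Lemma deficiency_le (m : {ffun G -> G}) : mate m -> deficiency G <= #|[set x | m x == x]|.
Proof.
case/mateP=> mK me.
pose M := [set [set x; m x] | x in [set x | m x != x]].
have mM : matching M.
  apply/andP; split.
    apply/subsetP => A /imsetP[x]; rewrite inE => mx ->; rewrite inE.
    by apply/existsP; exists x; apply/existsP; exists (m x); rewrite me // eqxx.
  apply/trivIsetP => A B /imsetP[x _ ->] /imsetP[y _ ->].
  have pairE z w : z \in [set w; m w] -> [set w; m w] = [set z; m z].
    by rewrite !inE => /orP[]/eqP-> //; rewrite mK setUC.
  by apply: contraR => /pred0Pn[z /andP[/= /pairE-> /pairE->]].
have -> : [set x | m x == x] = ~: cover M.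
  apply/setP => x; rewrite !inE; apply/idP/idP => [/eqP mx|].
    apply/negP => /bigcupP[A /imsetP[y]]; rewrite inE => my ->; rewrite !inE.
    case/orP=> /eqP e; first by rewrite -e mx eqxx in my.
    by move: my; rewrite -e -[X in _ != X](mK y) -e mx eqxx.
  apply: contraR => mx; apply/bigcupP; exists [set x; m x].
    by apply/imsetP; exists x; rewrite ?inE.
  by rewrite !inE eqxx.
rewrite /deficiency; case: arg_maxnP => [|M' mM' maxM'].
  exact: matching0.
rewrite -[X in X <= _](addKn #|cover M'|) -[X in _ <= X](addKn #|cover M|).
rewrite !cardsC leq_sub2l // !card_cover_matching // leq_mul2r.
exact: maxM'.
Qed.

End Mates.

(** * Components of G - S *)

Section Components.
Variable G : sgraph.
Implicit Types (x y u v : G) (S U K : {set G}).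

(** G - S stays on the vertex type of G, so that components for different S can be compared. A
    vertex of S is isolated for this relation and forms its own [component]; hence the recurrent
    conditions that base points lie outside S. *)
Definition avoid S : rel G := [rel u v | [&& u \notin S, v \notin S & sedge u v]].
Definition component S x : {set G} := [set y | connect (avoid S) x y].
Definition components S : {set {set G}} := [set component S x | x in ~: S].
Definition odd_components S : {set {set G}} := [set K in components S | odd #|K|].

Lemma avoid_sym S : connect_sym (avoid S).
Proof.
by apply: sym_connect_sym => u v; rewrite /avoid /= sedge_sym; case: (u \in S); case: (v \in S).
Qed.

Lemma component_refl S x : x \in component S x.
Proof. by rewrite inE. Qed.

Lemma component_sym S x y : (y \in component S x) = (x \in component S y).
Proof. by rewrite !inE avoid_sym. Qed.

Lemma component_eq S x y : y \in component S x -> component S y = component S x.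
Proof.
rewrite inE => xy; apply/setP => z; rewrite !inE.
by rewrite (same_connect (avoid_sym S) xy).
Qed.

Lemma component_ind S x (P : G -> Prop) :
  P x ->
  (forall u v, u \in component S x -> P u -> u \notin S -> v \notin S -> sedge u v ->
    P v) ->
  forall y, y \in component S x -> P y.
Proof.
move=> Px step y; rewrite inE => /connectP[p]; elim/last_ind: p y => [|p z IH] y.
  by move=> _ ->.
rewrite rcons_path last_rcons => /andP[pth /and3P[h1 h2 h3]] ->.
apply: step h1 h2 h3; last exact: IH.
by rewrite inE; apply/connectP; exists p.
Qed.

Lemma component_step S x u v :
  u \in component S x -> u \notin S -> v \notin S -> sedge u v -> v \in component S x.
Proof.
rewrite !inE => xu uS vS uv; apply: connect_trans xu (connect1 _).
by apply/and3P; split.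
Qed.

Lemma component_notin S x y : x \notin S -> y \in component S x -> y \notin S.
Proof. by move=> xS; apply: (component_ind (P := fun y => y \notin S)). Qed.

Lemma component_mono S U x : U \subset S -> component S x \subset component U x.
Proof.
move=> /subsetP US; apply/subsetP => y; apply: (component_ind (P := fun y => y \in component U x)); first exact: component_refl.
move=> u v _ uU uS vS; apply: component_step => //; first exact: contra (US _) uS.
exact: contra (US _) vS.
Qed.

Lemma componentsP S K : reflect (exists2 x, x \notin S & K = component S x) (K \in components S).
Proof.
apply: (iffP imsetP) => [[x xS ->]|[x xS ->]]; exists x => //; first by rewrite inE in xS.
by rewrite inE.
Qed.

Lemma components_mem S K x : K \in components S -> x \in K -> K = component S x /\ x \notin S.
Proof.
case/componentsP => y yS -> xy; split; last exact: component_notin xy.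
exact/esym/component_eq.
Qed.

Lemma components_closed S K u v :
  K \in components S -> u \in K -> sedge u v -> v \in K \/ v \in S.
Proof.
move=> KS uK uv; have [-> uS] := components_mem KS uK.
have [|vS] := boolP (v \in S); [by right|left].
exact: component_step (component_refl _ _) uS vS uv.
Qed.

Lemma components_partition S : partition (components S) (~: S).
Proof.
apply/and3P; split.
- apply/eqP/setP => x; apply/bigcupP/idP => [[K KS /(components_mem KS)[]]|xS].
    by rewrite inE.
  by exists (component S x); [apply/imsetP; exists x|exact: component_refl].
- apply/trivIsetP => A B AS BS; apply: contraR => /pred0Pn[x /andP[/= xA xB]].
  by rewrite (components_mem AS xA).1 (components_mem BS xB).1.
- by apply/imsetP => -[x _ e]; have := component_refl S x; rewrite -e inE.
Qed.

Lemma components_trivIset S : trivIset (components S).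
Proof. by have /and3P[] := components_partition S. Qed.

Lemma components_neq0 S K : K \in components S -> exists x, x \in K.
Proof. by case/componentsP => x _ ->; exists x; apply: component_refl. Qed.

Lemma odd_componentsW S K : K \in odd_components S -> K \in components S.
Proof. by rewrite inE => /andP[]. Qed.

Lemma odd_components_parity S : odd #|odd_components S| = odd #|~: S|.
Proof.
rewrite (card_partition (components_partition S)).
rewrite (bigID (fun K : {set G} => odd #|K|)) /= oddD.
rewrite [X in _ = _ (+) X](_ : _ = false) ?addbF; last first.
  apply: (big_ind (fun a => odd a = false)) => // [a b|K /andP[_ /negPf //]].
  by rewrite oddD => -> ->.
have -> : \sum_(K in components S | odd #|K|) #|K| = \sum_(K in odd_components S) #|K|.
  by apply: eq_bigl => K; rewrite inE.
rewrite -sum1_card; apply: (big_ind2 (fun a b => odd a = odd b)) => //.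
  by move=> a b c d; rewrite !oddD => ->->.
by move=> K; rewrite inE => /andP[_ ->].
Qed.

End Components.

(** * The easy inequality of the Tutte-Berge formula *)

Section Duality.
Variables (G H : sgraph) (h : H -> G).
Hypothesis h_inj : injective h.

(** An odd set K is not a union of pairs of a matching, so some vertex of K is unmatched or matched
    into S, and disjointness makes these vertices distinct. Stating it along an injection [h], for
    disjoint odd sets closed up to S, covers two uses: odd components of G inside an induced
    subgraph, and singletons of an independent set under an isomorphism. *)
Lemma odd_family_le (S : {set G}) (F : {set {set G}}) :
  trivIset F ->
  (forall K, K \in F -> odd #|K|) ->
  (forall K u, K \in F -> u \in K -> exists x, u = h x) ->
  (forall K x y, K \in F -> h x \in K -> sedge x y -> h y \in K \/ h y \in S) ->
  #|F| <= #|S| + deficiency H.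
Proof.
move=> tF oddF domF closF.
have [m /mateP[mK me] ->] := deficiency_mate H.
pose good (K : {set G}) x := (h x \in K) && ((m x == x) || (h (m x) \in S)).
have ex (K : {set G}) : K \in F -> exists x, good K x.
  move=> KF; apply/existsP; apply: contraT => /existsPn bad.
  have KE : #|K| = #|h @^-1: K|.
    rewrite -(card_imset _ h_inj); apply: eq_card => u.
    apply/idP/imsetP => [uK|[x]]; last by rewrite inE => xK ->.
    by have [x e] := domF _ _ KF uK; exists x => //; rewrite inE -e.
  have := oddF _ KF; rewrite KE (odd_card_fixed mK).
    rewrite (_ : [set x in h @^-1: K | m x == x] = set0) ?cards0 //.
    apply/setP => x; rewrite !inE; apply/negP => /andP[xK mx].
    by move: (bad x); rewrite /good xK mx.
  move=> x; rewrite !inE => xK; move: (bad x); rewrite /good xK /= negb_or.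
  case/andP=> mx mS; case: (closF _ _ (m x) KF xK (me _ mx)) => // mS'.
  by rewrite mS' in mS.
case: (set_0Vmem F) => [->|[K0 K0F]]; first by rewrite cards0.
have [x0 _] := ex _ K0F.
pose f (K : {set G}) := odflt x0 [pick x | good K x].
have fP (K : {set G}) : K \in F -> good K (f K).
  move=> KF; rewrite /f; case: pickP => // bad.
  by have [x] := ex _ KF; rewrite bad.
have f_inj : {in F &, injective f}.
  move=> K L KF LF e; apply/eqP; apply: contraT => KL.
  move/trivIsetP: tF => /(_ _ _ KF LF KL)/pred0P/(_ (h (f K))) /=.
  have /andP[-> _] := fP _ KF; rewrite e.
  by have /andP[-> _] := fP _ LF.
rewrite -(card_in_imset f_inj).
apply: (leq_trans (n := #|(m @: (h @^-1: S)) :|: [set x | m x == x]|)).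
  apply/subset_leq_card/subsetP => _ /imsetP[K KF ->].
  have /andP[_ /orP[mx|mS]] := fP _ KF; rewrite !inE ?mx ?orbT //.
  apply/orP; left; apply/imsetP; exists (m (f K)); rewrite ?inE ?mK //.
apply: leq_trans (leq_card_setU _ _) _; rewrite leq_add2r.
apply: leq_trans (leq_imset_card _ _) _.
rewrite -(card_imset _ h_inj); apply/subset_leq_card/subsetP => _ /imsetP[x + ->].
by rewrite inE.
Qed.

End Duality.

Lemma deficiency_parity (G : sgraph) : odd (deficiency G) = odd #|G|.
Proof.
have [m /mateP[mK me] ->] := deficiency_mate G.
rewrite -cardsT (@odd_card_fixed _ m setT mK); last by move=> x; rewrite inE.
by congr odd; apply: eq_card => x; rewrite !inE.
Qed.

(** * Gallai's lemma and the existence of a barrier *)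

Section TutteBerge.
Variable G : sgraph.
Implicit Types (x y u v : G) (S U K : {set G}) (m : {ffun G -> G}).

(** Matchings of the subgraph induced on U, kept as involutions of G that fix everything outside U;
    deleting a vertex changes U and not the type. *)
Definition mate_in U m := mate m && [forall x, (x \notin U) ==> (m x == x)].
Definition missed U m := #|[set x in U | m x == x]|.
Definition deficiency_in U :=
  missed U [arg min_(m < [ffun x => x] | mate_in U m) missed U m].

Lemma mate_inP U m :
  reflect [/\ involutive m, forall x, m x != x -> sedge x (m x)
            & forall x, x \notin U -> m x = x] (mate_in U m).
Proof.
apply: (iffP andP) => [[/mateP[h1 h2] /forallP h3]|[h1 h2 h3]].
  by split=> // x xU; apply/eqP; have := h3 x; rewrite xU.
by split; [apply/mateP|apply/forallP => x; apply/implyP => /h3->].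
Qed.

Lemma mate_in_mem U m x : mate_in U m -> x \in U -> m x \in U.
Proof.
case/mate_inP=> mK _ mU xU; apply: contraT => nU.
by have := mU _ nU; rewrite mK => e; rewrite -e xU in nU.
Qed.

Lemma deficiency_inP U :
  exists m, [/\ mate_in U m, missed U m = deficiency_in U &
    forall m', mate_in U m' -> deficiency_in U <= missed U m'].
Proof.
rewrite /deficiency_in; case: arg_minnP => [|m mm min_m]; last by exists m.
by apply/mate_inP; split=> x; rewrite !ffunE ?eqxx.
Qed.

Lemma missed_parity U m : mate_in U m -> odd (missed U m) = odd #|U|.
Proof.
move=> mm; have [mK _ _] := mate_inP _ _ mm.
by rewrite (@odd_card_fixed _ m U mK) // => x; apply: mate_in_mem.
Qed.

Lemma deficiency_inT : deficiency_in setT = deficiency G.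
Proof.
have [m [mm <- min_m]] := deficiency_inP setT.
have E m' : missed setT m' = #|[set x | m' x == x]|.
  by apply: eq_card => x; rewrite !inE.
apply/eqP; rewrite eqn_leq; apply/andP; split.
  have [m' mm' ->] := deficiency_mate G.
  have: mate_in setT m'.
    by rewrite /mate_in mm'; apply/forallP => x; rewrite inE.
  by move/min_m; rewrite -E; have [m2 [_ e _]] := deficiency_inP setT; lia.
by rewrite E deficiency_le //; case/andP: mm.
Qed.

Definition minimum_mate U m := mate_in U m && (missed U m == deficiency_in U).

(** Gallai's relation: no maximum matching of the subgraph on U misses both vertices. The disjunct
    [u == v] makes it reflexive. *)
Definition linked U u v :=
  (u == v) || [forall m, minimum_mate U m ==> ~~ ((m u == u) && (m v == v))].

(** A minimum mate missing both ends could be enlarged by the edge uv. *)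
Lemma linked_edge U u v : u \in U -> v \in U -> sedge u v -> linked U u v.
Proof.
move=> uU vU uv; apply/orP; right; apply/forallP => m; apply/implyP => /andP[mm /eqP em].
apply/negP => /andP[/eqP mu /eqP mv].
have uv' : u != v by apply: contraTneq uv => ->; rewrite sedge_irr.
have [mK me mU] := mate_inP _ _ mm.
pose m' := [ffun x => if x == u then v else if x == v then u else m x].
have mm' : mate_in U m'.
  apply/mate_inP; split=> x; rewrite !ffunE.
  - case: (eqVneq x u) => [->|xu]; first by rewrite eq_sym (negPf uv') eqxx.
    case: (eqVneq x v) => [->|xv]; first by rewrite eqxx.
    rewrite (_ : (m x == u) = false); last first.
      by apply/negbTE; rewrite -mu (can_eq mK).
    rewrite (_ : (m x == v) = false) ?mK //.
    by apply/negbTE; rewrite -mv (can_eq mK).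
  - case: (eqVneq x u) => [->|xu] //; case: (eqVneq x v) => [->|xv] //.
      by rewrite sedge_sym.
    exact: me.
  - case: (eqVneq x u) => [->|xu]; first by rewrite uU.
    case: (eqVneq x v) => [->|xv]; first by rewrite vU.
    exact: mU.
have [_ [_ _ min_m]] := deficiency_inP U.
have := min_m _ mm'; rewrite -em leqNgt => /negP[]; apply/proper_card/properP.
split.
  apply/subsetP => x; rewrite !inE ffunE => /andP[-> /=].
  case: (eqVneq x u) => [->|xu]; first by rewrite eq_sym (negPf uv').
  by case: (eqVneq x v) => [->|xv] //; rewrite (negPf uv').
by exists u; rewrite !inE ?uU ?mu ?eqxx //= ffunE eqxx eq_sym (negPf uv').
Qed.

(* Gallai's lemma.  If a minimum mate M misses u and v, then among the minimum mates
   missing t the one agreeing with M on the most vertices could still be improved. *)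
Lemma linked_trans U u t v :
  t \in U -> (exists2 m, minimum_mate U m & m t = t) ->
  u \in U -> v \in U -> linked U u t -> linked U t v -> linked U u v.
Proof.
move=> tU ext uU vU /orP[/eqP-> //|ut] /orP[/eqP<-|tv]; first by rewrite /linked ut orbT.
have [->|uv] := eqVneq u v; first by rewrite /linked eqxx.
apply/orP; right; apply/forallP => M; apply/implyP => minM; apply/negP.
case/andP=> /eqP Mu /eqP Mv.
have [mM /eqP eM] := andP minM.
have [MK Me MU] := mate_inP _ _ mM.
pose P (N : {ffun G -> G}) := minimum_mate U N && (N t == t).
pose agree (N : {ffun G -> G}) := #|[set x | M x == N x]|.
have [N0 N0m N0t] := ext.
have PN0 : P N0 by rewrite /P N0m N0t eqxx.
case: (arg_maxnP agree PN0) => N /andP[minN /eqP Nt] maxN.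
have [mN /eqP eN] := andP minN.
have [NK Ne NU] := mate_inP _ _ mN.
have Nu : N u != u.
  by move/forallP/(_ N): ut; rewrite minN Nt eqxx andbT.
have Nv : N v != v.
  by move/forallP/(_ N): tv; rewrite minN Nt eqxx.
(* M and N miss equally many vertices. M misses u and v, both covered by N; so if M missed
   everything that N misses apart from t, it would miss one vertex too many. *)
have [x [xU xt Nx Mx]] : exists x, [/\ x \in U, x != t, N x = x & M x != x].
  pose A := [set x in U | N x == x] :\ t; pose B := [set x in U | M x == x] :\ u :\ v.
  have [/existsP[x /and4P[? ? /eqP ? ?]]|/existsPn noX] :=
    boolP [exists x, [&& x \in U, x != t, N x == x & M x != x]]; first by exists x.
  have cA : (#|A|.+1 = deficiency_in U).
    by rewrite -eN /missed (cardsD1 t [set x in U | N x == x]) !inE tU Nt eqxx.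
  have cB : (#|B|.+2 = deficiency_in U).
    rewrite -eM /missed (cardsD1 u [set x in U | M x == x]).
    rewrite (cardsD1 v ([set x in U | M x == x] :\ u)) !inE uU vU Mu Mv !eqxx.
    by rewrite eq_sym uv.
  suff: #|A| <= #|B| by rewrite -[_ <= _]ltnS -[_ < _]ltnS cA cB ltnn.
  apply/subset_leq_card/subsetP => x; rewrite !inE => /and3P[xt xU /eqP Nx].
  move: (noX x); rewrite xU xt Nx eqxx /= negbK => /eqP Mx; rewrite Mx eqxx andbT.
  by apply/andP; split; [apply: contraNneq Nv => <-|apply: contraNneq Nu => <-]; rewrite Nx.
pose y := M x; pose z := N y.
have xy : sedge x y by exact: Me.
have yU : y \in U by exact: mate_in_mem.
have yx : y != x by [].
have My : M y = x by exact: MK.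
have zy : z != y.
  apply: contraTN isT => /eqP Ny.
  have lk := linked_edge xU yU xy.
  move: lk; rewrite /linked eq_sym (negPf yx) /= => /forallP/(_ N).
  by rewrite minN Nx -{2}[y]Ny !eqxx.
have Nz : N z = y by exact: NK.
have zx : z != x by apply: contraNneq yx => e; rewrite -Nz e Nx.
have zU : z \in U by exact: mate_in_mem.
have zt : z != t by apply: contraNneq zy => e; rewrite -Nz e Nt.
have yt : y != t by apply: contraNneq zy => e; rewrite /z e Nt.
(* The edge yz of N is exchanged for the edge xy of M: z is missed instead of x, t is still missed,
   and the agreement with M grows at x and is lost nowhere. *)
pose N' := [ffun w => if w == x then y else if w == y then x else
                      if w == z then z else N w].
have mN' : mate_in U N'.
  apply/mate_inP; split=> w; rewrite !ffunE.
  - case: (eqVneq w x) => [->|wx]; first by rewrite (negPf yx) eqxx.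
    case: (eqVneq w y) => [->|wy]; first by rewrite eqxx.
    case: (eqVneq w z) => [->|wz]; first by rewrite (negPf zx) (negPf zy) eqxx.
    have -> : (N w == x) = false by rewrite -Nx (can_eq NK) (negPf wx).
    have -> : (N w == y) = false by rewrite -Nz (can_eq NK) (negPf wz).
    have -> : (N w == z) = false by rewrite (can_eq NK) (negPf wy).
    exact: NK.
  - case: (eqVneq w x) => [->|wx] //; case: (eqVneq w y) => [->|wy] //.
      by rewrite sedge_sym.
    case: (eqVneq w z) => [->|wz]; first by rewrite eqxx.
    exact: Ne.
  - case: (eqVneq w x) => [->|wx]; first by rewrite xU.
    case: (eqVneq w y) => [->|wy]; first by rewrite yU.
    by case: (eqVneq w z) => // _; apply: NU.
have eN' : missed U N' = missed U N.
  rewrite /missed (cardsD1 z) [in RHS](cardsD1 x) !inE xU zU Nx !ffunE.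
  rewrite (negPf zx) (negPf zy) !eqxx; congr (_ + _).
  apply: eq_card => w; rewrite !inE ffunE.
  case: (eqVneq w x) => [->|wx]; first by rewrite (negPf yx) !andbF.
  case: (eqVneq w y) => [->|wy]; first by rewrite [x == y]eq_sym (negPf yx) (negPf zy) !andbF.
  by case: (eqVneq w z) => [->|wz] //; rewrite Nz eq_sym (negPf zy) !andbF.
have PN' : P N'.
  rewrite /P /minimum_mate mN' eN' eN eqxx ffunE.
  by rewrite ![t == _]eq_sym (negPf xt) (negPf yt) (negPf zt) Nt eqxx.
have: agree N' <= agree N := maxN _ PN'; rewrite leqNgt => /negP[]; apply/proper_card/properP; split.
  apply/subsetP => w; rewrite !inE ffunE => /eqP Mw.
  case: (eqVneq w x) => [->//|wx]; case: (eqVneq w y) => [->|wy]; first by rewrite My.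
  case: (eqVneq w z) => [wz|_]; last by rewrite Mw.
  by case/eqP: wx; rewrite -[w]MK Mw wz Nz My.
by exists x; rewrite !inE ?ffunE ?eqxx // Nx (negPf yx).
Qed.

Lemma linked_connect U u v :
  (forall t, t \in U -> exists2 m, minimum_mate U m & m t = t) ->
  v \in component (~: U) u -> u \in U -> linked U u v.
Proof.
move=> ext + uU; move: v; apply: (component_ind (P := fun v => linked U u v)).
  by rewrite /linked eqxx.
move=> a b ua la; rewrite !inE !negbK => aU bU ab.
by apply: (linked_trans aU (ext _ aU) uU bU la); apply: linked_edge.
Qed.

(* For a maximal [S] whose removal increases the deficiency by [#|S|], every vertex
   outside [S] is missed by some minimum mate. *)
Lemma tutte_berge : exists S, deficiency G + #|S| <= #|odd_components S|.
Proof.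
pose P S := deficiency G + #|S| <= deficiency_in (~: S).
have P0 : P set0 by rewrite /P cards0 addn0 setC0 deficiency_inT.
case: (arg_maxnP (fun S => #|S|) P0) => S PS maxS; exists S.
apply: (leq_trans PS); set U := ~: S.
(* An optimal mate of U :\ t, with t left single, misses at least [deficiency_in U] vertices of U.
   As t |: S violates the maximality of S, it misses at most one more, and parity excludes that
   excess. *)
have ext t : t \in U -> exists2 m, minimum_mate U m & m t = t.
  move=> tU; have tS : t \notin S by move: tU; rewrite inE.
  have [m [mm em _]] := deficiency_inP (U :\ t).
  have [mK me mU] := mate_inP _ _ mm.
  have mt : m t = t by apply: mU; rewrite !inE eqxx.
  exists m => //.
  have mmU : mate_in U m.
    by apply/mate_inP; split=> // x xU; apply: mU; rewrite in_setD1 negb_and xU orbT.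
  have eU : missed U m = (deficiency_in (U :\ t)).+1.
    rewrite -em /missed (cardsD1 t) !inE tS mt eqxx; congr _.+1.
    by apply: eq_card => x; rewrite !inE; case: eqP.
  have nP : ~~ P (t |: S).
    by apply/negP => /maxS /=; rewrite cardsU1 tS; lia.
  have [m0 [mm0 em0 min0]] := deficiency_inP U.
  have par := missed_parity mmU; have := missed_parity mm0; rewrite -par em0.
  have := min0 _ mmU; move: nP PS; rewrite /P setCU setIC -setDE -/U cardsU1 tS.
  rewrite /minimum_mate mmU eU /=; lia.
have [m [mm em _]] := deficiency_inP U.
have [mK me mU] := mate_inP _ _ mm.
have minm : minimum_mate U m by rewrite /minimum_mate mm em eqxx.
have SU : ~: U = S by rewrite setCK.
have one u v : u \in U -> m u = u -> v \in component S u -> m v = v -> u = v.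
  move=> uU mu uv mv; apply/eqP; rewrite -SU in uv.
  have /orP[//|/forallP/(_ m)] := linked_connect ext uv uU.
  by rewrite minm mu mv !eqxx.
pose F := [set x in U | m x == x].
(* By Gallai's lemma a component of G - S holds at most one vertex missed by m. A component holding
   one is stable under m with a single fixed point, hence odd. *)
have inj : {in F &, injective (component S)}.
  move=> u v; rewrite !inE => /andP[uU /eqP mu] /andP[vU /eqP mv] e.
  by apply: one mv => //; [rewrite inE|rewrite e component_refl].
rewrite -em /missed -/F -(card_in_imset inj).
apply/subset_leq_card/subsetP => _ /imsetP[u + ->]; rewrite !inE => /andP[uS /eqP mu].
apply/andP; split; first by apply/componentsP; exists u.
have uU : u \in U by rewrite inE.
rewrite (@odd_card_fixed _ m _ mK) => [|x ux].
  rewrite (_ : [set x in _ | _] = [set u]) ?cards1 //.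
  apply/setP => x; rewrite !(inE, in_set1); apply/andP/eqP => [[ux /eqP mx]|->].
    by apply/esym/one; rewrite ?inE.
  by rewrite connect0 mu eqxx.
case: (eqVneq (m x) x) => [-> //|mx].
have xS := component_notin uS ux.
apply: (component_step ux xS _ (me _ mx)).
by have := mate_in_mem mm (x := x); rewrite !inE; apply.
Qed.

End TutteBerge.

(** * Induced paths and bones *)

Section InducedPaths.
Variable G : sgraph.
Implicit Types (x y u v w : G) (s t P Q W : seq G) (S : {set G}).

(** Distinctness is included, so that one predicate yields both injectivity and the absence of edges
    when an induced copy is assembled. *)
Definition nonadj : rel G := fun u v => (u != v) && ~~ sedge u v.

Lemma nonadj_sym : symmetric nonadj.
Proof. by move=> u v; rewrite /nonadj eq_sym sedge_sym. Qed.

Fixpoint induced_path s :=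
  if s is x :: s' then
    (if s' is y :: t then sedge x y && all (nonadj x) t else true) && induced_path s'
  else true.

(** Both ends are read with [ohead], on the list and on its reverse, which makes the notion visibly
    symmetric under [rev]. *)
Definition ipath x y s := [&& induced_path s, ohead s == Some x & ohead (rev s) == Some y].

Lemma sedge_neq u v : sedge u v -> u != v.
Proof. by apply: contraTneq => ->; rewrite sedge_irr. Qed.

Lemma nonadj_edgeF u v : nonadj u v -> sedge u v = false.
Proof. by case/andP=> _ /negPf. Qed.

Lemma nonadj_neq u v : nonadj u v -> u != v.
Proof. by case/andP. Qed.

Lemma ip_neq x s : induced_path (x :: s) -> x \notin s.
Proof.
case: s => //= y t /andP[/andP[xy /allP h] _]; rewrite inE negb_or sedge_neq //=.
by apply/negP => /h /nonadj_neq; rewrite eqxx.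
Qed.

Lemma ip_tl x s : induced_path (x :: s) -> induced_path s.
Proof. by case/andP. Qed.

Lemma ip_uniq s : induced_path s -> uniq s.
Proof. by elim: s => //= x s IH h; rewrite ip_neq //= IH // (ip_tl h). Qed.

Lemma ip_na x y t v : induced_path [:: x, y & t] -> v \in t -> nonadj x v.
Proof. by case/andP=> /andP[_ /allP h] _ /h. Qed.

Lemma ip_edge x y t : induced_path [:: x, y & t] -> sedge x y.
Proof. by case/andP=> /andP[]. Qed.

Lemma ip_cons2 x y t : induced_path [:: x, y & t] = [&& sedge x y, all (nonadj x) t & induced_path (y :: t)].
Proof. by rewrite [LHS]/= -andbA. Qed.

Lemma ohead_rev x s : ohead (rev (x :: s)) = Some (last x s).
Proof. by rewrite lastI rev_rcons. Qed.

Lemma ipathP x y s :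
  reflect (exists t, [/\ s = x :: t, last x t = y & induced_path s]) (ipath x y s).
Proof.
apply: (iffP and3P) => [[h /eqP e1 /eqP e2]|[t [-> e h]]].
  by case: s h e1 e2 => // a t h [ea]; rewrite ohead_rev => -[el]; exists t; rewrite -ea.
by split=> //; apply/eqP; rewrite ohead_rev ?e.
Qed.

Lemma ipath_ip x y s : ipath x y s -> induced_path s.
Proof. by case/and3P. Qed.

Lemma ipath_head x y s : ipath x y s -> x \in s.
Proof. by case/ipathP=> t [-> _ _]; rewrite mem_head. Qed.

Lemma ipath_last x y s : ipath x y s -> y \in s.
Proof. by case/ipathP=> t [-> <- _]; rewrite mem_last. Qed.

Lemma ipath1 x : ipath x x [:: x].
Proof. by rewrite /ipath /= !eqxx. Qed.

Lemma ipath_cons x y z s :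
  sedge x y -> ipath y z s -> (forall v, v \in s -> v != y -> nonadj x v) ->
  ipath x z (x :: s).
Proof.
move=> xy /ipathP[t [-> e h]] hna; apply/ipathP; exists (y :: t); split => //.
rewrite ip_cons2 xy h andbT; apply/allP => v vt; apply: hna; first by rewrite inE vt orbT.
by apply: contraTneq vt => ->; apply: ip_neq.
Qed.

(** The condition [(a == w) && (b == v) || nonadj a b] says that wv is the only contact between W
    and Q; it recurs in all the attachment lemmas. *)
Lemma ipath_join x w v y W Q :
  ipath x w W -> ipath v y Q -> sedge w v ->
  (forall a b, a \in W -> b \in Q -> (a == w) && (b == v) || nonadj a b) ->
  ipath x y (W ++ Q).
Proof.
move=> /ipathP[t [-> e h]] hQ wv; elim: t x e h => [|a t IH] x e h hna; rewrite /= in e.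
  subst x; apply: ipath_cons wv hQ _ => u uQ uv.
  by have := hna w u (mem_head _ _) uQ; rewrite eqxx (negPf uv).
have xw : x != w.
  by apply: contraTneq (ip_neq h) => ->; rewrite -e negbK mem_last.
apply: (ipath_cons (ip_edge h)) => [|u].
  apply: IH => //; first exact: ip_tl h.
  by move=> c b ct; apply: hna; rewrite inE ct orbT.
rewrite -cat_cons mem_cat => /orP[ut|uQ] ua.
  by move: ut; rewrite inE (negPf ua) /= => ut; apply: ip_na h ut.
by have := hna x u (mem_head _ _) uQ; rewrite (negPf xw).
Qed.

Lemma ipath_rev x y s : ipath x y s -> ipath y x (rev s).
Proof.
suff ipr t : induced_path t -> induced_path (rev t).
  by case/and3P=> h h1 h2; rewrite /ipath ipr // revK h1 h2.
elim: t => // a t IH h; rewrite rev_cons -cats1.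
case: t IH h => [//|b t] IH h.
have: ipath (last b t) a (rev (b :: t) ++ [:: a]); last exact: ipath_ip.
have hr : ipath (last b t) b (rev (b :: t)).
  by rewrite /ipath revK /= IH ?(ip_tl h) // ohead_rev !eqxx.
apply: (ipath_join hr (ipath1 a)); first by rewrite sedge_sym (ip_edge h).
move=> c d; rewrite mem_rev !inE => + /eqP->; rewrite eqxx andbT.
by case: eqP => //= _ /(ip_na h); rewrite nonadj_sym.
Qed.

Lemma ip_rev s : induced_path s -> induced_path (rev s).
Proof.
case: s => // x s h; have := @ipath_rev x (last x s) (x :: s).
rewrite {1}/ipath h ohead_rev !eqxx => /(_ isT); exact: ipath_ip.
Qed.

Lemma ip_catr s t : induced_path (s ++ t) -> induced_path t.
Proof. by elim: s => //= x s IH /andP[_ /IH]. Qed.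

Lemma ip_catl s t : induced_path (s ++ t) -> induced_path s.
Proof. by move/ip_rev; rewrite rev_cat => /ip_catr/ip_rev; rewrite revK. Qed.

Lemma ip_cat_na s x y t u v :
  induced_path (s ++ x :: y :: t) -> u \in rcons s x -> v \in y :: t ->
  (u == x) && (v == y) || nonadj u v.
Proof.
elim: s => [|a s IH] h.
  rewrite inE => /eqP->; rewrite inE eqxx; case: eqP => //= _; exact: ip_na h.
have h' := ip_tl h; rewrite rcons_cons inE => /orP[/eqP->|]; last exact: IH.
move=> vt; apply/orP; right; case: s {IH} h h' => [|b s] h h'; first exact: ip_na h _.
by apply: ip_na h _; rewrite mem_cat [v \in x :: _]in_cons vt !orbT.
Qed.

Lemma ipath_glue x z y P Q :
  ipath x z P -> ipath z y (z :: Q) ->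
  (forall a b, a \in P -> b \in Q -> a != z -> nonadj a b) ->
  ipath x y (P ++ Q).
Proof.
move=> hP /ipathP[Q' [[<-] e h]] hna; case: Q e h hna => [|v Q] e h hna.
  by rewrite cats0 -e.
apply: (ipath_join (v := v) hP _ (ip_edge h)).
  by apply/ipathP; exists Q; split=> //; apply: ip_tl h.
move=> a b aP bQ; have [->|az] := eqVneq a z; last by rewrite hna.
by move: bQ; rewrite inE; case: eqP => //= _; apply: ip_na h.
Qed.

(** Jump from x to its last neighbour on the walk: the remainder then contains no further neighbour
    of x, and the recursion continues from there. *)
Lemma ipath_exists x p :
  path sedge x p -> exists2 s, ipath x (last x p) s & {subset s <= x :: p}.
Proof.
have [n] := ubnP (size p); elim: n x p => // n IH x p lt pth.
have [xl|xl] := eqVneq x (last x p).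
  exists [:: x]; first by rewrite -xl ipath1.
  by move=> v; rewrite !inE => ->.
pose q := rev p.
have hasq : has (sedge x) p.
  by case: p pth xl {lt q} => [|a p] /=; rewrite ?eqxx // => /andP[->].
have [p1 [y [p2 [ep xy nop2]]]] :
    exists p1 y p2, [/\ p = p1 ++ y :: p2, sedge x y & ~~ has (sedge x) p2].
  move: hasq; elim: p {lt pth xl q} => //= a p IHp.
  have [hp _|np] := boolP (has (sedge x) p).
    by have [p1 [y [p2 [-> ? ?]]]] := IHp hp; exists (a :: p1), y, p2.
  by rewrite orbF => xa; exists [::], a, p.
have pth2 : path sedge y p2 by move: pth; rewrite ep cat_path /= => /and3P[].
have [|s hs sub] := IH y p2 _ pth2.
  by move: lt; rewrite ep size_cat /=; lia.
have xp2 : x \notin p2.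
  apply/negP => /splitPr E; case: E pth2 nop2 ep => r1 r2.
  case: r2 => [|b r2].
    by move=> _ _ ep; rewrite ep !last_cat /= last_cat /= eqxx in xl.
  rewrite cat_path has_cat /= => /and4P[_ _ xb _].
  by rewrite xb !orbT.
exists (x :: s).
  rewrite ep last_cat /=; apply: ipath_cons xy hs _ => v /sub.
  rewrite inE => /orP[->//|vp2 vy]; apply/andP; split.
    by apply: contraNneq xp2 => ->.
  by move: nop2; rewrite -all_predC => /allP/(_ _ vp2).
move=> v; rewrite inE => /orP[/eqP->|/sub]; first exact: mem_head.
by rewrite ep !inE mem_cat inE => /orP[] ->; rewrite !orbT.
Qed.

Lemma component_ipath S x y :
  x \notin S -> y \in component S x ->
  exists2 s, ipath x y s & {subset s <= component S x}.
Proof.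
move=> xS; rewrite inE => /connectP[p pth ->].
have pth' : path sedge x p by apply: sub_path pth => u v /and3P[].
have [s hs sub] := ipath_exists pth'; exists s => // v /sub.
rewrite inE => /orP[/eqP->|vp]; first exact: component_refl.
by rewrite inE; apply: (path_connect pth); rewrite inE vp orbT.
Qed.

Lemma ipath_nth x0 s i j : induced_path s -> i < j < size s ->
  (nth x0 s i != nth x0 s j) * (sedge (nth x0 s i) (nth x0 s j) = (j == i.+1)).
Proof.
elim: s i j => [|x s IH] i j h; first by rewrite ltn0 andbF.
case: j => [|j]; first by rewrite ltn0.
case: i => [|i] /=; last by rewrite !ltnS => lt; rewrite !IH // (ip_tl h).
case: s h {IH} => [|y t] h lt; first by case: j lt.
case: j lt => [|j] /= lt; first by rewrite sedge_neq (ip_edge h).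
have /(ip_na h) : nth x0 t j \in t by rewrite mem_nth.
by move=> nav; rewrite (nonadj_neq nav) (nonadj_edgeF nav).
Qed.

End InducedPaths.
Arguments induced_path {G} s : simpl never.

Definition emb (H G : sgraph) (f : H -> G) : Prop :=
  injective f /\ {mono f : x y / sedge x y}.

Lemma emb_comp (H K G : sgraph) (f : H -> K) (g : K -> G) :
  emb f -> emb g -> emb (g \o f).
Proof.
by move=> [f1 f2] [g1 g2]; split; [exact: inj_comp|move=> x y /=; rewrite g2 f2].
Qed.

Lemma emb_val (G : sgraph) (S : {set G}) : emb (val : induced S -> G).
Proof. by split=> //; apply: val_inj. Qed.

Lemma giso_sym (G H : sgraph) : G ≅ H -> H ≅ G.
Proof.
case/gisoP=> f [g fK gK] mono; apply/gisoP; exists g; first by exists f.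
by move=> x y; rewrite -mono !gK.
Qed.

Lemma emb_giso (H G : sgraph) (f : H -> G) :
  emb f -> induced (f @: setT) ≅ H.
Proof.
case=> f_inj f_mono; apply: giso_sym; apply/gisoP.
have fS x : f x \in f @: setT by apply: imset_f.
exists (fun x => Sub (f x) (fS x) : induced (f @: setT)); last first.
  by move=> x y; rewrite -[RHS]f_mono.
apply: inj_card_bij; first by move=> x y /(congr1 val)/f_inj.
by rewrite card_sig card_imset // cardsT.
Qed.

Lemma has_inducedP (H G : sgraph) :
  reflect (exists f : H -> G, emb f) (has_induced G H).
Proof.
apply: (iffP existsP) => [[S /giso_sym/gisoP[f bij mono]]|[f /emb_giso]].
  exists (val \o f); apply: emb_comp (emb_val S); split=> //; exact: bij_inj bij.
by exists (f @: setT).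
Qed.

Lemma emb_has_induced (H K G : sgraph) (f : K -> G) :
  emb f -> has_induced K H -> has_induced G H.
Proof.
by move=> fe /has_inducedP[g ge]; apply/has_inducedP; exists (f \o g); apply: emb_comp.
Qed.

Lemma local_indep_emb (K G : sgraph) (f : K -> G) :
  emb f -> local_indep K <= local_indep G.
Proof.
move=> fe; apply/bigmax_leqP => t ht; apply: local_indep_max.
exact: (emb_has_induced fe ht).
Qed.

Lemma card_indep_nbrs (G : sgraph) (x : G) (I : {set G}) :
  (forall a, a \in I -> sedge x a) ->
  (forall a b, a \in I -> b \in I -> a != b -> nonadj a b) ->
  #|I| <= local_indep G.
Proof.
move=> xI naI; apply: local_indep_max; apply/has_inducedP.
pose f (v : biclique 1 #|I|) := match v with inl _ => x | inr i => enum_val i end.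
exists f; split.
- move=> [i|i] [j|j] //= e; first by rewrite (ord1 i) (ord1 j).
  + by have := xI _ (enum_valP j); rewrite -e sedge_irr.
  + by have := xI _ (enum_valP i); rewrite e sedge_irr.
  + by rewrite (enum_val_inj e).
- move=> [i|i] [j|j] /=; rewrite ?sedge_irr ?xI ?enum_valP //.
    by rewrite sedge_sym xI ?enum_valP.
  have [->|ij] := eqVneq i j; first by rewrite sedge_irr.
  apply/nonadj_edgeF/naI; rewrite ?enum_valP //.
  by rewrite (inj_eq enum_val_inj).
Qed.

Section Bones.
Variable G : sgraph.
Implicit Types (x y u v w a b : G) (s t P Q W : seq G).

Lemma emb_path x0 s i : induced_path s -> size s = i.-1.+1 ->
  emb (fun k : path_graph i => nth x0 s k).
Proof.
move=> h si; split=> [j k e|j k].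
  apply/val_inj/eqP; rewrite -(nth_uniq x0 _ _ (ip_uniq h)) ?e ?si ?ltn_ord //.
have jlt := ltn_ord j; have klt := ltn_ord k; rewrite -[sedge j k]/(path_rel j k).
rewrite /path_rel; have [jk|kj|e] := ltngtP j k.
- rewrite (ipath_nth _ h) ?si ?jk // eq_sym; lia.
- rewrite sedge_sym (ipath_nth _ h) ?si ?kj // eq_sym; lia.
- rewrite e sedge_irr; lia.
Qed.

Lemma emb_pendent (H : sgraph) (f : H -> G) (v : H) k (g : 'I_k -> G) :
  emb f -> (forall i j, i != j -> nonadj (g i) (g j)) ->
  (forall h i, f h != g i) -> (forall h i, sedge (f h) (g i) = (h == v)) ->
  emb (fun x : pendent v k => match x with inl h => f h | inr i => g i end).
Proof.
move=> [f_inj f_mono] gna fg fge; split.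
  move=> [h|i] [h'|i'] //= e; first by rewrite (f_inj _ _ e).
  - by move: (fg h i'); rewrite e eqxx.
  - by move: (fg h' i); rewrite e eqxx.
  - congr inr; apply/eqP; apply: contraT => /gna/nonadj_neq; by rewrite e eqxx.
move=> [h|i] [h'|i'] /=; rewrite ?f_mono ?fge //; first by rewrite sedge_sym fge.
have [->|ii] := eqVneq i i'; first by rewrite sedge_irr.
exact/nonadj_edgeF/gna.
Qed.

(* The edges from [x] to [a] and [b] are the two pendent edges of a bone at the end
   [x] of the path [s]. *)
Definition pend s x a b :=
  nonadj a b /\ forall v, v \in s ->
    [/\ v != a, v != b, sedge v a = (v == x) & sedge v b = (v == x)].

Lemma has_bone x y s a b a' b' :
  ipath x y s -> x != y -> pend s x a b -> pend s y a' b' ->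
  [/\ nonadj a a', nonadj a b', nonadj b a' & nonadj b b'] -> has_induced G (bone (size s)).
Proof.
move=> hs xy [ab pab] [ab' pab'] [aa' ab'' ba' bb'].
have [t [es el h]] := ipathP _ _ _ hs.
have si : size s = (size s).-1.+1 by rewrite es.
have e1 := emb_path x h si.
pose g1 (i : 'I_2) := if i == ord0 then a else b.
pose g2 (i : 'I_2) := if i == ord0 then a' else b'.
have I2 (i : 'I_2) : i = ord0 \/ i = ord_max.
  by case: i => -[|[|//]] lt; [left|right]; apply: val_inj.
have mem_s k : nth x s (k : path_graph (size s)) \in s.
  by rewrite mem_nth // [X in _ < X]si.
have [f_inj _] := e1.
have e2 : emb (fun v : pendent (ord0 : path_graph (size s)) 2 =>
    match v with inl h => nth x s h | inr i => g1 i end).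
  apply: emb_pendent => //.
  - by move=> i j; case: (I2 i) => ->; case: (I2 j) => -> //= _; rewrite /g1 //= nonadj_sym.
  - by move=> k i; rewrite /g1; have [] := pab _ (mem_s k); case: ifP.
  - move=> k i; transitivity (nth x s k == x).
      by rewrite /g1; have [_ _] := pab _ (mem_s k); case: ifP.
    by rewrite -[X in _ == X](_ : nth x s (ord0 : path_graph (size s)) = x) ?(inj_eq f_inj) // es.
apply/has_inducedP; exists (fun v : bone (size s) =>
  match v with
  | inl h => match h with inl h => nth x s h | inr i => g1 i end
  | inr i => g2 i end).
apply: (emb_pendent e2).
- by move=> i j; case: (I2 i) => ->; case: (I2 j) => -> //= _; rewrite /g2 //= nonadj_sym.
- move=> [k|i] j; rewrite /g2; first by have [] := pab' _ (mem_s k); case: ifP.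
  by rewrite /g1; case: ifP; case: ifP => _ _; exact: nonadj_neq.
- move=> [k|i] j; last first.
    by rewrite /g1 /g2; case: ifP; case: ifP => _ _; exact: nonadj_edgeF.
  transitivity (nth x s k == y).
    by rewrite /g2; have [_ _] := pab' _ (mem_s k); case: ifP.
  have <- : nth x s (ord_max : path_graph (size s)) = y.
    by rewrite -el es /= -last_nth.
  by rewrite (inj_eq f_inj).
Qed.

End Bones.

Lemma split_first (T : Type) (p : pred T) (s : seq T) :
  has p s -> exists s1 x s2, [/\ s = s1 ++ x :: s2, p x & ~~ has p s1].
Proof.
elim: s => //= x s IH; have [px _|px /= /IH[s1 [y [s2 [-> py h]]]]] := boolP (p x).
  by exists [::], x, s.
by exists (x :: s1), y, s2; rewrite /= negb_or px.
Qed.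

Lemma split_last (T : Type) (p : pred T) (s : seq T) :
  has p s -> exists s1 x s2, [/\ s = s1 ++ x :: s2, p x & ~~ has p s2].
Proof.
rewrite -has_rev => /split_first[s1 [x [s2 [e px h]]]].
exists (rev s2), x, (rev s1); rewrite has_rev; split=> //.
by rewrite -(revK s) e rev_cat rev_cons cat_rcons.
Qed.

(** * Cuts at a single vertex and bones protected by them *)

Section Separation.
Variable G : sgraph.
Implicit Types (x y z u v w a b : G) (s t P Q W : seq G).

Lemma component1_neq z x v : x != z -> v \in component [set z] x -> v != z.
Proof.
move=> xz /(component_notin _); rewrite !in_set1; exact.
Qed.

Lemma component1_step z x u v :
  x != z -> u \in component [set z] x -> v != z -> sedge u v ->
  v \in component [set z] x.
Proof.
move=> xz ux vz; apply: (component_step ux); rewrite in_set1 //.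
exact: component1_neq ux.
Qed.

Lemma ipath_component x y s v :
  ipath x y s -> v \in s -> v != x -> v \in component [set x] y.
Proof.
move=> /ipathP[t [-> e h]]; rewrite inE => /orP[->//|vt vx].
have tx := ip_neq h.
have step u w : u \in t -> w \in t -> sedge u w -> avoid [set x] u w.
  by move=> ut wt uw; apply/and3P; split=> //; rewrite in_set1;
    apply: contraNneq tx => <-.
suff con : {in t, forall w, connect (avoid [set x]) (last x t) w}.
  by rewrite inE -e con.
move: tx h step {vt e}; case: t => // a t tx h step w wt.
have pa : path (avoid [set x]) a t.
  have := ip_tl h; elim: t a {h tx wt} step => //= b t IH a step hp.
  rewrite step ?mem_head ?(ip_edge hp) //= ?inE ?eqxx ?orbT //.
  apply: IH; last exact: ip_tl hp.
  by move=> u v' ut vt; apply: step; rewrite inE ?ut ?vt orbT.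
rewrite /= avoid_sym; apply: (@connect_trans _ _ a).
  by rewrite avoid_sym; apply: (path_connect pa).
apply: (path_connect pa); exact: mem_last.
Qed.

(* Two pendent edges at [x] lead away from [y]: they serve every induced path from
   [x] towards [y]. *)
Definition ext x y := exists a b,
  [/\ nonadj a b, sedge x a, sedge x b,
      a \notin component [set x] y & b \notin component [set x] y].

Lemma ext_eq x y v : v \in component [set x] y -> ext x y -> ext x v.
Proof. by move=> h; rewrite /ext (component_eq h). Qed.

Lemma component_out x y a v : y != x ->
  a != x -> a \notin component [set x] y -> v \in component [set x] y -> nonadj a v.
Proof.
move=> yx ax ay vy; apply/andP; split; first by apply: contraNneq ay => ->.
by apply: contra ay; rewrite sedge_sym; apply: component1_step.
Qed.

Lemma pend_out x y s a b : y != x ->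
  [/\ nonadj a b, sedge x a, sedge x b,
      a \notin component [set x] y & b \notin component [set x] y] ->
  (forall v, v \in s -> v != x -> v \in component [set x] y) -> pend s x a b.
Proof.
move=> yx [ab xa xb ay bY] sy; split=> // v vs.
have [->|vx] := eqVneq v x; first by rewrite !sedge_neq.
have h := sy _ vs vx.
have ax : a != x by rewrite eq_sym sedge_neq.
have bx : b != x by rewrite eq_sym sedge_neq.
have /andP[n1 /negPf n2] := component_out yx ax ay h.
have /andP[n3 /negPf n4] := component_out yx bx bY h.
by split; rewrite ?[sedge v _]sedge_sym ?n2 ?n4 ?(negPf vx) // eq_sym.
Qed.

Lemma ip_rcons_pend x y s a : ipath x y s -> induced_path (rcons s a) ->
  forall v, v \in s -> v != a /\ sedge v a = (v == y).
Proof.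
move=> /ipath_rev/ipathP[t [e _ _]] h.
have {}h : induced_path (a :: y :: t) by rewrite -e -rev_rcons; apply: ip_rev.
move=> v; rewrite -mem_rev e => vt; split.
  by rewrite eq_sym; apply: contraTneq vt => <-; apply: ip_neq.
rewrite sedge_sym; move: vt; rewrite inE => /orP[/eqP->|vt].
  by rewrite eqxx (ip_edge h).
rewrite (nonadj_edgeF (ip_na h vt)); apply/esym/negbTE.
by apply: contraTneq vt => ->; apply: (ip_neq (ip_tl h)).
Qed.

Section BoneSizes.
Variable A : pred nat.
Hypothesis bonesA : forall i, 2 <= i -> has_induced G (bone i) -> A i.

(** The pendent pair at y lies in the component of G - x containing y, the pair at x outside it, so
    no edge joins the pairs. Only the end y has to be controlled by hand. *)
Lemma bone_size x y s a b : x != y -> ipath x y s -> ext x y -> pend s y a b ->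
  A (size s).
Proof.
move=> xy hs [a' [b' h]] hp; have yx : y != x by rewrite eq_sym.
have hp' : pend s x a' b'.
  by apply: (pend_out yx h) => v vs vx; apply: ipath_component hs vs vx.
apply: bonesA.
  have [[//|c [//|d t]] [-> // e _]] := ipathP _ _ _ hs.
  by move: xy; rewrite -e /= eqxx.
apply: (has_bone hs xy hp' hp).
have [ab pab] := hp; have [_ xa' xb' aB bB] := h.
have [xa xb _ _] := pab _ (ipath_head hs).
have [_ _ ya yb] := pab _ (ipath_last hs); rewrite eqxx in ya yb.
have ay : a \in component [set x] y.
  by apply: component1_step yx (component_refl _ _) _ ya; rewrite eq_sym.
have bY : b \in component [set x] y.
  by apply: component1_step yx (component_refl _ _) _ yb; rewrite eq_sym.
by split; apply: (component_out yx) => //; rewrite eq_sym sedge_neq.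
Qed.

Lemma bone_ends x y s :
  x != y -> ipath x y s -> ext x y -> ext y x -> A (size s).
Proof.
move=> xy hs ex [a [b h]]; apply: (bone_size xy hs ex (a := a) (b := b)).
apply: (pend_out xy h) => v vs vy.
by apply: ipath_component (ipath_rev hs) _ vy; rewrite mem_rev.
Qed.

(** For a branching vertex y: two nonadjacent induced continuations of the path beyond y serve as
    the pendent pair there. *)
Lemma bone_leg x y s a b : x != y -> ipath x y s -> ext x y -> nonadj a b ->
  induced_path (rcons s a) -> induced_path (rcons s b) -> A (size s).
Proof.
move=> xy hs ex ab ha hb; apply: (bone_size xy hs ex (a := a) (b := b)).
split=> // v vs; have [-> ->] := ip_rcons_pend hs ha vs.
by have [-> ->] := ip_rcons_pend hs hb vs.
Qed.

End BoneSizes.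
End Separation.

(** * Attaching a third endpoint to a path *)

Section Prefix.
Variable G : sgraph.
Implicit Types (x y z u v w a b : G) (s t P Q W : seq G).

Lemma ipath_split x y v Q1 Q2 :
  ipath x y (Q1 ++ v :: Q2) -> ipath x v (rcons Q1 v) /\ ipath v y (v :: Q2).
Proof.
move=> /and3P[h h1 h2]; split.
  rewrite /ipath (ip_catl (t := Q2) (s := rcons Q1 v)) ?cat_rcons // rev_rcons /= eqxx andbT.
  by case: Q1 h1 {h h2}.
rewrite /ipath (ip_catr h) /= eqxx /=.
by move: h2; rewrite ohead_rev rev_cat lastI rev_rcons.
Qed.

Lemma ip_rcons x y s a : ipath x y s -> sedge y a ->
  (forall v, v \in s -> v != y -> nonadj v a) -> induced_path (rcons s a).
Proof.
move=> hs ya h; rewrite -cats1; apply: (@ipath_ip _ x a).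
apply: (ipath_join hs (ipath1 a) ya) => u b us.
rewrite inE => /eqP->; rewrite eqxx andbT.
by have [//|uy] := eqVneq u y; rewrite h.
Qed.

End Prefix.

Section Attach.
Variables (G : sgraph) (A : pred nat) (E : {set G}).
Hypothesis bonesA : forall i, 2 <= i -> has_induced G (bone i) -> A i.
Hypothesis extE : {in E &, forall x y, x != y -> ext x y}.
Implicit Types (x y z u v w a b e : G) (s t P Q W : seq G).

Lemma endpoints_size x y s : x \in E -> y \in E -> x != y -> ipath x y s -> A (size s).
Proof.
move=> xE yE xy hs; apply: (bone_ends bonesA xy hs); apply: extE => //.
by rewrite eq_sym.
Qed.

(* Below, [x], [y], [e] are endpoints, [Q] is an induced path from [x] to [y], and the
   induced path [W] from [e] touches [Q] only through its last vertex [w]. *)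
Lemma attach_half x y e w v Q1 Q4 W :
  x \in E -> y \in E -> e \in E -> x != y -> e != x ->
  ipath x y (Q1 ++ v :: Q4) -> ipath e w W -> sedge w v ->
  (forall a b, a \in W -> b \in Q1 ++ v :: Q4 -> (a == w) && (b == v) || nonadj a b) ->
  A (size Q1 + size W).+1 /\
  (Q1 != [::] -> Q4 != [::] -> A (size Q1).+1 /\ A (size W).+1).
Proof.
move=> xE yE eE xy ex hQ hW wv cross.
have [hQ1 hQ4] := ipath_split hQ.
have hQr : ipath v x (v :: rev Q1) by rewrite -rev_rcons; apply: ipath_rev.
have J : ipath e x (W ++ v :: rev Q1).
  apply: (ipath_join hW hQr wv) => a b aW bQ; apply: cross => //.
  by move: bQ; rewrite mem_cat !inE mem_rev => /orP[]->; rewrite ?orbT.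
split.
  by have := endpoints_size eE xE ex J; rewrite size_cat /= size_rev addnS addnC.
case: Q4 hQ hQ4 cross => // d Q4 hQ hQ4 cross; case: (lastP Q1) hQ hQ1 J hQr cross => // Q1' c.
rewrite rev_rcons => hQ hQ1 J hQr cross _ _.
have vQ : v \in rcons Q1' c ++ [:: v, d & Q4] by rewrite mem_cat !inE eqxx orbT.
have dQ : d \in rcons Q1' c ++ [:: v, d & Q4] by rewrite mem_cat !inE eqxx !orbT.
have cQ : c \in rcons Q1' c ++ [:: v, d & Q4] by rewrite mem_cat mem_rcons !inE eqxx.
have dv : d != v.
  by apply: contraTneq (ip_neq (ipath_ip hQ4)) => ->; rewrite inE eqxx.
have cv : c != v.
  by apply: contraTneq (ip_neq (ipath_ip hQr)) => ->; rewrite inE eqxx.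
have cd : nonadj c d.
  have := ipath_ip hQ; rewrite cat_rcons => /ip_catr h; apply: (ip_na h); exact: mem_head.
have xv : x != v.
  move: hQ => /ipathP[t [et _ h]].
  have: uniq (rcons (rcons Q1' c) v).
    by apply: ip_uniq; apply: ipath_ip hQ1.
  have xQ : x \in rcons Q1' c.
    by case: (Q1') et => [|q Q1''] /= [-> _]; rewrite ?inE ?eqxx.
  by rewrite rcons_uniq => /andP[+ _]; apply: contraNneq => <-.
have wW := ipath_last hW.
have naw b : b \in rcons Q1' c ++ [:: v, d & Q4] -> b != v -> nonadj w b.
  by move=> bQ bv; have := cross w b wW bQ; rewrite (negPf bv) andbF.
split.
  rewrite -(size_rcons (rcons Q1' c) v).
  apply: (bone_leg (x := x) (y := v) (a := w) (b := d) bonesA) => //.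
  - apply: ext_eq (extE xE yE xy); apply: ipath_component hQ vQ _.
    by rewrite eq_sym.
  - exact: naw.
  - apply: (ip_rcons hQ1); first by rewrite sedge_sym.
    move=> u; rewrite mem_rcons inE => /orP[->//|uQ] uv; rewrite nonadj_sym naw //.
    by rewrite mem_cat uQ.
  - apply: (@ip_catl _ _ Q4); rewrite -cats1 -catA /= cat_rcons.
    exact: ipath_ip hQ.
have hWv : ipath e v (rcons W v).
  rewrite -cats1; apply: (ipath_join hW (ipath1 v) wv) => a b aW.
  by rewrite inE => /eqP->; apply: cross.
have ev : e != v.
  apply: contraTneq (ip_uniq (ipath_ip hWv)) => <-.
  by rewrite rcons_uniq (ipath_head hW).
rewrite -(size_rcons W v).
apply: (bone_leg (x := e) (y := v) (a := c) (b := d) bonesA) => //.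
- apply: ext_eq (extE eE xE ex); apply: ipath_component J _ _.
    by rewrite mem_cat inE eqxx orbT.
  by rewrite eq_sym.
- apply: (@ip_catl _ _ (rev Q1')); rewrite -cats1 -cats1 -!catA /=.
  exact: ipath_ip J.
- apply: (ip_rcons hWv); first exact: ip_edge (ipath_ip hQ4).
  move=> u; rewrite mem_rcons inE => /orP[/eqP->|uW] uv; first by rewrite eqxx in uv.
  by have := cross u d uW dQ; rewrite (negPf dv) andbF.
Qed.

(** The claw shape. The paths from e through v to x and to y join endpoints. If v is interior to Q,
    then on each of the three legs the other two branches at v form the pendent pair. The second
    half comes from reversing Q. *)
Lemma attach_unique x y e w v Q1 Q4 W :
  x \in E -> y \in E -> e \in E -> x != y -> e != x -> e != y ->
  ipath x y (Q1 ++ v :: Q4) -> ipath e w W -> sedge w v ->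
  (forall a b, a \in W -> b \in Q1 ++ v :: Q4 -> (a == w) && (b == v) || nonadj a b) ->
  [/\ A (size Q1 + size W).+1, A (size Q4 + size W).+1 &
    Q1 != [::] -> Q4 != [::] -> [/\ A (size Q1).+1, A (size Q4).+1 & A (size W).+1]].
Proof.
move=> xE yE eE xy ex ey hQ hW wv cross.
have [h1 h2] := attach_half xE yE eE xy ex hQ hW wv cross.
have rQ : rev (Q1 ++ v :: Q4) = rev Q4 ++ v :: rev Q1.
  by rewrite rev_cat rev_cons cat_rcons.
have yx : y != x by rewrite eq_sym.
have := ipath_rev hQ; rewrite rQ => hQr.
have [|h3 h4] := attach_half yE xE eE yx ey hQr hW wv.
  by move=> a b aW; rewrite -rQ mem_rev; apply: cross.
rewrite size_rev in h3; split=> // n1 n4; rewrite size_rev in h4.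
have nr (s : seq G) : s != [::] -> rev s != [::].
  by apply: contraNneq => e0; rewrite -(revK s) e0.
by have [] := h2 n1 n4; have [] := h4 (nr _ n4) (nr _ n1).
Qed.

(* The three sides of the triangle-shaped configuration have an even total size. *)
Lemma attach_triangle x y e w u v Q1 Q4 W : (forall i, A i -> odd i) ->
  x \in E -> y \in E -> e \in E -> x != y -> e != x -> e != y ->
  ipath x y (Q1 ++ u :: v :: Q4) -> ipath e w W -> sedge w u -> sedge w v ->
  (forall a b, a \in W -> b \in Q1 ++ u :: v :: Q4 -> [|| (a == w) && (b == u),
      (a == w) && (b == v) | nonadj a b]) -> False.
Proof.
move=> oddA xE yE eE xy ex ey hQ hW wu wv cross.
have [hQ1 hQ4] := ipath_split hQ.
have [_ hQ5] : ipath x v (rcons (rcons Q1 u) v) /\ ipath v y (v :: Q4).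
  by apply: ipath_split; rewrite cat_rcons.
have hQr : ipath u x (u :: rev Q1) by rewrite -rev_rcons; apply: ipath_rev.
have uniqQ := ip_uniq (ipath_ip hQ).
have J1 : ipath e x (W ++ u :: rev Q1).
  apply: (ipath_join hW hQr wu) => a b aW bQ.
  have bv : b != v.
    apply: contraTneq uniqQ => e0; move: bQ; rewrite e0 inE mem_rev => bQ.
    rewrite -cat_rcons cat_uniq /= negb_and negb_and negbK mem_rcons inE.
    by rewrite bQ !orbT.
  have := cross a b aW; rewrite (negPf bv) andbF; apply.
  by move: bQ; rewrite mem_cat !inE mem_rev => /orP[]->; rewrite ?orbT.
have J2 : ipath e y (W ++ v :: Q4).
  apply: (ipath_join hW hQ5 wv) => a b aW bQ.
  have bu : b != u.
    by apply: contraTneq (ip_neq (ipath_ip hQ4)) => <-; rewrite bQ.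
  have := cross a b aW; rewrite (negPf bu) andbF; apply.
  by rewrite mem_cat [b \in u :: _]in_cons bQ !orbT.
have := oddA _ (endpoints_size xE yE xy hQ).
have := oddA _ (endpoints_size eE xE ex J1).
have := oddA _ (endpoints_size eE yE ey J2).
rewrite !size_cat /= size_rev; move: (size Q1) (size Q4) (size W) => a b c; clear; lia.
Qed.

(** A detour through w replaces M, so neighbours of w inside M do not matter, and w becomes a
    branching vertex with arms towards x, y and e. *)
Lemma attach_far_half x y e w u v M Q1 Q4 W :
  x \in E -> y \in E -> e \in E -> x != y -> e != x -> e != y ->
  ipath x y (Q1 ++ u :: M ++ v :: Q4) -> M != [::] ->
  ipath e w W -> sedge w u -> sedge w v ->
  (forall a b, a \in W -> b \in Q1 ++ u :: M ++ v :: Q4 -> a != w -> nonadj a b) ->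
  w \notin Q1 ++ u :: M ++ v :: Q4 ->
  ~~ has (sedge w) Q1 -> ~~ has (sedge w) Q4 ->
  [/\ A (size Q1).+2, A (size Q1 + size Q4).+3,
     ipath x y (rcons Q1 u ++ w :: v :: Q4) & 2 <= size W -> A (size W)].
Proof.
move=> xE yE eE xy ex ey hQ nM hW wu wv cross wQ no1 no4.
have [hQ1 hQ4] := ipath_split hQ.
have wW := ipath_last hW.
have uv_na b : b \in v :: Q4 -> nonadj u b.
  case: M nM hQ4 {hQ cross wQ} => // m M _ hQ4 bQ; apply: (ip_na (ipath_ip hQ4)).
  by rewrite mem_cat bQ orbT.
have Q1_na a b : a \in Q1 -> b \in v :: Q4 -> nonadj a b.
  case: M nM hQ {cross wQ hQ4} => // m M _ hQ aQ bQ.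
  have := @ip_cat_na _ Q1 u m (M ++ v :: Q4) a b (ipath_ip hQ).
  rewrite mem_rcons inE aQ orbT inE mem_cat bQ !orbT => /(_ isT isT) /orP[/andP[/eqP au _]|//].
  have := ip_uniq (ipath_ip hQ1); rewrite rcons_uniq -au aQ //.
have [_ hQ5] : ipath x v (rcons (Q1 ++ u :: M) v) /\ ipath v y (v :: Q4).
  by apply: ipath_split; rewrite -catA.
have no1' b : b \in Q1 -> nonadj w b.
  move=> bQ; apply/andP; split; last by apply: contra no1 => wb; apply/hasP; exists b.
  by apply: contraNneq wQ => ->; rewrite mem_cat bQ.
have no4' b : b \in Q4 -> nonadj w b.
  move=> bQ; apply/andP; split; last by apply: contra no4 => wb; apply/hasP; exists b.
  by apply: contraNneq wQ => ->; rewrite mem_cat inE mem_cat inE bQ !orbT.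
have hx : ipath x w (rcons (rcons Q1 u) w).
  rewrite -cats1; apply: (ipath_join hQ1 (ipath1 w)); first by rewrite sedge_sym.
  move=> a b; rewrite mem_rcons !inE => /orP[->|aQ] /eqP->; rewrite ?eqxx //.
  by rewrite nonadj_sym no1' ?orbT.
have J : ipath x y (rcons (rcons Q1 u) w ++ v :: Q4).
  apply: (ipath_join hx hQ5 wv) => a b; rewrite mem_rcons inE => /orP[/eqP->|].
    rewrite eqxx inE => /orP[->//|bQ]; by rewrite no4' // orbT.
  rewrite mem_rcons inE => /orP[/eqP->|aQ] bQ; first by rewrite uv_na ?orbT.
  by rewrite Q1_na ?orbT.
have AJ := endpoints_size xE yE xy J.
have [W' [w1 eW]] : exists W' w1, W = rcons W' w1.
  by move: wW; case: (lastP W) => // W' w1 _; exists W', w1.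
have ew : w1 = w.
  by have /and3P[_ _] := hW; rewrite eW rev_rcons /= => /eqP[].
subst w1.
have uW : u \notin W.
  apply/negP => uW; have [uw|uw] := eqVneq u w.
    by move: wu; rewrite uw sedge_irr.
  have := cross u u uW _ uw; rewrite /nonadj eqxx /=.
  by rewrite mem_cat inE eqxx !orbT => /(_ isT).
split.
(* If W is reduced to w, then w = e is an endpoint with its own pendent pair; otherwise the
   predecessor [w2] of w on W and the contact v form the pair. *)
- case: (lastP W') eW => [eW|W'' w2 eW].
    have e1 : e = w by have /and3P[_ + _] := hW; rewrite eW /= => /eqP[].
    have := endpoints_size xE eE (_ : x != e) (_ : ipath x e (rcons (rcons Q1 u) w)).
    by rewrite !size_rcons eq_sym ex e1 => /(_ isT hx).
  have w2W : w2 \in W by rewrite eW mem_rcons inE mem_rcons inE eqxx orbT.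
  have w2w : w2 != w.
    have := ip_uniq (ipath_ip hW); rewrite eW rcons_uniq mem_rcons inE negb_or.
    by rewrite eq_sym => /andP[/andP[]].
  have w2_na b : b \in Q1 ++ u :: M ++ v :: Q4 -> nonadj w2 b.
    by move=> bQ; apply: cross.
  have vx : x != w.
    by apply: contraNneq wQ => <-; apply: ipath_head hQ.
  rewrite -(size_rcons Q1 u) -(size_rcons _ w).
  apply: (bone_leg (x := x) (y := w) (a := w2) (b := v) bonesA) => //.
  + apply: ext_eq (extE xE yE xy); apply: ipath_component J _ _.
      by rewrite mem_cat mem_rcons inE eqxx.
    by rewrite eq_sym.
  + by apply: w2_na; rewrite mem_cat inE mem_cat inE eqxx !orbT.
  + apply: (ip_rcons hx).
      have := ipath_rev hW; rewrite eW !rev_rcons => /ipath_ip; exact: ip_edge.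
    move=> b; rewrite mem_rcons inE => /orP[->//|bQ _]; rewrite nonadj_sym w2_na //.
    by rewrite -cat_rcons mem_cat bQ.
  + apply: (ip_rcons hx wv) => b; rewrite mem_rcons inE => /orP[->//|].
    rewrite mem_rcons inE => /orP[/eqP-> _|bQ _]; first by rewrite uv_na ?mem_head.
    by rewrite Q1_na ?mem_head.
- by move: AJ; rewrite size_cat !size_rcons /= addnS !addSn.
- by rewrite -cat_rcons.
move=> sW.
have hu : induced_path (rcons W u).
  apply: (ip_rcons hW wu) => b bW bw; apply: cross => //.
  by rewrite mem_cat inE eqxx orbT.
have hv : induced_path (rcons W v).
  apply: (ip_rcons hW wv) => b bW bw; apply: cross => //.
  by rewrite mem_cat inE mem_cat inE eqxx !orbT.
have ew : e != w.
  apply: contraTneq sW => e0; case/ipathP: hW => -[[-> //]|a t [-> el h]].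
  by have := ip_neq h; rewrite [X in X \notin _]e0 -[X in X \notin _]el /= mem_last.
apply: (bone_leg (x := e) (y := w) (a := u) (b := v) bonesA) => //.
  have J2 : ipath e x (rcons W u ++ rev Q1).
    rewrite cat_rcons; have hQr : ipath u x (u :: rev Q1).
      by rewrite -rev_rcons; apply: ipath_rev.
    apply: (ipath_join hW hQr wu) => a b aW bQ.
    have bQ' : b \in rcons Q1 u by rewrite mem_rcons inE -mem_rev -in_cons.
    have [->|aw] := eqVneq a w; last first.
      by rewrite cross ?orbT // -cat_rcons mem_cat bQ'.
    move: bQ'; rewrite mem_rcons inE => /orP[->//|bQ1]; by rewrite no1' ?orbT.
  apply: ext_eq (extE eE xE ex); apply: ipath_component J2 _ _.
    by rewrite mem_cat mem_rcons inE wW orbT.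
  by rewrite eq_sym.
by apply: uv_na; rewrite mem_head.
Qed.

Lemma attach_far x y e w u v M Q1 Q4 W :
  x \in E -> y \in E -> e \in E -> x != y -> e != x -> e != y ->
  ipath x y (Q1 ++ u :: M ++ v :: Q4) -> M != [::] ->
  ipath e w W -> sedge w u -> sedge w v ->
  (forall a b, a \in W -> b \in Q1 ++ u :: M ++ v :: Q4 -> a != w -> nonadj a b) ->
  w \notin Q1 ++ u :: M ++ v :: Q4 ->
  ~~ has (sedge w) Q1 -> ~~ has (sedge w) Q4 ->
  [/\ A (size Q1).+2, A (size Q4).+2, A (size Q1 + size Q4).+3,
     ipath x y (rcons Q1 u ++ w :: v :: Q4) & 2 <= size W -> A (size W)].
Proof.
move=> xE yE eE xy ex ey hQ nM hW wu wv cross wQ no1 no4.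
have [h1 h2 h5 h3] := attach_far_half xE yE eE xy ex ey hQ nM hW wu wv cross wQ no1 no4.
have yx : y != x by rewrite eq_sym.
have rQ : rev (Q1 ++ u :: M ++ v :: Q4) = rev Q4 ++ v :: rev M ++ u :: rev Q1.
  by rewrite rev_cat rev_cons rev_cat rev_cons -!cats1 -!catA.
have := ipath_rev hQ; rewrite rQ => hQr.
have nM' : rev M != [::] by apply: contraNneq nM => e0; rewrite -(revK M) e0.
have [||||h4 _ _ _] := attach_far_half yE xE eE yx ey ex hQr nM' hW wv wu _ _ _ _.
- by move=> a b aW; rewrite -rQ mem_rev; apply: cross.
- by rewrite -rQ mem_rev.
- by rewrite has_rev.
- by rewrite has_rev.
by rewrite size_rev in h4.
Qed.

End Attach.

Section Cases.
Variables (G : sgraph) (A : pred nat) (E : {set G}).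
Hypothesis bonesA : forall i, 2 <= i -> has_induced G (bone i) -> A i.
Hypothesis oddA : forall i, A i -> odd i.
Hypothesis extE : {in E &, forall x y, x != y -> ext x y}.
Hypothesis connG : gconnected G.
Implicit Types (x y z u v w a b e : G) (s t P Q W : seq G) (T : {set G}).

Lemma gconnected_ipath x y : exists s, ipath x y s.
Proof.
have [_ /forallP/(_ x)/forallP/(_ y)/connectP[p pth ->]] := andP connG.
by have [s hs _] := ipath_exists pth; exists s.
Qed.

(** Follow a walk from e to T up to its first vertex with a neighbour in T. As every vertex of T has
    a neighbour in T, stopping there also keeps the path outside T. *)
Lemma approach T e (r : G) :
  e \notin T -> r \in T -> (forall u, u \in T -> exists2 v, v \in T & sedge u v) ->
  exists w W, [/\ ipath e w W, {in W, forall a, a \notin T},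
    exists2 v, v \in T & sedge w v &
    forall a b, a \in W -> b \in T -> a != w -> nonadj a b].
Proof.
move=> eT rT adjT.
have [_ /forallP/(_ e)/forallP/(_ r)/connectP[p pth er]] := andP connG.
pose adj v := [exists u in T, sedge v u].
have adjP v : reflect (exists2 u, u \in T & sedge v u) (adj v).
  exact: (iffP exists_inP).
have : has adj (e :: p).
  by apply/hasP; exists r; [rewrite er mem_last|apply/adjP/adjT].
case/split_first=> s1 [w [s2 [ep wadj no1]]].
have wT : w \notin T.
  apply/negP => wT; case: (lastP s1) ep no1 => [|s c] ep.
    by move: ep eT => /= [->] _; rewrite wT.
  rewrite has_rcons negb_or => /andP[/adjP nc _]; case: nc; exists w => //.
  move: pth; case: s ep => [|d s] /= [-> ->]; first by case/andP.
  by rewrite cat_path rcons_path last_rcons /= => /andP[_ /andP[]].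
have [p1 [pp1 lp1 sp1]] : exists p1, [/\ path sedge e p1, last e p1 = w &
    {subset e :: p1 <= rcons s1 w}].
  case: s1 ep no1 => [|d s] /= [<- ep] _.
    by exists [::]; split=> // v; rewrite !inE.
  exists (rcons s w); rewrite last_rcons; split=> //.
  by move: pth; rewrite ep -cat_rcons cat_path => /andP[].
have [W hW sW] := ipath_exists pp1; rewrite lp1 in hW.
have naW a b : a \in W -> b \in T -> a != w -> ~~ sedge a b.
  move=> /sW/sp1; rewrite mem_rcons inE => /orP[->//|as1] bT _.
  apply: contra no1 => ab; apply/hasP; exists a => //; apply/adjP; by exists b.
have WT a : a \in W -> a \notin T.
  move=> aW; have [->//|aw] := eqVneq a w; apply/negP => aT.
  by have [b bT ab] := adjT _ aT; move: (naW _ _ aW bT aw); rewrite ab.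
exists w, W; split=> //; first exact/adjP.
move=> a b aW bT aw; rewrite /nonadj naW // andbT.
by apply: contraTneq bT => <-; apply: WT.
Qed.

Lemma ip_adj s u : induced_path s -> 2 <= size s -> u \in s -> exists2 v, v \in s & sedge u v.
Proof.
move=> h sz /splitPr E0; case: E0 h sz => s1 s2; case: s2 => [|b s2] h.
  case: (lastP s1) h => [//|s' c] h _; exists c.
    by rewrite mem_cat mem_rcons inE eqxx.
  by move: h; rewrite cat_rcons => /ip_catr/ip_edge; rewrite sedge_sym.
move=> _; exists b; first by rewrite mem_cat !inE eqxx !orbT.
exact: ip_edge (ip_catr h).
Qed.

Lemma ipath_size2 x y s : ipath x y s -> x != y -> 2 <= size s.
Proof.
by case/ipathP=> -[|a t] [-> //= <-]; rewrite eqxx.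
Qed.

(** Compare the first and the last neighbour of w on Q: equal (claw), consecutive (triangle,
    excluded by parity), or with a nonempty stretch M between them (detour). *)
Lemma attach_cases x y e Q w W :
  x \in E -> y \in E -> e \in E -> x != y -> e != x -> e != y ->
  ipath x y Q -> ipath e w W -> has (sedge w) Q -> w \notin Q ->
  (forall a b, a \in W -> b \in Q -> a != w -> nonadj a b) ->
  (exists Q1 v Q4, [/\ Q = Q1 ++ v :: Q4,
     {in Q, forall b, sedge w b = (b == v)},
     A (size Q1 + size W).+1, A (size Q4 + size W).+1 &
     Q1 != [::] -> Q4 != [::] ->
       [/\ A (size Q1).+1, A (size Q4).+1 & A (size W).+1]]) \/
  (exists Q1 u M v Q4, [/\ Q = Q1 ++ u :: M ++ v :: Q4, M != [::],
      [/\ sedge w u, sedge w v, ~~ has (sedge w) Q1 & ~~ has (sedge w) Q4],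
      ipath x y (rcons Q1 u ++ w :: v :: Q4) &
      [/\ A (size Q1).+2, A (size Q4).+2, A (size Q1 + size Q4).+3 &
       2 <= size W -> A (size W)]]).
Proof.
move=> xE yE eE xy ex ey hQ hW hasQ wQ cross.
have [Q1 [u [R [eQ wu no1]]]] := split_first hasQ; subst Q.
have uniqQ := ip_uniq (ipath_ip hQ).
have [hasR|noR] := boolP (has (sedge w) R); last first.
  left; exists Q1, u, R.
  have adjE b : b \in Q1 ++ u :: R -> sedge w b = (b == u).
    rewrite mem_cat inE => bQ; have [->//|bu] := eqVneq b u.
    apply/negbTE/negP => wb; move: bQ; rewrite (negPf bu) /= => /orP[bQ|bR].
      by case/negP: no1; apply/hasP; exists b.
    by case/negP: noR; apply/hasP; exists b.
  have [|h1 h2 h3] := attach_unique bonesA extE xE yE eE xy ex ey hQ hW wu.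
    move=> a b aW bQ; have [->|aw] := eqVneq a w; last by rewrite cross ?orbT.
    have [//|bu] := eqVneq b u; rewrite /nonadj adjE // (negPf bu) andbT orFb.
    by apply: contraNneq wQ => ->.
  by split.
have [M [v [Q4 [eR wv no4]]]] := split_last hasR; subst R.
have [eM|nM] := eqVneq M [::].
  subst M; exfalso.
  apply: (attach_triangle bonesA extE oddA xE yE eE xy ex ey hQ hW wu wv).
  move=> a b aW bQ; have [->|aw] := eqVneq a w; last by rewrite cross.
  rewrite /=; have [//|bu] := eqVneq b u; have [//|bv] := eqVneq b v.
  have wb : w != b by apply: contraNneq wQ => ->.
  rewrite /nonadj wb /=; apply/negP => sb; move: bQ.
  rewrite mem_cat !inE (negPf bu) (negPf bv) /= => /orP[bQ|bR].
    by case/negP: no1; apply/hasP; exists b.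
  by case/negP: no4; apply/hasP; exists b.
right; exists Q1, u, M, v, Q4.
have [h1 h2 h3 h4 h5] :=
  attach_far bonesA extE xE yE eE xy ex ey hQ nM hW wu wv cross wQ no1 no4.
by split.
Qed.

End Cases.

Section Three.
Variables (G : sgraph) (A : pred nat) (E : {set G}).
Hypothesis bonesA : forall i, 2 <= i -> has_induced G (bone i) -> A i.
Hypothesis oddA : forall i, A i -> odd i.
Hypothesis extE : {in E &, forall x y, x != y -> ext x y}.
Hypothesis connG : gconnected G.
Implicit Types (x y z u v w a b e : G) (s P Q W : seq G) (T : {set G}).

Lemma ipath_size_gt0 x y s : ipath x y s -> 0 < size s.
Proof. by case/ipathP=> t [-> _ _]. Qed.

Lemma ipath_ends_neq x y s : ipath x y s -> 2 <= size s -> x != y.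
Proof.
case/ipathP=> -[|a t] [-> // <- h] _.
by apply/eqP => e0; have := ip_neq h; rewrite [X in X \notin _]e0 /= mem_last.
Qed.

(** All shapes are brought to one normal form, a path between two endpoints split at z, which
    reduces both values of q to arithmetic. The split vertex is e when e lies on Q, the vertex of
    attachment for a claw, and w for a detour. *)
Lemma three_endpoints x y e :
  x \in E -> y \in E -> e \in E -> x != y -> e != x -> e != y ->
  exists x' y' z Q1 Q2,
    [/\ x' \in E, y' \in E, x' != y', ipath x' y' (Q1 ++ z :: Q2) &
    [/\ A (size Q1).+1, A (size Q2).+1 & A (size Q1 + size Q2).+1]].
Proof.
move=> xE yE eE xy ex ey.
have yx : y != x by rewrite eq_sym.
have [Q hQ] := gconnected_ipath connG x y.
have AQ := endpoints_size bonesA extE xE yE xy hQ.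
have [eQ|eQ] := boolP (e \in Q).
  case/splitPr: eQ hQ AQ => Q1 Q2 hQ AQ; exists x, y, e, Q1, Q2.
  have [hQ1 hQ2] := ipath_split hQ.
  split=> //; split; last by move: AQ; rewrite size_cat /= addnS.
    rewrite -(size_rcons Q1 e); apply: (endpoints_size bonesA extE xE eE _ hQ1).
    by rewrite eq_sym.
  by have := endpoints_size bonesA extE eE yE ey hQ2.
have szQ := ipath_size2 hQ xy.
have [||u|w [W [hW WT [v vQ wv] cross]]] := @approach G connG [set:: Q] e x.
- by rewrite inE.
- by rewrite inE (ipath_head hQ).
- by rewrite inE => /(ip_adj (ipath_ip hQ) szQ)[v vQ uv]; exists v; rewrite ?inE.
have [] := attach_cases bonesA oddA extE xE yE eE xy ex ey hQ hW.
- by apply/hasP; exists v; rewrite // -[_ \in _](in_set (mem Q)).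
- by have := WT _ (ipath_last hW); rewrite inE.
- by move=> a b aW bQ; apply: cross; rewrite ?inE.
- case=> Q1 [c [Q4 [eQ' adjw A1 A4 A14]]].
  have cross' a b : a \in W -> b \in Q -> (a == w) && (b == c) || nonadj a b.
    move=> aW bQ; have [->|aw] := eqVneq a w; last by rewrite cross ?orbT ?inE.
    rewrite /nonadj adjw //; have [//|bc] := eqVneq b c; rewrite andbT.
    by apply: contraTneq bQ => <-; have := WT _ (ipath_last hW); rewrite inE.
  have wc : sedge w c by rewrite adjw ?eqxx // eQ' mem_cat inE eqxx orbT.
  (* Attachment at an end of Q: that endpoint becomes the split vertex of the path from e to the
     other end. *)
  have [e1|n1] := eqVneq Q1 [::].
    subst Q1; have xc : x = c by move: hQ; rewrite eQ' => /ipathP[t [[->]]].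
    subst c; exists e, y, x, W, Q4; split=> //.
      rewrite [x :: Q4](_ : _ = Q) //; exact: ipath_join hW hQ wc cross'.
    split; [exact: A1| |by rewrite addnC].
    by move: AQ; rewrite eQ'.
  have [e4|n4] := eqVneq Q4 [::].
    have hQr := ipath_rev hQ; subst Q4.
    have yc : y = c.
      by move: hQ; rewrite eQ' => /and3P[_ _]; rewrite rev_cat /= => /eqP[->].
    subst c; exists e, x, y, W, (rev Q1); split=> //.
      have -> : y :: rev Q1 = rev Q by rewrite eQ' rev_cat.
      by apply: ipath_join hW hQr wc _ => a b aW; rewrite mem_rev; apply: cross'.
    rewrite size_rev; split; [exact: A4| |by rewrite addnC].
    by move: AQ; rewrite eQ' size_cat addn1.
  have [B1 B4 _] := A14 n1 n4.
  exists x, y, c, Q1, Q4; rewrite -eQ'; split=> //; split=> //.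
  by move: AQ; rewrite eQ' size_cat /= addnS.
case=> Q1 [u [M [c [Q4 [eQ' nM _ hJ [A1 A4 A14 _]]]]]].
exists x, y, w, (rcons Q1 u), (c :: Q4); split=> //.
by rewrite size_rcons /= addnS addSn.
Qed.

End Three.

(** Halves with p or 2p + 1 vertices sharing one vertex make a whole of 2p - 1, 3p or 4p + 1
    vertices, none of which is p or 2p + 1 for p >= 3. *)
Lemma endpoints_le2 (G : sgraph) (p : nat) (E : {set G}) :
  gconnected G -> 3 <= p -> odd p ->
  (forall i, 2 <= i -> has_induced G (bone i) -> pred2 p (2 * p + 1) i) ->
  {in E &, forall x y, x != y -> ext x y} -> #|E| <= 2.
Proof.
move=> connG p3 oddp bonesA extE; rewrite leqNgt; apply/negP => /card_gt2P.
case=> x [y [e [[xE yE eE] [xy ye ex]]]].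
have oddA i : pred2 p (2 * p + 1) i -> odd i by move=> /= /orP[]/eqP->; rewrite // oddD oddM.
have ey : e != y by rewrite eq_sym.
have [x' [y' [z [Q1 [Q2 [_ _ _ _]]]]]] :=
  three_endpoints bonesA oddA extE connG xE yE eE xy ex ey.
by move: (size Q1) (size Q2) => a b [] /=; clear -p3; lia.
Qed.

(** * Spiders *)

Section Spider.
Variables (G : sgraph) (p : nat) (E : {set G}).
Hypothesis (p3 : 3 <= p) (oddp : odd p).
Notation A := (pred2 p (2 * p - 1)).
Hypothesis bonesA : forall i, 2 <= i -> has_induced G (bone i) -> A i.
Hypothesis extE : {in E &, forall x y, x != y -> ext x y}.
Hypothesis connG : gconnected G.
Implicit Types (x y z u v w a b e : G) (s P Q W : seq G) (X : {set G}) (leg : G -> seq G).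

Lemma oddA i : A i -> odd i.
Proof. by move=> /= /orP[]/eqP->; rewrite // oddB ?oddM //; clear -p3; lia. Qed.

(* [leg x] omits the center [z] and ends in [x]. *)
Definition spider z X leg :=
  [/\ X \subset E, {in X, forall x, ipath z x (z :: leg x)},
      {in X, forall x, size (leg x) = p.-1} &
      {in X &, forall x y, x != y ->
        forall a b, a \in leg x -> b \in leg y -> nonadj a b}].

Lemma spider_path z X leg x y : spider z X leg -> x \in X -> y \in X -> x != y ->
  ipath x y (rev (leg x) ++ z :: leg y).
Proof.
move=> [_ hleg _ naleg] xX yX xy; rewrite -cat_rcons -rev_cons.
apply: (ipath_glue (ipath_rev (hleg _ xX)) (hleg _ yX)) => a b.
rewrite mem_rev inE => /orP[->//|ax] bY az; exact: naleg xX yX xy _ _ ax bY.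
Qed.

Lemma spider_ncenter z X leg x : spider z X leg -> x \in X -> z != x.
Proof.
move=> [_ hleg szleg _] xX; have sz := szleg _ xX.
have [t [[<-] e h]] := ipathP _ _ _ (hleg _ xX).
case: (leg x) sz e h => [|b t'] /=; first by clear -p3; lia.
by move=> _ <- h; apply: contraTneq (ip_neq h) => ->; rewrite mem_last.
Qed.

Lemma spider_init : 3 <= #|E| -> exists z X leg, spider z X leg /\ 2 <= #|X|.
Proof.
case/card_gt2P=> x0 [y0 [e [[xE yE eE] [xy ye ex]]]].
have ey : e != y0 by rewrite eq_sym.
have [x [y [z [Q1 [Q2 [{}xE {}yE {}xy hQ [A1 A2 A12]]]]]]] :=
  three_endpoints bonesA oddA extE connG xE yE eE xy ex ey.
have [s1 s2] : size Q1 = p.-1 /\ size Q2 = p.-1.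
  by move: (size Q1) (size Q2) A1 A2 A12 => a b /=; clear -p3; lia.
have [hQ1 hQ2] := ipath_split hQ.
have yx : y != x by rewrite eq_sym.
exists z, [set x; y], (fun v => if v == x then rev Q1 else Q2); split.
  split.
  - by apply/subsetP => v; rewrite !inE => /orP[]/eqP->.
  - move=> v; rewrite !inE => /orP[]/eqP->; rewrite ?eqxx ?(negPf yx) //.
    by rewrite -rev_rcons; apply: ipath_rev.
  - by move=> v; rewrite !inE => /orP[]/eqP->; rewrite ?eqxx ?(negPf yx) ?size_rev.
  have naQ a b : a \in Q1 -> b \in Q2 -> nonadj a b.
    move=> aQ bQ; case: Q2 bQ hQ {A2 A12 s2 hQ2} => // c Q2 bQ hQ.
    have: a \in rcons Q1 z by rewrite mem_rcons inE aQ orbT.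
    move: (mem_head z (c :: Q2)) => zQ.
    have := @ip_cat_na _ Q1 z c Q2 a b (ipath_ip hQ).
    rewrite mem_rcons inE aQ orbT => /(_ isT bQ)/orP[/andP[/eqP az _]|//].
    by have := ip_uniq (ipath_ip hQ1); rewrite rcons_uniq -az aQ.
  move=> u v; rewrite !inE => /orP[]/eqP-> /orP[]/eqP->; rewrite ?eqxx ?(negPf yx) //= => _ a b.
    by rewrite mem_rev; apply: naQ.
  by rewrite mem_rev nonadj_sym => aQ bQ; apply: naQ.
by rewrite cards2 xy.
Qed.

Lemma exists_other X x : 2 <= #|X| -> x \in X -> exists2 y, y \in X & x != y.
Proof.
move=> X2 xX; have [/pred0P X0|/pred0Pn[y /andP[/= yx yX]]] := boolP (pred0b [pred y | (y != x) && (y \in X)]).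
  move: X2; rewrite (cardsD1 x) xX ltnS card_gt0 => /set0Pn[y].
  by rewrite !inE; have := X0 y => /= ->.
by exists y; rewrite // eq_sym.
Qed.

(** A connection W from e either touches the spider only at z and is a new leg, or its last vertex w
    sees the heads of all legs and can replace z; then either w = e, or the rest of W is a new leg.
    The clause on [z \in E] guarantees that an endpoint serving as center is never given up, so
    repeated extension makes progress. *)
Lemma spider_extend z X leg e :
  spider z X leg -> 2 <= #|X| -> e \in E -> e != z -> e \notin X ->
  exists z' X' leg', [/\ spider z' X' leg', 2 <= #|X'|,
    X \subset X', z \in E -> z = z' & e \in z' |: X'].
Proof.
move=> sp X2 eE ez eX; have [/subsetP XE hleg szleg naleg] := sp.
have ncen x : x \in X -> z != x by exact: spider_ncenter sp.
have ex x : x \in X -> e != x by move=> xX; apply: contraNneq eX => ->.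
have zleg x : x \in X -> z \notin leg x.
  by move=> xX; apply: ip_neq (ipath_ip (hleg _ xX)).
have legcons x : x \in X -> exists h t, leg x = h :: t.
  by move=> xX; have := szleg _ xX; case: (leg x) => [|h t] /=; [clear -p3; lia|exists h, t].
pose T := [set v | (v == z) || [exists x in X, v \in leg x]].
have legT x v : x \in X -> v \in leg x -> v \in T.
  by move=> xX vx; rewrite inE; apply/orP; right; apply/exists_inP; exists x.
have zT : z \in T by rewrite inE eqxx.
have TP v : v \in T -> v = z \/ exists2 x, x \in X & v \in leg x.
  by rewrite inE => /orP[/eqP|/exists_inP]; [left|right].
have eT : e \notin T.
  apply/negP => /TP[/eqP|[x xX eleg]]; first by rewrite (negPf ez).
  have := hleg _ xX; have := szleg _ xX; case/splitPr: eleg => l1 l2 sz.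
  rewrite -cat_cons => /ipath_split[_ h].
  have := endpoints_size bonesA extE eE (XE _ xX) (ex _ xX) h.
  by move: sz; rewrite size_cat /=; move: (size l1) (size l2) => a b; clear -p3; lia.
have legnbr x v : x \in X -> v \in z :: leg x -> exists2 u, u \in T & sedge v u.
  move=> xX vx; have [|u ux vu] := ip_adj (ipath_ip (hleg _ xX)) _ vx.
    by rewrite /= szleg //; clear -p3; lia.
  by exists u => //; move: ux; rewrite inE => /orP[/eqP->//|]; apply: legT.
have [x0 x0X] : exists x0, x0 \in X by apply/set0Pn; rewrite -card_gt0; clear -X2; lia.
have [||v vT|w [W [hW WT [v vT wv] cross]]] := @approach G connG T e z.
- exact: eT.
- exact: zT.
- case: (TP _ vT) => [->|[x xX vx]]; first by apply: (legnbr x0); rewrite ?mem_head.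
  by apply: (legnbr x); rewrite // inE vx orbT.
have wT := WT _ (ipath_last hW).
pose ztype x := [/\ size W = p.-1, sedge w z & ~~ has (sedge w) (leg x)].
pose htype x := sedge w (head z (leg x)) /\ ~~ has (sedge w) (behead (leg x)).
(* The path along two legs has 2p - 1 vertices. A single contact must halve it, so it is z. Two
   distant contacts leave p - 2 vertices on either side and skip exactly one, so they are the heads
   of the two legs and z is skipped. *)
have types x y : x \in X -> y \in X -> x != y ->
    has (sedge w) (rev (leg x) ++ z :: leg y) ->
  (ztype x /\ ztype y) \/ (htype x /\ htype y).
  move=> xX yX xy hasw; have hL := spider_path sp xX yX xy.
  have LT b : b \in rev (leg x) ++ z :: leg y -> b \in T.
    rewrite mem_cat mem_rev inE => /orP[|/orP[/eqP->//|]]; exact: legT.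
  have szL : size (rev (leg x) ++ z :: leg y) = (2 * p - 1)%N.
    by rewrite size_cat size_rev /= !szleg //; clear -p3; lia.
  have [] := attach_cases bonesA oddA extE (XE _ xX) (XE _ yX) eE xy (ex _ xX) (ex _ yX) hL hW hasw.
  - by apply: contra wT; apply: LT.
  - by move=> a b aW /LT bT; apply: cross.
  - case=> Q1 [c [Q4 [eQ adjw A1 A4 A14]]]; left.
    have W0 := ipath_size_gt0 hW.
    have sz : size Q1 + size Q4 + 1 = (2 * p - 1)%N by rewrite -szL eQ size_cat /=; clear; lia.
    have [n1 n4] : Q1 != [::] /\ Q4 != [::].
      split; apply/negP => /eqP e0; move: sz A1 A4; rewrite e0 /=;
      move: (size Q1) (size Q4) (size W) W0 => a b c'; clear -p3; lia.
    have [s1 s4 sW] : [/\ size Q1 = p.-1, size Q4 = p.-1 & size W = p.-1].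
      have [] := A14 n1 n4; move: sz A1 A4 W0; rewrite /=.
      by move: (size Q1) (size Q4) (size W) => a b c'; clear -p3 => *; split; lia.
    have /eqP : rev (leg x) ++ z :: leg y = Q1 ++ c :: Q4 by [].
    rewrite eqseq_cat ?size_rev ?szleg ?s1 // eqseq_cons => /and3P[/eqP e1 /eqP ec _].
    subst c; have wz : sedge w z by rewrite adjw ?eqxx // mem_cat inE eqxx orbT.
    split; split=> //; apply/hasPn => b bleg.
      rewrite adjw ?mem_cat ?mem_rev ?bleg //.
      by apply: contraTneq bleg => ->; apply: zleg.
    rewrite adjw ?mem_cat ?inE ?bleg ?orbT //.
    by apply: contraTneq bleg => ->; apply: zleg.
  case=> Q1 [u [M [c [Q4 [eQ nM [wu wc no1 no4] _ [A1 A4 A14 _]]]]]]; right.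
  have sz : size Q1 + size M + size Q4 + 2 = (2 * p - 1)%N.
    by rewrite -szL eQ size_cat /= size_cat /=; clear; lia.
  have M0 : 0 < size M by case: (M) nM.
  have [s1 s4 sM] : [/\ size Q1 = p.-2, size Q4 = p.-2 & size M = 1].
    move: sz A1 A4 A14 M0; rewrite /=.
    by move: (size Q1) (size Q4) (size M) => a b c'; clear -p3 => *; split; lia.
  case: M sM eQ {nM sz M0} => [//|m [|//]] _ eQ.
  have : rev (leg x) ++ z :: leg y = rcons Q1 u ++ m :: c :: Q4.
    by rewrite eQ cat_rcons.
  move=> /eqP; rewrite eqseq_cat ?size_rev ?size_rcons ?szleg ?s1 //; last by clear -p3; lia.
  rewrite eqseq_cons => /and3P[/eqP e1 /eqP ec /eqP e2].
  have ex1 : leg x = u :: rev Q1 by rewrite -(revK (leg x)) e1 rev_rcons.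
  by rewrite /htype ex1 e2 /= has_rev.
have hE x b : x \in X -> htype x -> b \in leg x -> sedge w b = (b == head z (leg x)).
  move=> xX [wh no] bleg; have [h [t el]] := legcons _ xX.
  move: wh no bleg; rewrite el /= => wh no; rewrite inE.
  have [-> //|bh /= bt] := eqVneq b h.
  by apply/negbTE; apply: (hasPn no).
have hedge x y b : x \in X -> y \in X -> x != y -> b \in z :: leg x -> sedge w b ->
    has (sedge w) (rev (leg x) ++ z :: leg y).
  move=> xX yX xy bx wb; apply/hasP; exists b => //.
  by move: bx; rewrite mem_cat mem_rev !inE => /orP[]->; rewrite ?orbT.
have [/exists_inP[x1 x1X wh1]|/exists_inPn nohead] :=
  boolP [exists x in X, sedge w (head z (leg x))]; last first.
  (* w only touches the center *)
  have noh x : x \in X -> ~ htype x.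
    by move=> xX [wh _]; case/negP: (nohead _ xX).
  have wz : sedge w z.
    case: (TP _ vT) => [<-//|[x xX vx]]; have [y yX xy] := exists_other X2 xX.
    have [] := types _ _ xX yX xy (hedge _ _ v xX yX xy _ wv); first by rewrite inE vx orbT.
      by case=> -[].
    by case=> /noh; case.
  have allz x : x \in X -> ztype x.
    move=> xX; have [y yX xy] := exists_other X2 xX.
    have [] := types _ _ xX yX xy (hedge _ _ z xX yX xy (mem_head _ _) wz).
      by case.
    by case=> /noh; case.
  have [sW _ _] := allz _ x0X.
  have naW x a b : x \in X -> a \in W -> b \in leg x -> nonadj a b.
    move=> xX aW bx; have [->|aw] := eqVneq a w; last by apply: cross; rewrite // (legT x).
    apply/andP; split; first by apply: contraNneq wT => ->; apply: legT bx.
    by have [_ _ /hasPn] := allz _ xX; apply.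
  exists z, (e |: X), (fun v => if v == e then rev W else leg v); split.
  - split.
    + by apply/subsetP => u; rewrite !inE => /orP[/eqP->//|/XE].
    + move=> u; rewrite !inE => /orP[/eqP->|uX]; last by rewrite eq_sym (negPf (ex _ uX)); apply: hleg.
      rewrite eqxx; apply: (ipath_cons _ (ipath_rev hW)); first by rewrite sedge_sym.
      by move=> c; rewrite mem_rev => cW cw; rewrite nonadj_sym cross.
    + move=> u; rewrite !inE => /orP[/eqP->|uX]; first by rewrite eqxx size_rev.
      by rewrite eq_sym (negPf (ex _ uX)); apply: szleg.
    + move=> u u'; rewrite !inE => /orP[/eqP->|uX] /orP[/eqP->|uX']; rewrite ?eqxx //.
      * rewrite [u' == e]eq_sym (negPf (ex _ uX')) => _ a b; rewrite mem_rev; exact: naW.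
      * rewrite [u == e]eq_sym (negPf (ex _ uX)) => _ a b; rewrite mem_rev nonadj_sym => au bW; exact: naW bW au.
      * rewrite ![_ == e]eq_sym (negPf (ex _ uX)) (negPf (ex _ uX')); exact: naleg.
  - by rewrite cardsU1 eX; clear -X2; lia.
  - exact: subsetUr.
  - by [].
  - by rewrite !inE eqxx orbT.
(* w touches the head of every leg, and can replace the center *)
have allh x : x \in X -> htype x.
  have step y x' : x' \in X -> y \in X -> x' != y -> sedge w (head z (leg x')) -> htype x' /\ htype y.
    move=> xX yX xy wh; have [] := types _ _ xX yX xy (hedge _ _ _ xX yX xy _ wh).
    - by have [h [t ->]] := legcons _ xX; rewrite !inE eqxx orbT.
    - case=> -[_ _ /hasPn noh]; exfalso.
      have [h [t el]] := legcons _ xX; move: wh; rewrite el /= => wh.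
      by have := noh h; rewrite el mem_head wh => /(_ isT).
    - by [].
  move=> xX; have [->|xx] := eqVneq x x1; last by have [] := step x x1 x1X xX _ wh1; rewrite 1?eq_sym.
  by have [y yX xy] := exists_other X2 x1X; have [] := step y x1 x1X yX xy wh1.
(* W followed by a leg joins two endpoints by |W| + p - 1 vertices, which must be p or 2p - 1. *)
have szW : size W = 1 \/ size W = p.
  have hx := hleg _ x1X; have [h [t el]] := legcons _ x1X.
  have hl : ipath h x1 (h :: t).
    move: hx; rewrite el -[z :: h :: t]/([:: z] ++ h :: t); by case/ipath_split.
  have [wh _] := allh _ x1X; rewrite el /= in wh.
  have J : ipath e x1 (W ++ h :: t).
    apply: (ipath_join hW hl wh) => a b aW bl; have bT : b \in T by apply: (legT x1); rewrite ?el.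
    have [->|aw] := eqVneq a w; last by rewrite cross ?orbT.
    have [//|bh] := eqVneq b h; rewrite -el in bl.
    rewrite /nonadj (hE x1 b x1X (allh _ x1X) bl) el /= bh ?andbT.
    by apply: contraNneq wT => ->.
  have := endpoints_size bonesA extE eE (XE _ x1X) (ex _ x1X) J.
  have := szleg _ x1X; rewrite el size_cat /=.
  have := ipath_size_gt0 hW; move: (size W) (size t) => a b; clear -p3; lia.
(* Otherwise z and w form a pendent pair at the head of a leg, and this leg carries a bone of even
   size p - 1. *)
have wz : sedge w z.
  apply: contraT => nwz.
  have [y yX xy] := exists_other X2 x1X; have hL := spider_path sp x1X yX xy.
  have [h [t el]] := legcons _ x1X.
  have hl : ipath x1 h (rev (h :: t)).
    by apply: ipath_rev; move: (hleg _ x1X); rewrite el -[z :: h :: t]/([:: z] ++ h :: t); case/ipath_split.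
  have t0 : 0 < size t by have := szleg _ x1X; rewrite el /=; clear -p3; lia.
  have xh : x1 != h.
    by apply: (ipath_ends_neq hl); rewrite size_rev.
  have : A (size (rev (h :: t))).
    apply: (bone_leg (x := x1) (y := h) (a := z) (b := w) bonesA) => //.
    - apply: ext_eq (extE (XE _ x1X) (XE _ yX) xy); apply: ipath_component hL _ _.
        by rewrite mem_cat mem_rev el mem_head.
      by rewrite eq_sym.
    - by rewrite nonadj_sym /nonadj nwz andbT; apply: contraNneq wT => ->.
    - by rewrite -rev_cons -el; apply: ip_rev; apply: ipath_ip (hleg _ x1X).
    - apply: (ip_rcons hl).
        by rewrite sedge_sym; have [] := allh _ x1X; rewrite el.
      move=> b; rewrite mem_rev -el => bl bh; rewrite nonadj_sym.
      rewrite /nonadj (hE x1 b x1X (allh _ x1X) bl) el /= bh andbT.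
      by apply: contraNneq wT => ->; apply: legT bl.
  have := szleg _ x1X; rewrite el size_rev /= => ->.
  by clear -p3 oddp; move/oddA; case: p p3 oddp => //= k _ /negPf->.
(* W followed by z would join two endpoints by 2 or p + 1 vertices, an even number. *)
have zE : z \in E -> False.
  move=> zE; have hz : ipath e z (rcons W z).
    rewrite -cats1; apply: (ipath_join hW (ipath1 z) wz) => a b aW.
    rewrite inE => /eqP->; rewrite eqxx andbT.
    by have [//|aw] := eqVneq a w; rewrite cross.
  have := oddA (endpoints_size bonesA extE eE zE ez hz).
  by rewrite size_rcons /=; case: szW => -> //; rewrite oddp.
have leghead x : x \in X -> ipath w x (w :: leg x).
  move=> xX; have [h [t el]] := legcons _ xX.
  have hl : ipath h x (leg x).
    by move: (hleg _ xX); rewrite el -[z :: h :: t]/([:: z] ++ h :: t); case/ipath_split.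
  apply: (ipath_cons _ hl); first by have [] := allh _ xX; rewrite el.
  move=> b bl bh; rewrite /nonadj (hE x b xX (allh _ xX) bl) el /= bh andbT.
  by apply: contraNneq wT => ->; apply: legT bl.
case: szW => sW.
  have we : w = e.
    by case/ipathP: hW sW => t [-> el _]; case: t el.
  exists w, X, leg; split=> //; first by split=> //; apply/subsetP.
    by rewrite !inE we eqxx.
have ew : e != w.
  by apply: (ipath_ends_neq hW); rewrite sW; clear -p3; lia.
have [W' eW] : exists W', W = rcons W' w.
  have /and3P[_ _] := hW; case: (lastP W) => // W' w1; rewrite rev_rcons => /eqP[->].
  by exists W'.
have naW x a b : x \in X -> a \in W' -> b \in leg x -> nonadj a b.
  move=> xX aW bx; apply: cross; first by rewrite eW mem_rcons inE aW orbT.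
    exact: legT bx.
  have := ip_uniq (ipath_ip hW); rewrite eW rcons_uniq => /andP[+ _].
  by apply: contraNneq => <-.
exists w, (e |: X), (fun v => if v == e then rev W' else leg v); split.
- split.
  + by apply/subsetP => u; rewrite !inE => /orP[/eqP->//|/XE].
  + move=> u; rewrite !inE => /orP[/eqP->|uX]; last by rewrite eq_sym (negPf (ex _ uX)); apply: leghead.
    by rewrite eqxx -rev_rcons -eW; apply: ipath_rev.
  + move=> u; rewrite !inE => /orP[/eqP->|uX]; last by rewrite eq_sym (negPf (ex _ uX)); apply: szleg.
    by rewrite eqxx size_rev -sW eW size_rcons.
  + move=> u u'; rewrite !inE => /orP[/eqP->|uX] /orP[/eqP->|uX']; rewrite ?eqxx //.
    * rewrite [u' == e]eq_sym (negPf (ex _ uX')) => _ a b; rewrite mem_rev; exact: naW.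
    * rewrite [u == e]eq_sym (negPf (ex _ uX)) => _ a b; rewrite mem_rev nonadj_sym => au bW; exact: naW bW au.
    * rewrite ![_ == e]eq_sym (negPf (ex _ uX)) (negPf (ex _ uX')); exact: naleg.
- by rewrite cardsU1 eX; clear -X2; lia.
- exact: subsetUr.
- by [].
- by rewrite !inE eqxx orbT.
Qed.

End Spider.

(** Stronger than [ext x y] for every y: one pair serves all other members of E at once. This
    uniformity is needed when the center of a spider is itself an endpoint and its pair must avoid
    all legs. *)
Definition endpoint (G : sgraph) (E : {set G}) (x : G) := exists a b,
  [/\ nonadj a b, sedge x a, sedge x b & forall y, y \in E -> y != x ->
      (a \notin component [set x] y) && (b \notin component [set x] y)].

Lemma endpoint_ext (G : sgraph) (E : {set G}) :
  {in E, forall x, endpoint E x} -> {in E &, forall x y, x != y -> ext x y}.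
Proof.
move=> endE x y xE yE; rewrite eq_sym => yx.
have [a [b [ab xa xb /(_ _ yE yx)/andP[]]]] := endE x xE.
by exists a, b.
Qed.

(** * Spiders covering all endpoints, and how many there can be *)

Section Cover.
Variables (G : sgraph) (p : nat) (E : {set G}).
Hypothesis (p3 : 3 <= p) (oddp : odd p).
Notation A := (pred2 p (2 * p - 1)).
Hypothesis bonesA : forall i, 2 <= i -> has_induced G (bone i) -> A i.
Hypothesis endE : {in E, forall x, endpoint E x}.
Hypothesis connG : gconnected G.
Implicit Types (x y z u v w a b e : G) (s P Q W : seq G) (X : {set G}) (leg : G -> seq G).

Lemma spider_cover : 3 <= #|E| -> exists z X leg,
  [/\ spider p E z X leg, 2 <= #|X| & E \subset z |: X].
Proof.
have extE := endpoint_ext endE.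
move=> /(spider_init p3 oddp bonesA extE connG) [z [X [leg [sp X2]]]].
have [k] := ubnP #|E :\: (z |: X)|; elim: k z X leg sp X2 => // k IH z X leg sp X2 lt.
have [sub|/subsetPn[e eE]] := boolP (E \subset z |: X); first by exists z, X, leg.
rewrite !inE negb_or => /andP[ez eX].
have [z' [X' [leg' [sp' X2' sX zz eX']]]] :=
  spider_extend p3 oddp bonesA extE connG sp X2 eE ez eX.
apply: IH sp' X2' _; apply: leq_trans (_ : #|E :\: (z |: X)| <= k); last by [].
apply/proper_card/properP; split; last first.
  by exists e; rewrite !inE ?(negPf ez) ?(negPf eX) ?eE //; move: eX'; rewrite !inE => ->.
apply/subsetP => u; rewrite !inE !negb_or => /andP[/andP[uz' uX'] uE].
rewrite uE andbT; apply/andP; split; last by apply: contra uX'; apply: (subsetP sX).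
by apply: contraNneq uz' => uz; rewrite uz in uE *; rewrite -(zz uE).
Qed.

(** The heads of the legs together with J form an independent set of neighbours of z. *)
Lemma spider_card z X leg (J : {set G}) : spider p E z X leg ->
  (forall a, a \in J -> sedge z a) ->
  (forall a b, a \in J -> b \in J -> a != b -> nonadj a b) ->
  (forall a x, a \in J -> x \in X -> a \notin component [set z] x) ->
  #|X| + #|J| <= local_indep G.
Proof.
move=> sp zJ naJ outJ; have [_ hleg szleg naleg] := sp.
have ncen x : x \in X -> z != x by exact: spider_ncenter sp.
have legcons x : x \in X -> exists h t, leg x = h :: t.
  by move=> xX; have := szleg _ xX; case: (leg x) => [|h t] /=; [clear -p3; lia|exists h, t].
pose hd x := head z (leg x).
have hdleg x : x \in X -> hd x \in leg x.
  by rewrite /hd => /legcons[h [t ->]]; rewrite mem_head.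
have hdz x : x \in X -> sedge z (hd x).
  rewrite /hd => xX; have [h [t el]] := legcons _ xX.
  by rewrite el /=; have := ipath_ip (hleg _ xX); rewrite el => /ip_edge.
have hd_na x y : x \in X -> y \in X -> x != y -> nonadj (hd x) (hd y).
  by move=> xX yX xy; apply: (naleg _ _ xX yX xy); apply: hdleg.
have hd_inj : {in X &, injective hd}.
  move=> x y xX yX e; apply/eqP; apply: contraT => /(hd_na _ _ xX yX)/nonadj_neq.
  by rewrite e eqxx.
have hd_comp x : x \in X -> hd x \in component [set z] x.
  move=> xX; apply: ipath_component (hleg _ xX) _ _; first by rewrite inE hdleg ?orbT.
  by rewrite eq_sym sedge_neq ?hdz.
have Jhd a x : a \in J -> x \in X -> nonadj a (hd x).
  move=> aJ xX; apply: component_out (outJ _ _ aJ xX) (hd_comp _ xX).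
    by rewrite eq_sym ncen.
  by rewrite eq_sym sedge_neq ?zJ.
rewrite -(card_in_imset hd_inj) -cardsUI.
have -> : hd @: X :&: J = set0.
  apply/setP => u; rewrite !inE; apply/negP => /andP[/imsetP[x xX ->] hJ].
  by have := nonadj_neq (Jhd _ _ hJ xX); rewrite eqxx.
rewrite cards0 addn0; apply: (@card_indep_nbrs _ z).
  by move=> u; rewrite inE => /orP[/imsetP[x xX ->]|/zJ//]; apply: hdz.
move=> u v; rewrite !inE => /orP[/imsetP[x xX ->]|uJ] /orP[/imsetP[y yX ->]|vJ] uv.
- by apply: hd_na => //; apply: contraNneq uv => ->.
- by rewrite nonadj_sym Jhd.
- exact: Jhd.
- exact: naJ.
Qed.

Lemma spider_notin z X leg : spider p E z X leg -> z \notin X.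
Proof.
by move=> sp; apply/negP => zX; have := spider_ncenter p3 sp zX; rewrite eqxx.
Qed.

(** The pendent pair of the center adds two neighbours to the heads of the at least |E| - 1 legs. *)
Lemma spider_center_card z X leg : spider p E z X leg -> E \subset z |: X ->
  z \in E -> #|E| < local_indep G.
Proof.
move=> sp sub zE; have [a [b [ab za zb out]]] := endE zE.
have [/subsetP XE _ _ _] := sp.
have := @spider_card z X leg [set a; b] sp.
rewrite cards2 nonadj_neq //= => h.
have zX := spider_notin sp.
have : #|E| <= #|X|.+1.
  by apply: leq_trans (subset_leq_card sub) _; rewrite cardsU1 zX.
suff : #|X| + 2 <= local_indep G by lia.
apply: h.
- by move=> u; rewrite !inE => /orP[]/eqP->.
- move=> u v; rewrite !inE => /orP[]/eqP-> /orP[]/eqP->; rewrite ?eqxx //.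
  by rewrite nonadj_sym.
- move=> u x uJ xX; have xz : x != z by apply: contraNneq zX => <-.
  have /andP[h1 h2] := out _ (XE _ xX) xz.
  by move: uJ; rewrite in_set2 => /orP[]/eqP->.
Qed.

Lemma endpoints_le : 2 <= local_indep G -> #|E| <= local_indep G.
Proof.
move=> l2; have [E2|E3] := leqP #|E| 2; first exact: leq_trans E2 l2.
have [z [X [leg [sp X2 sub]]]] := spider_cover E3.
have [zE|zE] := boolP (z \in E); first by apply: ltnW; apply: spider_center_card sp sub zE.
have /subset_leq_card h : E \subset X.
  apply/subsetP => u uE; have := subsetP sub _ uE; rewrite !inE => /orP[/eqP e|//].
  by rewrite -e uE in zE.
apply: leq_trans h _.
have := @spider_card z X leg set0 sp; rewrite cards0 addn0; apply; by move=> ?; rewrite inE.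
Qed.

Lemma spider_full : 3 <= #|E| -> local_indep G <= #|E| ->
  exists z leg, z \notin E /\ spider p E z E leg.
Proof.
move=> E3 lE; have [z [X [leg [sp X2 sub]]]] := spider_cover E3.
have zE : z \notin E.
  by apply/negP => zE; have := spider_center_card sp sub zE; rewrite ltnNge lE.
have eX : X = E.
  have [/subsetP XE _ _ _] := sp; apply/setP => u; apply/idP/idP => [/XE//|uE].
  by have := subsetP sub _ uE; rewrite !inE => /orP[/eqP e|//]; rewrite -e uE in zE.
by exists z, leg; rewrite eX in sp.
Qed.
End Cover.

(** * Minimum barriers of critical graphs *)

Section Connectivity.
Variable G : sgraph.
Implicit Types (x y z u v w a b : G) (s P Q : seq G) (S K U : {set G}).

Lemma gconnected_closed K u v : gconnected G ->
  (forall a b, a \in K -> sedge a b -> b \in K) -> u \in K -> v \in K.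
Proof.
case/andP=> _ /forallP/(_ u)/forallP/(_ v)/connectP[p pth ->] clK uK.
elim: p u uK pth => //= a p IH u uK /andP[ua]; apply: IH; exact: clK ua.
Qed.

Lemma gconnected_component S x : x \notin S -> gconnected (induced (component S x)).
Proof.
move=> xS; pose r : induced (component S x) := Sub x (component_refl S x).
have con (v : induced (component S x)) : connect sedge r v.
  suff h u : u \in component S x -> forall ux : u \in component S x, connect sedge r (Sub u ux).
    by case: v => v vx; apply: (h v vx vx).
  move: u; apply: (component_ind (P := fun v => forall vx : v \in component S x,
            connect sedge r (Sub v vx))).
    by move=> vx; rewrite (_ : Sub x vx = r) //; apply: val_inj.
  move=> a b ax IH aS bS ab bx; apply: connect_trans (IH ax) (connect1 _).
  exact: ab.
apply/andP; split; first by apply/card_gt0P; exists r.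
apply/forallP => a; apply/forallP => b.
apply: (@connect_trans _ _ r) (con b).
by rewrite (sym_connect_sym (@sedge_sym _)).
Qed.

Lemma ipath_avoid u v x Q : ipath u v Q -> x \notin Q -> v \in component [set x] u.
Proof.
case/ipathP=> t [-> <- h] xQ; rewrite inE; apply/connectP; exists t => //.
elim: t u h xQ => //= a t IH u h; rewrite !inE !negb_or => /and3P[xu xa xt].
rewrite IH ?(ip_tl h) ?inE ?negb_or ?xa // andbT.
by apply/and3P; rewrite !in_set1 ![_ == x]eq_sym xu xa (ip_edge h).
Qed.

Lemma ipath_sep_cat x z y P Q : x != z -> y \notin component [set z] x -> y != z ->
  ipath x z P -> ipath z y (z :: Q) -> ipath x y (P ++ Q).
Proof.
move=> xz yx yz hP hQ; apply: (ipath_glue hP hQ) => a b aP bQ az.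
have ax : a \in component [set z] x.
  by apply: ipath_component (ipath_rev hP) _ az; rewrite mem_rev.
have bz : b != z.
  by apply: contraTneq bQ => ->; apply: ip_neq (ipath_ip hQ).
have bY : b \in component [set z] y.
  by apply: ipath_component hQ _ bz; rewrite inE bQ orbT.
apply: (component_out yz az _ bY); apply: contra yx => ay.
by rewrite -(component_eq ax) component_sym.
Qed.

End Connectivity.

Section Barrier.
Variables (G : sgraph) (S : {set G}).
Hypothesis connG : gconnected G.
Implicit Types (x y z u v w a b : G) (s : G) (P Q : seq G) (K U : {set G}).

Notation O := (odd_components S).
Definition adj x K := [exists u in K, sedge x u].
Definition adj_odd x := [set K in odd_components S | adj x K].
Definition leaf x := [set K in odd_components S | [set s in S | adj s K] == [set x]].
Definition endpoints := [set x in S | 2 <= #|leaf x|].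
(** The odd components at z that lead away from x. Two of them supply a pendent pair at z for every
    path from x, that is [ext z x], even if z is no endpoint. *)
Definition out z x := [set K in adj_odd z | ~~ (K \subset component [set z] x)].

Lemma adjP x K : reflect (exists2 u, u \in K & sedge x u) (adj x K).
Proof. exact: (iffP exists_inP). Qed.

Lemma leafP x K : K \in leaf x ->
  [/\ K \in O, x \in S, adj x K & forall s, s \in S -> adj s K -> s = x].
Proof.
rewrite inE => /andP[KO /eqP/setP e]; have := e x; rewrite !inE eqxx => /andP[xS xK].
split=> //; first by rewrite inE in KO.
by move=> s sS sK; have := e s; rewrite !inE sS sK /= => /esym/eqP.
Qed.

Lemma leaf_adj x : leaf x \subset adj_odd x.
Proof. by apply/subsetP => K /leafP[KO _ xK _]; rewrite inE KO. Qed.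

Lemma components_notin K x : K \in components S -> x \in S -> x \notin K.
Proof.
by move=> KS xS; apply/negP => xK; have [_ ] := components_mem KS xK; rewrite xS.
Qed.

Lemma components_na K L a b :
  K \in components S -> L \in components S -> K != L -> a \in K -> b \in L -> nonadj a b.
Proof.
move=> KS LS KL aK bL; have [eK aS] := components_mem KS aK.
have [eL bS] := components_mem LS bL.
apply/andP; split; first by apply: contraNneq KL => e; rewrite eK eL e.
apply: contra KL => ab; rewrite eK eL; apply/eqP/esym/component_eq.
exact: component_step (component_refl _ _) aS bS ab.
Qed.

Lemma component_absorb x y K u :
  K \in components S -> x \in S -> y != x -> u \in component [set x] y ->
  u \in K \/ adj u K -> K \subset component [set x] y.
Proof.
move=> KS xS yx uy uK.
have [w [wK wy]] : exists w, w \in K /\ w \in component [set x] y.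
  case: uK => [uK|/adjP[w wK uw]]; first by exists u.
  exists w; split=> //; apply: (component1_step yx uy) uw.
  by apply: contraTneq wK => ->; apply: components_notin.
have [-> _] := components_mem KS wK.
rewrite -(component_eq wy); apply: component_mono.
by rewrite sub1set.
Qed.

Lemma out_notin z x K a : z \in S -> x != z -> K \in out z x -> a \in K ->
  a \notin component [set z] x.
Proof.
move=> zS xz; rewrite inE => /andP[+ nK] aK; rewrite inE => /andP[KO _].
apply: contra nK => ax; apply: component_absorb ax _ => //; last by left.
exact: odd_componentsW KO.
Qed.

Lemma exists_adj K : K \in components S -> S != set0 -> exists2 s, s \in S & adj s K.
Proof.
move=> KS /set0Pn[s0 s0S]; have [u uK] := components_neq0 KS.
have [/exists_inP//|/exists_inPn no] := boolP [exists s in S, adj s K].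
have := components_notin KS s0S; rewrite (gconnected_closed s0 connG _ uK) //.
move=> a b aK ab; have [//|bS] := components_closed KS aK ab.
by case/negP: (no _ bS); apply/adjP; exists a; rewrite // sedge_sym.
Qed.

Lemma leaf_out x K a y : K \in leaf x -> a \in K -> y \notin K -> y != x ->
  a \notin component [set x] y.
Proof.
move=> /leafP[KO xS xK onlyx] aK yK yx; have KS := odd_componentsW KO.
apply/negP; rewrite component_sym => ya; case/negP: yK.
move: y ya {yx}; apply: (component_ind (P := fun y => y \in K)) => //.
move=> u v _ uK; rewrite !in_set1 => ux vx uv.
have [//|vS] := components_closed KS uK uv.
by case/eqP: vx; apply: onlyx => //; apply/adjP; exists u; rewrite // sedge_sym.
Qed.

Lemma leaf_outS x K a y : K \in leaf x -> a \in K -> y \in S -> y != x ->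
  a \notin component [set x] y.
Proof.
move=> KL aK yS; apply: (leaf_out KL aK).
by have [KO _ _ _] := leafP KL; apply: components_notin (odd_componentsW KO) yS.
Qed.

Lemma endpoints_endpoint x : x \in endpoints -> endpoint S x.
Proof.
rewrite inE => /andP[xS /card_gt1P[K [L [KL LL neq]]]].
have [KO _ /adjP[a aK xa] _] := leafP KL; have [LO _ /adjP[b bL xb] _] := leafP LL.
exists a, b; split=> //.
  exact: components_na (odd_componentsW KO) (odd_componentsW LO) neq aK bL.
by move=> y yS yx; rewrite (leaf_outS KL) ?(leaf_outS LL).
Qed.

(** One neighbour of x from each member of F, together with J, is an independent set, since distinct
    components of G - S are nonadjacent. *)
Lemma card_adj_le x (F : {set {set G}}) (J : {set G}) :
  F \subset components S -> (forall K, K \in F -> adj x K) ->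
  (forall a, a \in J -> sedge x a) ->
  (forall a b, a \in J -> b \in J -> a != b -> nonadj a b) ->
  (forall a K v, a \in J -> K \in F -> v \in K -> sedge x v -> nonadj a v) ->
  #|F| + #|J| <= local_indep G.
Proof.
move=> /subsetP FS Fx Jx Jna JF.
pose r K := odflt x [pick u in K | sedge x u].
have rP K : K \in F -> r K \in K /\ sedge x (r K).
  move=> /Fx/adjP[u uK xu]; rewrite /r; case: pickP => [v /andP[]//|/(_ u)].
  by rewrite /= uK xu.
have r_na K L : K \in F -> L \in F -> K != L -> nonadj (r K) (r L).
  move=> KF LF KL; have [rK _] := rP _ KF; have [rL _] := rP _ LF.
  by apply: components_na KL rK rL; apply: FS.
have r_inj : {in F &, injective r}.
  move=> K L KF LF e; apply/eqP; apply: contraT => /(r_na _ _ KF LF)/nonadj_neq.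
  by rewrite e eqxx.
rewrite -(card_in_imset r_inj) -cardsUI.
have -> : r @: F :&: J = set0.
  apply/setP => u; rewrite !inE; apply/negP => /andP[/imsetP[K KF ->] rJ].
  by have [rK xr] := rP _ KF; have := nonadj_neq (JF _ _ _ rJ KF rK xr); rewrite eqxx.
rewrite cards0 addn0; apply: (@card_indep_nbrs _ x).
  by move=> u; rewrite inE => /orP[/imsetP[K /rP[_ ?] ->]|/Jx].
move=> u v; rewrite !inE => /orP[/imsetP[K KF ->]|uJ] /orP[/imsetP[L LF ->]|vJ] uv.
- by apply: r_na => //; apply: contraNneq uv => ->.
- by have [rK xr] := rP _ KF; rewrite nonadj_sym (JF _ K).
- by have [rK xr] := rP _ LF; rewrite (JF _ L).
- exact: Jna.
Qed.

Lemma adj_odd_components x : adj_odd x \subset components S.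
Proof. by apply/subsetP => K; rewrite inE => /andP[/odd_componentsW]. Qed.

Lemma adj_odd_le x : #|adj_odd x| <= local_indep G.
Proof.
have := @card_adj_le x (adj_odd x) set0 (adj_odd_components x).
rewrite cards0 addn0; apply=> [K|a|a b|a K v]; rewrite ?inE //.
by case/andP.
Qed.

(* Any neighbour of [x] towards [y] extends the representatives of components away from [y]. *)
Lemma card_adj_lt x y (F : {set {set G}}) :
  F \subset components S -> (forall K, K \in F -> adj x K) -> y != x ->
  (forall K v, K \in F -> v \in K -> v \notin component [set x] y) ->
  #|F| < local_indep G.
Proof.
move=> FS Fx yx Fout; have [s hs] := gconnected_ipath connG x y.
have [[|u t] [es el h]] := ipathP _ _ _ hs.
  by move: yx; rewrite -el eqxx.
have xu : sedge x u by rewrite es in h; exact: ip_edge h.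
have uy : u \in component [set x] y.
  apply: ipath_component hs _ _; first by rewrite es !inE eqxx orbT.
  by rewrite eq_sym sedge_neq.
have := @card_adj_le x F [set u] FS Fx; rewrite cards1 addn1; apply.
- by move=> a; rewrite inE => /eqP->.
- by move=> a b; rewrite !inE => /eqP-> /eqP->; rewrite eqxx.
move=> a K v; rewrite in_set1 => /eqP-> KF vK xv; rewrite nonadj_sym.
by apply: (component_out yx _ (Fout _ _ KF vK) uy); rewrite eq_sym sedge_neq.
Qed.

Lemma leaf_lt x y : y \in S -> y != x -> #|leaf x| < local_indep G.
Proof.
move=> yS yx; apply: (@card_adj_lt x y) => //.
- exact: subset_trans (leaf_adj x) (adj_odd_components x).
- by move=> K /leafP[].
- by move=> K v KL vK; apply: leaf_outS KL vK yS yx.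
Qed.

Lemma double_count : S != set0 ->
  2 * #|O| <= \sum_(s in S) (#|adj_odd s| + #|leaf s|).
Proof.
move=> S0.
have E1 s : #|adj_odd s| + #|leaf s| =
    \sum_(K in O) ((adj s K : nat) + ([set t in S | adj t K] == [set s])).
  rewrite big_split /=; congr (_ + _).
    rewrite -sum1_card [RHS](bigID (adj s)) /= [X in _ = _ + X]big1 ?addn0.
      rewrite [RHS](eq_bigr (fun _ => 1)) => [|K /andP[_ ->]//].
      by apply: eq_bigl => K; rewrite !inE.
    by move=> K /andP[_ /negPf->].
  rewrite -sum1_card [RHS](bigID (fun K => [set t in S | adj t K] == [set s])) /=.
  rewrite [X in _ = _ + X]big1 ?addn0.
    rewrite [RHS](eq_bigr (fun _ => 1)) => [|K /andP[_ ->]//].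
    by apply: eq_bigl => K; rewrite !inE.
  by move=> K /andP[_ /negPf->].
under eq_bigr => s _ do rewrite E1.
rewrite exchange_big /= mulnC -sum_nat_const; apply: leq_sum => K KO.
have [s sS sK] := exists_adj (odd_componentsW KO) S0.
rewrite big_split /= (bigD1 s) //= sK.
(* Connectivity gives K one neighbour s in S; the second unit of weight is the leaf bonus or a
   second neighbour. *)
have [e|ne] := eqVneq [set t in S | adj t K] [set s].
  by rewrite [X in _ <= _ + X](bigD1 s) //= e eqxx; lia.
have [t tS [ts tK]] : exists2 t, t \in S & t != s /\ adj t K.
  have sub : [set s] \subset [set t in S | adj t K] by rewrite sub1set inE sS.
  move: ne; rewrite eq_sym eqEsubset sub /= => /subsetPn[t].
  by rewrite !inE => /andP[tS tK] ts; exists t.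
by rewrite (bigD1 t) ?tS ?ts //= tK; lia.
Qed.

End Barrier.

(** * Consequences of criticality and of the minimality of the barrier *)

Section MinimumBarrier.
Variables (G : sgraph) (S : {set G}).
Hypothesis critG : deficiency_critical G.
Hypothesis barS : deficiency G + #|S| <= #|odd_components S|.
Hypothesis minS : forall T : {set G},
  deficiency G + #|T| <= #|odd_components T| -> #|S| <= #|T|.
Implicit Types (x y z u v w a b : G) (s : G) (P Q : seq G) (K U : {set G}).
Notation O := (odd_components S).

Let connG : gconnected G := critG.1.

(* Merging at most two odd components through [x] would, by parity, leave [S :\ x] a
   barrier. *)
Lemma adj_odd_ge3 x : x \in S -> 3 <= #|adj_odd S x|.
Proof.
move=> xS; pose T := S :\ x.
have cS : #|S| = #|T|.+1 by rewrite (cardsD1 x) xS.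
have sub : O :\: adj_odd S x \subset odd_components T.
  apply/subsetP => K; rewrite inE => /andP[nadj KO].
  have {}nadj : ~~ adj x K by apply: contra nadj => xK; rewrite inE KO.
  move: KO; rewrite !inE => /andP[KS ->]; rewrite andbT.
  have [u uK] := components_neq0 KS; have [eK uS] := components_mem KS uK.
  have uT : u \notin T by rewrite inE (negPf uS) andbF.
  apply/componentsP; exists u => //; rewrite eK; apply/eqP; rewrite eqEsubset.
  rewrite component_mono ?subD1set //=; apply/subsetP => v.
  apply: (component_ind (P := fun v => v \in component S u)).
    exact: component_refl.
  move=> a b _ aK aT bT ab; have aS := component_notin uS aK.
  have [bS|bS] := boolP (b \in S); last exact: component_step aK aS bS ab.
  case/negP: nadj; apply/adjP; exists a; rewrite ?eK //.
  by move: bT; rewrite inE bS andbT negbK inE => /eqP <-; rewrite sedge_sym.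
have nT : ~ (deficiency G + #|T| <= #|odd_components T|).
  by move/minS; rewrite cS ltnn.
(* With at most two odd components at x, T would miss the barrier inequality by at most one; equal
   parities then turn this into the inequality itself. *)
have par : odd #|odd_components T| = odd (#|T| + deficiency G).
  rewrite odd_components_parity oddD deficiency_parity.
  by rewrite -(cardsC T) oddD; case: (odd #|T|); case: (odd _).
have c1 := subset_leq_card sub; have sA : adj_odd S x \subset O.
  by apply/subsetP => K; rewrite inE => /andP[].
have c2 : #|O :\: adj_odd S x| + #|adj_odd S x| = #|O|.
  by rewrite addnC -(cardsID (adj_odd S x) O) (setIidPr sA).
move: barS nT par c1 c2; rewrite cS.
by move: #|O| #|T| #|odd_components T| #|_ :\: _| #|adj_odd S x| (deficiency G); clear; lia.
Qed.

(* The component of G - x containing [S :\ x] has smaller deficiency by criticality,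
   and [S :\ x] is nearly a barrier in it. *)
Lemma noncut_leaf x y : x \in S -> y != x ->
  (forall s, s \in S -> s != x -> s \in component [set x] y) ->
  2 <= #|leaf S x|.
Proof.
move=> xS yx allS; pose U := component [set x] y.
have xU : x \notin U.
  by apply/negP => /(component1_neq yx); rewrite eqxx.
have cU : gconnected (induced U).
  by apply: gconnected_component; rewrite in_set1.
have dU : deficiency (induced U) < deficiency G.
  apply: critG.2 cU; apply/properP; split; first exact: subsetT.
  by exists x; [rewrite inE|].
have KU K : K \in O :\: leaf S x -> K \subset U.
  rewrite in_setD => /andP[nL KO]; have KS := odd_componentsW KO.
  have S0 : S != set0 by apply/set0Pn; exists x.
  have [s sS sK] := exists_adj connG KS S0.
  have [t [tS tx tK]] : exists t, [/\ t \in S, t != x & adj t K].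
    have [sx|sx] := eqVneq s x; last by exists s.
    have [/existsP[t /and3P[? ? ?]]|/existsPn no] :=
      boolP [exists t, [&& t \in S, t != x & adj t K]]; first by exists t.
    case/negP: nL; rewrite inE KO /=; apply/eqP/setP => t; rewrite !inE.
    apply/andP/eqP => [[tS tK]|->]; last by rewrite xS -sx.
    by apply/eqP; have := no t; rewrite tS tK andbT /= negbK.
  by apply: (component_absorb KS xS yx (allS _ tS tx)); right.
(* The right-hand side is at most (|S| - 1) + (def(G) - 1), two less than the bound from below on
   the number of odd components; the difference is made up by leaves. *)
have : #|O :\: leaf S x| <= #|S :\ x| + deficiency (induced U).
  apply: (@odd_family_le _ _ (val : induced U -> G) val_inj).
  - apply: trivIsetS (components_trivIset S); apply/subsetP => K.
    by rewrite in_setD => /andP[_ /odd_componentsW].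
  - by move=> K; rewrite in_setD => /andP[_]; rewrite inE => /andP[].
  - by move=> K u /KU/subsetP KU' uK; exists (Sub u (KU' _ uK)).
  - move=> K a b /setDP[/odd_componentsW KS _] aK ab.
    have [bK|bS] := components_closed KS aK (ab : sedge (val a) (val b)); first by left.
    right; rewrite !inE bS andbT; apply: contraNneq xU => <-; exact: valP b.
have cS : #|S| = #|S :\ x|.+1 by rewrite (cardsD1 x) xS.
have sL : leaf S x \subset O by apply/subsetP => K /leafP[].
have := cardsID (leaf S x) O; rewrite (setIidPr sL).
move: barS dU; rewrite cS.
by move: #|O| #|S :\ x| #|O :\: leaf S x| #|leaf S x| (deficiency G) (deficiency _); clear; lia.
Qed.

(* Take [x] cutting off the fewest vertices from [z]. *)
Lemma exists_endpoint z y : z \in S -> y \in S -> y != z ->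
  exists2 x, x \in endpoints S & x \in component [set z] y /\ x != z.
Proof.
move=> zS yS yz.
pose F x := ~: (x |: component [set x] z).
pose R x := (x \in S) && (x \in component [set z] y).
have Ry : R y by rewrite /R yS component_refl.
case: (arg_minnP (fun x => #|F x|) Ry) => x /andP[xS xy] minF.
have xz : x != z by apply: component1_neq yz xy.
have zx : z != x by rewrite eq_sym.
exists x => //; rewrite inE xS /=; apply: (noncut_leaf xS zx) => s sS sx.
apply: contraT => sz; exfalso.
have sz' : s != z by apply: contraNneq sz => ->; apply: component_refl.
have [Q hQ] := gconnected_ipath connG s z.
have xQ : x \in Q.
  apply: contraT => /(ipath_avoid hQ) h; by rewrite component_sym h in sz.
have xs : x \in component [set z] s.
  by apply: ipath_component (ipath_rev hQ) _ xz; rewrite mem_rev.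
have Rs : R s by rewrite /R sS -(component_eq xy) (component_eq xs) component_refl.
(* If x separates s from z, then everything cut off from z by s is also cut off by x, and s itself
   is cut off by x only; this contradicts the choice of x. *)
have := minF _ Rs; rewrite leqNgt => /negP[]; apply/proper_card/properP; split.
  apply/subsetP => u; rewrite !in_setC !in_setU1 !negb_or => /andP[us uz].
  have [P hP] := gconnected_ipath connG x z.
  have sP : s \notin P.
    apply/negP => /splitPr E0; case: E0 hP => P1 P2 hP.
    have [hP1 hP2] := ipath_split hP.
    case/negP: sz; rewrite component_sym; apply: ipath_avoid hP2 _.
    case: P1 hP hP1 => [|c P1] /ipathP[t [[e1 e2] _ h]] _.
      by rewrite e1 eqxx in sx.
    have := ip_neq h; rewrite e1 mem_cat negb_or => /andP[_].
    by [].
  have ux : u != x.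
    by apply: contraNneq uz => ->; rewrite component_sym; apply: ipath_avoid hP sP.
  rewrite ux /=; apply: contra uz => uz; rewrite component_sym.
  have zx1 : z \notin [set x] by rewrite in_set1.
  have [P' hP' sub] := component_ipath zx1 uz.
  rewrite component_sym; apply: ipath_avoid hP' _.
  by apply: contra sz => /sub.
exists s; rewrite !in_setC !in_setU1 ?eqxx // negb_or sx.
exact: sz.
Qed.

Lemma endpoints_sub : endpoints S \subset S.
Proof. by apply/subsetP => x; rewrite inE => /andP[]. Qed.

(** If S minus z lay on one side of z, criticality would make z an endpoint. So z separates two
    vertices of S, and each of the two sides contains an endpoint. *)
Lemma center_separates z : z \in S -> z \notin endpoints S -> 2 <= #|S| ->
  exists x y, [/\ x \in endpoints S, y \in endpoints S, x != z, y != z &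
    y \notin component [set z] x].
Proof.
move=> zS zE S2; have [s1 s1S zs1] := exists_other S2 zS.
have s1z : s1 != z by rewrite eq_sym.
have [/existsP[s2 /and3P[s2S s2z nc]]|/existsPn no] :=
    boolP [exists s, [&& s \in S, s != z & s \notin component [set z] s1]].
  have [x xE [xs1 xz]] := exists_endpoint zS s1S s1z.
  have [y yE [ys2 yz]] := exists_endpoint zS s2S s2z.
  exists x, y; split=> //; rewrite (component_eq xs1); apply: contra nc => ys1.
  by rewrite -(component_eq ys1) component_sym in ys2 *; rewrite (component_eq ys1) in ys2 *.
case/negP: zE; rewrite inE zS; apply: (noncut_leaf zS s1z) => s sS sz.
by have := no s; rewrite sS sz /= negbK.
Qed.

Lemma exists_two_endpoints : 2 <= #|S| -> 2 <= #|endpoints S|.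
Proof.
move=> S2; have /set0Pn[z zS] : S != set0 by rewrite -card_gt0; apply: ltnW.
have [y yS zy] := exists_other S2 zS.
have yz : y != z by rewrite eq_sym.
have [x xE [_ xz]] := exists_endpoint zS yS yz.
have zx : z != x by rewrite eq_sym.
have [y' yE [_ yx]] := exists_endpoint (subsetP endpoints_sub _ xE) zS zx.
by apply/card_gt1P; exists x, y'; rewrite eq_sym.
Qed.

(** No component lies on both sides of z. As z sees at least three odd components, two of them lead
    away from x or two lead away from y. *)
Lemma out_cover z x y : z \in S -> x != z -> y != z -> y \notin component [set z] x ->
  adj_odd S z \subset out S z x :|: out S z y.
Proof.
move=> zS xz yz yx; apply/subsetP => K KA; rewrite !inE in KA *.
rewrite KA /= -negb_and; apply/negP => /andP[/subsetP Kx /subsetP Ky].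
have [KO _] := andP KA; have [KS _] := andP KO; have [u uK] := components_neq0 KS.
case/negP: yx; rewrite -(component_eq (Kx _ uK)).
by rewrite component_sym; apply: Ky.
Qed.

Lemma out_ext z x : z \in S -> x != z -> 2 <= #|out S z x| -> ext z x.
Proof.
move=> zS xz /card_gt1P[K [L [KL LL neq]]].
have /andP[/andP[KO /adjP[a aK za]] _] : (K \in O) && adj z K && ~~ (K \subset component [set z] x).
  by move: KL; rewrite !inE.
have /andP[/andP[LO /adjP[b bL zb]] _] : (L \in O) && adj z L && ~~ (L \subset component [set z] x).
  by move: LL; rewrite !inE.
exists a, b; split=> //; last 2 first.
- exact: out_notin KL aK.
- exact: out_notin LL bL.
exact: components_na (odd_componentsW KO) (odd_componentsW LO) neq aK bL.
Qed.

Section Sizes.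
Variable A : pred nat.
Hypothesis bonesA : forall i, 2 <= i -> has_induced G (bone i) -> A i.

Lemma center_size z x P : z \in S -> x \in endpoints S -> x != z ->
  2 <= #|out S z x| -> ipath x z P -> A (size P).
Proof.
move=> zS xE xz out2 hP; apply: (bone_ends bonesA xz hP); last exact: out_ext out2.
have [a [b [ab xa xb]]] := endpoints_endpoint xE.
have zx : z != x by rewrite eq_sym.
by move=> /(_ z zS zx)/andP[h1 h2]; exists a, b.
Qed.

Lemma extE_endpoints : {in endpoints S &, forall x y, x != y -> ext x y}.
Proof.
apply: endpoint_ext => x xE; have [a [b [ab xa xb h]]] := endpoints_endpoint xE.
exists a, b; split=> // y yE; apply: h; exact: subsetP endpoints_sub _ yE.
Qed.

End Sizes.
End MinimumBarrier.

(** * Counting odd components *)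

Section Counting.
Variables (G : sgraph) (S : {set G}) (N : nat).
Hypothesis critG : deficiency_critical G.
Hypothesis barS : deficiency G + #|S| <= #|odd_components S|.
Hypothesis minS : forall T : {set G},
  deficiency G + #|T| <= #|odd_components T| -> #|S| <= #|T|.
Hypothesis (N3 : 3 <= N) (locN : local_indep G <= N).
Implicit Types (x y z u v w a b e : G) (s : G) (P Q R : seq G) (K U : {set G}).
Notation O := (odd_components S).
Notation E := (endpoints S).

Let connG : gconnected G := critG.1.

(** The barriers too small to have two endpoints: for the empty one G has at most one odd component,
    and for a single vertex all odd components are adjacent to it. *)
Lemma deficiency_small : #|S| <= 1 -> deficiency G <= N.-1.
Proof.
move=> S1; have [e0|/set0Pn[x xS]] := eqVneq S set0.
  have O1 : #|O| <= 1.
    apply/card_le1_eqP => K L KO LO.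
    have [u uK] := components_neq0 (odd_componentsW KO).
    have [v vL] := components_neq0 (odd_componentsW LO).
    have [-> uS] := components_mem (odd_componentsW KO) uK.
    have [-> vS] := components_mem (odd_componentsW LO) vL.
    apply: component_eq; apply: (gconnected_closed v connG _ (component_refl S u)).
    move=> a b au; apply: component_step au _ _; by rewrite e0 inE.
  by move: barS; rewrite e0 cards0 -e0; move: O1; clear -N3; lia.
have eS : S = [set x].
  by apply/esym/eqP; rewrite eqEcard sub1set xS cards1 S1.
have sub : O \subset adj_odd S x.
  apply/subsetP => K KO; have S0 : S != set0 by apply/set0Pn; exists x.
  have [s sS sK] := exists_adj connG (odd_componentsW KO) S0.
  by rewrite inE KO; move: sS; rewrite eS inE => /eqP <-.
have := leq_trans (subset_leq_card sub) (leq_trans (adj_odd_le S x) locN).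
by move: barS; rewrite eS cards1 -eS; clear; lia.
Qed.

Lemma endpoint_weight x : 2 <= #|S| -> x \in E ->
  #|adj_odd S x| <= N /\ #|leaf S x| < N.
Proof.
move=> S2 xE; have xS := subsetP (endpoints_sub S) _ xE.
have [y yS xy] := exists_other S2 xS; split.
  exact: leq_trans (adj_odd_le S x) locN.
by apply: leq_trans locN; apply: (leaf_lt connG yS); rewrite eq_sym.
Qed.

Lemma weight_sum : S != set0 ->
  2 * (deficiency G + #|S|) <=
    \sum_(x in E) (#|adj_odd S x| + #|leaf S x|) +
    \sum_(z in S :\: E) (#|adj_odd S z| + #|leaf S z|).
Proof.
move=> S0; apply: leq_trans (_ : 2 * #|O| <= _); first by rewrite leq_mul2l barS.
apply: leq_trans (double_count connG S0) _; rewrite (big_setID E) /=.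
by rewrite (setIidPr (endpoints_sub S)).
Qed.

Lemma endpoints_weight_sum : 2 <= #|S| ->
  \sum_(x in E) (#|adj_odd S x| + #|leaf S x|) <= #|E| * (2 * N - 1).
Proof.
move=> S2; rewrite -sum_nat_const; apply: leq_sum => x xE.
by have [h1 h2] := endpoint_weight S2 xE; move: h1 h2; clear; lia.
Qed.

Lemma cardE_setD : #|S| = #|E| + #|S :\: E|.
Proof. by rewrite -(cardsID E S) (setIidPr (endpoints_sub S)). Qed.

Lemma ipath_cat_size x z y P Q : x != z -> y \notin component [set z] x -> y != z ->
  ipath x z P -> ipath z y Q -> exists2 R, ipath x y R & (size R).+1 = size P + size Q.
Proof.
move=> xz yx yz hP hQ; have [t [eQ _ _]] := ipathP _ _ _ hQ.
exists (P ++ t); last by rewrite eQ size_cat /= addnS.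
by apply: (ipath_sep_cat xz yx yz hP); rewrite -eQ.
Qed.

Lemma notin_component_sym x y z : y \notin component [set z] x -> x \notin component [set z] y.
Proof. by rewrite component_sym. Qed.

Lemma leaf_sub_out z x : x \in S -> x != z -> leaf S z \subset out S z x.
Proof.
move=> xS xz; apply/subsetP => K KL; rewrite inE (subsetP (leaf_adj S z) _ KL) /=.
have [KO _ _ _] := leafP KL; have [u uK] := components_neq0 (odd_componentsW KO).
by apply/subsetPn; exists u => //; apply: leaf_outS KL uK xS xz.
Qed.

Lemma exists_reps (F : {set {set G}}) (r : G -> bool) :
  F \subset components S -> (forall K, K \in F -> exists2 u, u \in K & r u) ->
  exists X : {set G}, [/\ #|X| = #|F|,
    {in X, forall u, r u /\ exists2 K, K \in F & u \in K} &
    {in X &, forall u v, u != v -> nonadj u v}].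
Proof.
move=> /subsetP FS ex; case: (set_0Vmem F) => [->|[K0 K0F]].
  by exists set0; rewrite !cards0; split=> // u; rewrite inE.
have [u0 _ _] := ex _ K0F; pose f (K : {set G}) := odflt u0 [pick u in K | r u].
have fP K : K \in F -> f K \in K /\ r (f K).
  move=> /ex[u uK ru]; rewrite /f; case: pickP => [v /andP[]//|/(_ u)].
  by rewrite /= uK ru.
have f_na K L : K \in F -> L \in F -> K != L -> nonadj (f K) (f L).
  move=> KF LF KL; have [rK _] := fP _ KF; have [rL _] := fP _ LF.
  exact: components_na (FS _ KF) (FS _ LF) KL rK rL.
exists (f @: F); split.
- apply: card_in_imset => K L KF LF e; apply/eqP; apply: contraT => /(f_na _ _ KF LF)/nonadj_neq.
  by rewrite e eqxx.
- by move=> _ /imsetP[K KF ->]; have [h1 h2] := fP _ KF; split=> //; exists K.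
move=> _ _ /imsetP[K KF ->] /imsetP[L LF ->] neq; apply: f_na => //.
by apply: contraNneq neq => ->.
Qed.

Lemma exists_leaf_reps x : exists X : {set G}, [/\ #|X| = #|leaf S x|,
    {in X, forall u, sedge x u},
    (forall u y, u \in X -> y \in S -> y != x -> u \notin component [set x] y) &
    {in X &, forall u v, u != v -> nonadj u v}].
Proof.
have [||X [cX Xx Xna]] := @exists_reps (leaf S x) (sedge x).
- exact: subset_trans (leaf_adj S x) (adj_odd_components S x).
- by move=> K /leafP[_ _ /adjP].
exists X; split=> // [u /Xx[]//|u y /Xx[_ [K KL uK]] yS yx].
exact: leaf_outS KL uK yS yx.
Qed.

(** The vertex data of an induced T_k^p: a and b are the two attachment vertices, M the other side
    of K_{2,k}, and P, Q with the pendent sets X, Y the two brooms. The final block separates each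
    broom from the rest; an embedding is only built later. *)
Definition T_pattern k p :=
  exists x y a b P Q (M X Y : {set G}),
  [/\ [/\ ipath x a P, ipath y b Q, size P = p & size Q = p],
      [/\ #|M| = k, #|X| = k & #|Y| = k],
      [/\ {in M &, forall m m', m != m' -> nonadj m m'},
          {in X &, forall m m', m != m' -> nonadj m m'} &
          {in Y &, forall m m', m != m' -> nonadj m m'}],
      [/\ {in M, forall m, sedge a m && sedge b m}, {in X, forall u, sedge x u},
          {in Y, forall u, sedge y u},
          (forall u v, u \in P -> u != x -> v \in X -> nonadj u v) &
          (forall u v, u \in Q -> u != y -> v \in Y -> nonadj u v)] &
      [/\ nonadj a b,
          (forall w c, (w \in P) && (w != a) || (w \in X) -> c \in M \/ c = b -> nonadj w c) &
          (forall w c, (w \in Q) && (w != b) || (w \in Y) ->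
             [\/ c \in M, c = a, c \in P | c \in X] -> nonadj w c)]].

(* The suffixes A and B refer to q = 2p + 1 and q = 2p - 1. *)
Section A.
Variables (p : nat) (x y : G).
Hypothesis (p3 : 3 <= p) (oddp : odd p).
Notation A := (pred2 p (2 * p + 1)).
Hypothesis bonesA : forall i, 2 <= i -> has_induced G (bone i) -> A i.
Hypothesis (xE : x \in E) (yE : y \in E) (xy : x != y).
Hypothesis S2 : 2 <= #|S|.

(** Two components away from x make P the path of a bone, and P followed by Q joins two endpoints.
    So |P| and |P| + |Q| - 1 lie in {p, 2p + 1}, and |Q| >= 2 leaves only p and 2p + 1. *)
Lemma center_sizeA z P Q : z \in S -> x != z -> y != z ->
  y \notin component [set z] x -> 2 <= #|out S z x| ->
  ipath x z P -> ipath z y Q -> size P = p /\ size Q = p + 2.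
Proof.
move=> zS xz yz sep out2 hP hQ.
have AP := center_size bonesA zS xE xz out2 hP.
have [R hR sR] := ipath_cat_size xz sep yz hP hQ.
have AR := endpoints_size bonesA (extE_endpoints (S := S)) xE yE xy hR.
have zy : z != y by rewrite eq_sym.
have := ipath_size2 hQ zy; move: AP AR sR => /=.
by move: (size P) (size Q) (size R) => a b c; clear -p3; lia.
Qed.

Lemma out_le1A z : z \in S -> x != z -> y != z ->
  y \notin component [set z] x -> 2 <= #|out S z x| -> #|out S z y| <= 1.
Proof.
move=> zS xz yz sep out2; rewrite leqNgt; apply/negP => out2'.
have [P hP] := gconnected_ipath connG x z; have [Q hQ] := gconnected_ipath connG z y.
have [_ sQ] := center_sizeA zS xz yz sep out2 hP hQ.
have := center_size bonesA zS yE yz out2' (ipath_rev hQ).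
by rewrite size_rev sQ /=; clear -p3; lia.
Qed.

(** Leaves of z lead away from y, and at most one component does, because p + 2 is no bone size. If
    it is a leaf, all other components at z lie on the side of y, so a neighbour of z towards x can
    be added to their representatives and at most N - 1 components are adjacent to z. *)
Lemma center_weightA z : z \in S -> x != z -> y != z ->
  y \notin component [set z] x -> 2 <= #|out S z x| ->
  #|adj_odd S z| + #|leaf S z| <= N.
Proof.
move=> zS xz yz sep out2; have out1 := out_le1A zS xz yz sep out2.
have xS := subsetP (endpoints_sub S) _ xE; have yS := subsetP (endpoints_sub S) _ yE.
have [e0|/set0Pn[K KL]] := eqVneq (leaf S z) set0.
  by rewrite e0 cards0 addn0; apply: leq_trans (adj_odd_le S z) locN.
have Ly := leaf_sub_out yS yz.
have leaf1 := leq_trans (subset_leq_card Ly) out1.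
have outE : out S z y = [set K].
  by apply/esym/eqP; rewrite eqEcard sub1set (subsetP Ly _ KL) cards1 out1.
suff : #|adj_odd S z| < N by move: leaf1; clear; lia.
apply: leq_trans locN; apply: (@card_adj_lt _ S connG z x (adj_odd S z)) => //.
- exact: adj_odd_components.
- by move=> L; rewrite inE => /andP[].
move=> L v LA vL; have [LK|LK] := eqVneq L K.
  by rewrite LK in vL; apply: leaf_outS KL vL xS xz.
have LO : L \in O by move: LA; rewrite inE => /andP[].
have : L \notin out S z y by rewrite outE inE.
rewrite inE LA /= negbK => /subsetP Lsub; have vy := Lsub _ vL.
apply: contra sep => vx; rewrite -(component_eq vx) (component_eq vy).
exact: component_refl.
Qed.

(** Such a vertex has p vertices on every path from x and p + 2 on every path to y. Passing through
    z and z' in succession makes one of these paths too long. *)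
Lemma center_uniqA z z' : z \in S -> z' \in S -> z != z' ->
  x != z -> y != z -> y \notin component [set z] x -> 2 <= #|out S z x| ->
  x != z' -> y != z' -> y \notin component [set z'] x -> 2 <= #|out S z' x| -> False.
Proof.
move=> zS z'S zz xz yz sep out2 xz' yz' sep' out2'.
have [P hP] := gconnected_ipath connG x z; have [Q hQ] := gconnected_ipath connG z y.
have [sP sQ] := center_sizeA zS xz yz sep out2 hP hQ.
have [Q' hQ'] := gconnected_ipath connG z' y.
have z'z : z' != z by rewrite eq_sym.
have [zx'|zx'] := boolP (z' \in component [set z] x).
  have [R hR] := gconnected_ipath connG z' z.
  have sep2 : y \notin component [set z] z' by rewrite (component_eq zx').
  have [R' hR' sR'] := ipath_cat_size z'z sep2 yz hR hQ.
  have [P' hP'] := gconnected_ipath connG x z'.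
  have [_ sR2] := center_sizeA z'S xz' yz' sep' out2' hP' hR'.
  have := ipath_size2 hR z'z; move: sR' sR2 sQ.
  by move: (size R) (size R') (size Q) => a b c; clear; lia.
have [R hR] := gconnected_ipath connG z z'.
have [R' hR' sR'] := ipath_cat_size xz zx' z'z hP hR.
have [sR2 _] := center_sizeA z'S xz' yz' sep' out2' hR' hQ'.
have := ipath_size2 hR zz; move: sR' sR2 sP.
by move: (size R) (size R') (size P) => a b c; clear; lia.
Qed.

End A.

(** * The case q = 2p + 1: bound and structure at equality *)

Section CaseA.
Variables (p : nat).
Hypothesis (p3 : 3 <= p) (oddp : odd p).
Notation A := (pred2 p (2 * p + 1)).
Hypothesis bonesA : forall i, 2 <= i -> has_induced G (bone i) -> A i.
Hypothesis S2 : 2 <= #|S|.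

(* [C] collects the centers closer to [x], [C'] those closer to [y]. *)
Lemma two_endpoints_structure : exists x y (C C' : {set G}),
  [/\ x != y, E = [set x; y], S :\: E = C :|: C', #|C| <= 1 & #|C'| <= 1] /\
  (forall z, z \in S :\: E ->
     [/\ z \in S, x != z, y != z & y \notin component [set z] x]) /\
  (forall z, z \in C -> 2 <= #|out S z x|) /\
  (forall z, z \in C' -> 2 <= #|out S z y|).
Proof.
have E2 : #|E| = 2.
  apply/eqP; rewrite eqn_leq (exists_two_endpoints critG barS S2) andbT.
  exact: (endpoints_le2 connG p3 oddp bonesA (extE_endpoints (S := S))).
have /cards2P[x [y [xy eE]]] : #|E| == 2 by rewrite E2.
have xE : x \in E by rewrite eE !inE eqxx.
have yE : y \in E by rewrite eE !inE eqxx orbT.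
have sepP z : z \in S :\: E -> [/\ z \in S, x != z, y != z & y \notin component [set z] x].
  rewrite inE => /andP[zE zS].
  have [x' [y' [x'E y'E xz yz sep]]] := center_separates critG barS zS zE S2.
  have xz0 : x != z by apply: contraNneq zE => <-.
  have yz0 : y != z by apply: contraNneq zE => <-.
  split=> //; move: x'E y'E sep; rewrite eE !in_set2 => /orP[]/eqP-> /orP[]/eqP-> //;
    by rewrite ?component_refl // component_sym.
have outP z : z \in S :\: E -> 2 <= #|out S z x| \/ 2 <= #|out S z y|.
  move=> /sepP[zS xz yz sep].
  have h1 := leq_trans (adj_odd_ge3 barS minS zS) (subset_leq_card (out_cover zS xz yz sep)).
  have H := leq_trans h1 (leq_card_setU _ _).
  have [h|h] := leqP 2 #|out S z x|; [by left|right].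
  by move: h H; move: #|out S z x| #|out S z y| => b c; clear; lia.
have yx : y != x by rewrite eq_sym.
exists x, y, [set z in S :\: E | 2 <= #|out S z x|], [set z in S :\: E | 2 <= #|out S z y|].
split; [split=> // | split=> //; split].
- apply/setP => z; rewrite [RHS]inE ![z \in [set z in _ | _]]inE.
  case: (boolP (z \in _)) => //= zC; have [->|->] := outP _ zC; by rewrite ?orbT.
- apply/card_le1_eqP => z z'; rewrite ![_ \in [set z in _ | _]]inE => /andP[zC o] /andP[zC' o'].
  have [zS xz yz sep] := sepP _ zC; have [zS' xz' yz' sep'] := sepP _ zC'.
  apply/eqP; apply: contraT; rewrite eq_sym => zz; exfalso.
  exact: (center_uniqA p3 bonesA xE yE xy zS zS' zz xz yz sep o xz' yz' sep' o').
- apply/card_le1_eqP => z z'; rewrite ![_ \in [set z in _ | _]]inE => /andP[zC o] /andP[zC' o'].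
  have [zS xz yz sep] := sepP _ zC; have [zS' xz' yz' sep'] := sepP _ zC'.
  apply/eqP; apply: contraT; rewrite eq_sym => zz; exfalso.
  exact: (center_uniqA p3 bonesA yE xE yx zS zS' zz yz xz (notin_component_sym sep) o
    yz' xz' (notin_component_sym sep') o').
- by move=> z; rewrite inE => /andP[].
- by move=> z; rewrite inE => /andP[].
Qed.

Lemma two_endpoints_center_weight x y C C' z :
  [/\ x != y, E = [set x; y], S :\: E = C :|: C', #|C| <= 1 & #|C'| <= 1] /\
  (forall z, z \in S :\: E ->
     [/\ z \in S, x != z, y != z & y \notin component [set z] x]) /\
  (forall z, z \in C -> 2 <= #|out S z x|) /\
  (forall z, z \in C' -> 2 <= #|out S z y|) ->
  z \in S :\: E -> #|adj_odd S z| + #|leaf S z| <= N.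
Proof.
move=> [[xy eE eC _ _] [sepP [CP CP']]] zC; have [zS xz yz sep] := sepP _ zC.
have xE : x \in E by rewrite eE !inE eqxx.
have yE : y \in E by rewrite eE !inE eqxx orbT.
have yx : y != x by rewrite eq_sym.
move: zC; rewrite eC inE => /orP[/CP o|/CP' o].
  exact: (center_weightA p3 bonesA xE yE xy zS xz yz sep o).
exact: (center_weightA p3 bonesA yE xE yx zS yz xz (notin_component_sym sep) o).
Qed.

Lemma deficiency_leA : deficiency G <= 3 * N - 5.
Proof.
have [x [y [C [C' st]]]] := two_endpoints_structure.
have w := two_endpoints_center_weight st.
have [[xy eE eC C1 C1'] _] := st.
have S0 : S != set0 by rewrite -card_gt0; apply: ltnW.
have := weight_sum S0; have := endpoints_weight_sum S2; have := cardE_setD.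
have : \sum_(z in S :\: E) (#|adj_odd S z| + #|leaf S z|) <= #|S :\: E| * N.
  by rewrite -sum_nat_const; apply: leq_sum => z; apply: w.
have : #|S :\: E| <= 2.
  by rewrite eC; apply: leq_trans (leq_card_setU _ _) _; apply: leq_add C1 C1'.
have -> : #|E| = 2 by rewrite eE cards2 xy.
move: (\sum_(x in E) _) (\sum_(x in _ :\: _) _) #|S :\: E| (deficiency G) #|S|.
by move=> a b c d e; clear -N3; case: c => [|[|[|]]] //; lia.
Qed.

(** Equality forces two centers a and b, N - 1 leaves at each endpoint, and weight N at a and at b.
    One component at a leads to x; the other N - 1 also touch b and supply the middle vertices of
    T. *)
Lemma deficiency_eqA : deficiency G = 3 * N - 5 -> T_pattern N.-1 p.
Proof.
have [x [y [C [C' st]]]] := two_endpoints_structure.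
have w := two_endpoints_center_weight st.
have [[xy eE eC C1 C1'] [sepP [CP CP']]] := st => dG.
have xE : x \in E by rewrite eE !inE eqxx.
have yE : y \in E by rewrite eE !inE eqxx orbT.
have xS := subsetP (endpoints_sub S) _ xE; have yS := subsetP (endpoints_sub S) _ yE.
have yx : y != x by rewrite eq_sym.
have S0 : S != set0 by rewrite -card_gt0; apply: ltnW.
have cE : #|E| = 2 by rewrite eE cards2 xy.
have hw := weight_sum S0; have he := endpoints_weight_sum S2; have cS := cardE_setD.
have hc : \sum_(z in S :\: E) (#|adj_odd S z| + #|leaf S z|) <= #|S :\: E| * N.
  by rewrite -sum_nat_const; apply: leq_sum => z; apply: w.
have c2 : #|S :\: E| <= 2.
  by rewrite eC; apply: leq_trans (leq_card_setU _ _) _; apply: leq_add C1 C1'.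
have {}c2 : #|S :\: E| = 2.
  apply/eqP; rewrite eqn_leq c2 /=; move: hw he hc c2; rewrite cE cS cE dG.
  move: (\sum_(x in E) _) (\sum_(x in _ :\: _) _) #|S :\: E|.
  by move=> a b c; clear -N3; case: c => [|[|[|]]] //; lia.
have [cC cC'] : #|C| = 1 /\ #|C'| = 1.
  move: c2 C1 C1' (leq_card_setU C C').1; rewrite eC.
  by move: #|C :|: C'| #|C| #|C'|; clear=> a b c *; lia.
have /cards1P[a eCa] : #|C| == 1 by rewrite cC.
have /cards1P[b eCb] : #|C'| == 1 by rewrite cC'.
have ab : a != b.
  by apply: contraPneq c2 => e; rewrite eC eCa eCb e setUid cards1.
have aC : a \in S :\: E by rewrite eC eCa !inE eqxx.
have bC : b \in S :\: E by rewrite eC eCb !inE eqxx orbT.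
have outa : 2 <= #|out S a x| by apply: CP; rewrite eCa inE.
have outb : 2 <= #|out S b y| by apply: CP'; rewrite eCb inE.
have [aS xa ya sepa] := sepP _ aC; have [bS xb yb sepb] := sepP _ bC.
have ba : b != a by rewrite eq_sym.
have sepb' := notin_component_sym sepb.
have inS s : s \in S -> [\/ s = x, s = y, s = a | s = b].
  move=> sS; case: (boolP (s \in E)) => sE.
    by move: sE; rewrite eE in_set2 => /orP[]/eqP->; [constructor 1|constructor 2].
  have : s \in S :\: E by rewrite inE sE.
  by rewrite eC eCa eCb in_setU !in_set1 => /orP[]/eqP->; [constructor 3|constructor 4].
have wx := endpoint_weight S2 xE; have wy := endpoint_weight S2 yE.
have wa := w _ aC; have wb := w _ bC.
have [leafx leafy tighta tightb] : [/\ #|leaf S x| = N.-1, #|leaf S y| = N.-1,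
    #|adj_odd S a| + #|leaf S a| = N & #|adj_odd S b| + #|leaf S b| = N].
  have sE : \sum_(z in E) (#|adj_odd S z| + #|leaf S z|) =
      #|adj_odd S x| + #|leaf S x| + (#|adj_odd S y| + #|leaf S y|).
    by rewrite eE big_setU1 /= ?big_set1 // inE.
  have sC : \sum_(z in S :\: E) (#|adj_odd S z| + #|leaf S z|) =
      #|adj_odd S a| + #|leaf S a| + (#|adj_odd S b| + #|leaf S b|).
    by rewrite eC eCa eCb big_setU1 /= ?big_set1 // inE.
  move: hw wx wy wa wb; rewrite sE sC cS cE c2 dG.
  move: #|adj_odd S x| #|adj_odd S y| #|adj_odd S a| #|adj_odd S b|.
  move: #|leaf S x| #|leaf S y| #|leaf S a| #|leaf S b|.
  by move=> a1 a2 a3 a4 a5 a6 a7 a8; clear -N3 => h [? ?] [? ?] ? ?; split; lia.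
have adjx : #|leaf S x| < #|adj_odd S x|.
  have sE : \sum_(z in E) (#|adj_odd S z| + #|leaf S z|) =
      #|adj_odd S x| + #|leaf S x| + (#|adj_odd S y| + #|leaf S y|).
    by rewrite eE big_setU1 /= ?big_set1 // inE.
  move: hw wx wy hc; rewrite sE leafx leafy cS cE c2 dG.
  move: #|adj_odd S x| #|adj_odd S y| (\sum_(z in _ :\: _) _).
  by move=> a1 a2 a3; clear -N3 => h [? ?] [? ?] ?; lia.
have [P hP] := gconnected_ipath connG x a; have [Py hPy] := gconnected_ipath connG a y.
have [sP sPy] := center_sizeA p3 bonesA xE yE xy aS xa ya sepa outa hP hPy.
have [Q hQ] := gconnected_ipath connG y b.
have szb R R' : ipath y b R -> ipath b x R' -> size R = p /\ size R' = p + 2.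
  exact: (center_sizeA p3 bonesA yE xE yx bS yb xb sepb' outb).
have szbx R : ipath x b R -> size R = p + 2.
  by move=> /ipath_rev/(szb _ _ hQ)[_]; rewrite size_rev.
have sQ : size Q = p.
  by have [R hR] := gconnected_ipath connG b x; have [] := szb _ _ hQ hR.
(* Otherwise a path from y to b could pass through a, which already takes p + 2 vertices, while
   every such path has p. *)
have bax : b \notin component [set a] x.
  apply/negP => h; have sep2 : b \notin component [set a] y.
    by apply: contra sepa => h'; rewrite -(component_eq h) (component_eq h') component_refl.
  have [R hR] := gconnected_ipath connG a b.
  have [R' hR' sR'] := ipath_cat_size ya sep2 ba (ipath_rev hPy) hR.
  have [R2 hR2] := gconnected_ipath connG b x.
  have [sR _] := szb _ _ hR' hR2.
  by move: sR' (ipath_size2 hR ab); rewrite sR size_rev sPy; clear; lia.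
have aby : a \notin component [set b] y.
  apply/negP => h; have sep2 : a \notin component [set b] x.
    by apply: contra sepb => h'; rewrite -(component_eq h') (component_eq h) component_refl.
  have [R hR] := gconnected_ipath connG x b; have sR := szbx _ hR.
  have [R' hR'] := gconnected_ipath connG b a.
  have [R2 hR2 sR2] := ipath_cat_size xb sep2 ab hR hR'.
  have [sR3 _] := center_sizeA p3 bonesA xE yE xy aS xa ya sepa outa hR2 hPy.
  by move: sR2 (ipath_size2 hR' ba); rewrite sR sR3; clear; lia.
(* Paths from x to a have p vertices, those from x to b have p + 2, and a is shared. *)
have sizeab R : ipath a b R -> size R = 3.
  move=> hR; have [R2 hR2 sR2] := ipath_cat_size xa bax ba hP hR.
  by move: sR2; rewrite (szbx _ hR2) sP; clear -p3; lia.
(* the component joining x to a *)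
have [K1 K1x K1L] : exists2 K, K \in adj_odd S x & K \notin leaf S x.
  apply/subsetPn; apply: contraL adjx => /subset_leq_card; by rewrite -leqNgt.
have K1O : K1 \in O by move: K1x; rewrite inE => /andP[].
have xK1 : adj x K1 by move: K1x; rewrite inE => /andP[].
have K1S := odd_componentsW K1O.
have K1B : K1 \subset component [set a] x.
  by apply: (component_absorb K1S aS xa (component_refl _ _)); right.
have disja u : u \in component [set a] x -> u \in component [set a] y -> False.
  move=> h h'; case/negP: sepa.
  by rewrite -(component_eq h) (component_eq h') component_refl.
have nonleaf K s : s \in S -> K \in O -> adj s K -> K \notin leaf S s ->
    exists2 t, t \in S & t != s /\ adj t K.
  move=> sS KO sK nL.
  have [/existsP[t /and3P[? ? ?]]|/existsPn no] :=
    boolP [exists t, [&& t \in S, t != s & adj t K]]; first by exists t.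
  case/negP: nL; rewrite inE KO /=; apply/eqP/setP => t; rewrite !inE.
  apply/andP/eqP => [[tS tK]|->]; last by rewrite sS.
  by apply/eqP; have := no t; rewrite tS tK andbT /= negbK.
have memB K s z u : K \in components S -> z \in S -> u != z -> K \subset component [set z] u -> s \in S -> s != z ->
    adj s K -> s \in component [set z] u.
  move=> KS zS uz /subsetP sub sS sz /adjP[v vK sv].
  by apply: (component1_step uz (sub _ vK) sz); rewrite sedge_sym.
(* Being no leaf of x, K1 touches another barrier vertex; y and b are separated from x by a, so only
   a remains. *)
have aK1 : adj a K1.
  have [t tS [tx tK]] := nonleaf _ _ xS K1O xK1 K1L.
  have [tA|tA] := eqVneq t a; first by rewrite -tA.
  have tB := memB _ _ _ _ K1S aS xa K1B tS tA tK.
  case: (inS _ tS) => e; subst t; first by rewrite eqxx in tx.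
  - by rewrite tB in sepa.
  - by rewrite eqxx in tA.
  - by rewrite tB in bax.
have K1out : K1 \in out S a y.
  have [u uK] := components_neq0 K1S.
  rewrite inE; apply/andP; split; first by rewrite inE K1O.
  by apply/subsetPn; exists u => //; apply/negP; apply: disja; apply: (subsetP K1B).
have outE : out S a y = [set K1].
  by apply/esym/eqP; rewrite eqEcard sub1set K1out cards1 (out_le1A p3 bonesA xE yE xy aS xa ya sepa outa).
have leafa : leaf S a = set0.
  apply/eqP; apply: contraT => /set0Pn[K KL].
  have := subsetP (leaf_sub_out yS ya) _ KL; rewrite outE inE => /eqP eK.
  have [_ _ _ only] := leafP KL; rewrite eK in only.
  by have := only _ xS xK1 => e; rewrite e eqxx in xa.
have adja : #|adj_odd S a| = N by rewrite leafa cards0 addn0 in tighta.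
pose F := adj_odd S a :\ K1.
have cF : #|F| = N.-1.
  have K1A : K1 \in adj_odd S a by rewrite inE K1O.
  by rewrite -adja (cardsD1 K1 (adj_odd S a)) K1A.
(* As a has no leaves, K touches y or b. Touching y but not b would connect a to y in G - b, against
   [aby]. *)
have FP K : K \in F -> [/\ K \in components S, K \subset component [set a] y, adj a K & adj b K].
  rewrite in_setD1 => /andP[KK1 KA]; have [KO aK] : K \in O /\ adj a K by move: KA; rewrite inE => /andP[].
  have KS := odd_componentsW KO.
  have KB : K \subset component [set a] y.
    by have : K \notin out S a y; [rewrite outE inE|rewrite inE KA negbK].
  split=> //; have [|t tS [ta tK]] := nonleaf _ _ aS KO aK; first by rewrite leafa inE.
  have tB := memB _ _ _ _ KS aS ya KB tS ta tK.
  case: (inS _ tS) => e; subst t => //.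
  - by case: (disja x) => //; apply: component_refl.
  - apply: contraT => nb; case/negP: aby.
    have KB' : K \subset component [set b] y.
      by apply: (component_absorb KS bS yb (component_refl _ _)); right.
    exact: memB KS bS yb KB' aS ab aK.
  - by rewrite eqxx in ta.
have [||M [cM MP Mna]] := @exists_reps F (fun m => sedge a m && sedge b m).
- by apply/subsetP => K /FP[].
- move=> K /FP[KS KB /adjP[u uK au] /adjP[v vK bv]].
  (* An induced path from a to b inside K and {a, b} has three vertices, so its middle vertex is a
     common neighbour in K. *)
  pose T := ~: (K :|: [set a; b]).
  have aT : a \notin T by rewrite !inE eqxx orbT.
  have bT : b \notin T by rewrite !inE eqxx !orbT.
  have KT c : c \in K -> c \notin T by move=> cK; rewrite !inE cK.
  have [eK uS] := components_mem KS uK.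
  have vT : v \in component T a.
    move: vK; rewrite eK; move: v {bv}; apply: component_ind.
      by apply: (component_step (component_refl _ _) aT (KT _ uK) au).
    move=> c d cu cT cS0 dS cd; have cK : c \in K by rewrite eK.
    have dK : d \in K by rewrite eK; apply: component_step cu cS0 dS cd.
    exact: component_step cT (KT _ cK) (KT _ dK) cd.
  have bTa : b \in component T a.
    by apply: (component_step vT (KT _ vK) bT); rewrite sedge_sym.
  have [R hR sub] := component_ipath aT bTa; have sR := sizeab _ hR.
  have [t [eR el h]] := ipathP _ _ _ hR; subst R.
  case: t h el sR sub hR => [|m [|b' [|]]] //= h eb _ sub _; subst b'.
  have am : sedge a m by apply: ip_edge h.
  have mb : sedge m b by apply: ip_edge (ip_tl h).
  exists m; last by rewrite am sedge_sym mb.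
  have /(component_notin aT) : m \in component T a by apply: sub; rewrite !inE eqxx orbT.
  rewrite !inE negbK => /or3P[//|/eqP e|/eqP e].
    by rewrite e sedge_irr in am.
  by rewrite e sedge_irr in mb.
have [X [cX Xx Xout Xna]] := exists_leaf_reps x.
have [Y [cY Yy Yout Yna]] := exists_leaf_reps y.
have PB u : u \in P -> u != a -> u \in component [set a] x.
  by move=> uP ua; apply: ipath_component (ipath_rev hP) _ ua; rewrite mem_rev.
have QB u : u \in Q -> u != b -> u \in component [set b] y.
  by move=> uQ ub; apply: ipath_component (ipath_rev hQ) _ ub; rewrite mem_rev.
have Xn u z : u \in X -> z \in S -> z != x -> u != z.
  by move=> uX zS zx; apply: contraNneq (Xout _ _ uX zS zx) => ->; apply: component_refl.
have Yn u z : u \in Y -> z \in S -> z != y -> u != z.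
  by move=> uX zS zx; apply: contraNneq (Yout _ _ uX zS zx) => ->; apply: component_refl.
have ax : a != x by rewrite eq_sym.
have bx : b != x by rewrite eq_sym.
have ay : a != y by rewrite eq_sym.
have by' : b != y by rewrite eq_sym.
have XBa u : u \in X -> u \in component [set a] x.
  by move=> uX; apply: (component1_step xa (component_refl _ _) (Xn _ _ uX aS ax)); apply: Xx.
have XBb u : u \in X -> u \in component [set b] x.
  by move=> uX; apply: (component1_step xb (component_refl _ _) (Xn _ _ uX bS bx)); apply: Xx.
have YBb u : u \in Y -> u \in component [set b] y.
  by move=> uX; apply: (component1_step yb (component_refl _ _) (Yn _ _ uX bS by')); apply: Yy.
have bP : b \notin P by apply: contra bax => bP; apply: PB.
have PBb u : u \in P -> u \in component [set b] x.
  move=> uP; case/splitPr: uP hP bP => P1 P2 hP bP; have [hP1 _] := ipath_split hP.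
  by apply: ipath_avoid hP1 _; apply: contra bP; rewrite -cat_rcons mem_cat => ->.
have MK m : m \in M -> exists2 K, K \in F & m \in K by move=> /MP[].
exists x, y, a, b, P, Q, M, X, Y; split.
- by [].
- by rewrite cM cX cY.
- by [].
- split=> //.
  + by move=> m /MP[].
  + move=> u v uP ux vX; rewrite nonadj_sym.
    apply: (component_out ax _ (Xout _ _ vX aS ax)).
      by rewrite eq_sym sedge_neq // Xx.
    exact: ipath_component hP uP ux.
  + move=> u v uQ uy vY; rewrite nonadj_sym.
    apply: (component_out by' _ (Yout _ _ vY bS by')).
      by rewrite eq_sym sedge_neq // Yy.
    exact: ipath_component hQ uQ uy.
split.
- apply/andP; split=> //; apply/negP => sab.
  have : ipath a b [:: a; b].
    by apply: ipath_cons sab (ipath1 b) _ => v; rewrite inE => /eqP->; rewrite eqxx.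
  by move/sizeab.
- move=> v c hv hc'; rewrite nonadj_sym.
  have vB : v \in component [set a] x.
    by case/orP: hv => [/andP[]|]; [apply: PB|apply: XBa].
  have [ca cB] : c != a /\ c \notin component [set a] x.
    case: hc' => [/MK[K KF cK]|->]; last by [].
    have [KS /subsetP KB _ _] := FP _ KF; split.
      by apply: contraTneq cK => ->; apply: components_notin KS aS.
    by apply/negP => h; apply: (disja c h); apply: KB.
  exact: (component_out xa ca cB vB).
move=> v c hv hc'; rewrite nonadj_sym.
have vB : v \in component [set b] y.
  by case/orP: hv => [/andP[]|]; [apply: QB|apply: YBb].
have disjb u : u \in component [set b] x -> u \notin component [set b] y.
  move=> h; apply: contra sepb => h'.
  by rewrite -(component_eq h) (component_eq h') component_refl.
have [cb cB] : c != b /\ c \notin component [set b] y.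
  have xbb c' : c' \in component [set b] x -> c' != b by exact: component1_neq xb.
  case: hc' => [/MK[K KF cK]|->|cP|cX'].
  - have [KS _ aK bK] := FP _ KF; split.
      by apply: contraTneq cK => ->; apply: components_notin KS bS.
    apply: contra aby => h.
    have KB' : K \subset component [set b] y.
      by apply: (component_absorb KS bS yb h); left.
    exact: memB KS bS yb KB' aS ab aK.
  - by [].
  - by split; [apply: xbb|apply: disjb]; apply: PBb.
  - by split; [apply: xbb|apply: disjb]; apply: XBb.
exact: (component_out yb cb cB vB).
Qed.

End CaseA.
End Counting.

(** * The case q = 2p - 1: bound and structure at equality *)

Section CaseB.
Variables (G : sgraph) (S : {set G}) (N p : nat).
Hypothesis critG : deficiency_critical G.
Hypothesis barS : deficiency G + #|S| <= #|odd_components S|.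
Hypothesis minS : forall T : {set G},
  deficiency G + #|T| <= #|odd_components T| -> #|S| <= #|T|.
Hypothesis (N3 : 3 <= N) (locN : local_indep G <= N).
Hypothesis (p3 : 3 <= p) (oddp : odd p).
Notation A := (pred2 p (2 * p - 1)).
Hypothesis bonesA : forall i, 2 <= i -> has_induced G (bone i) -> A i.
Hypothesis S2 : 2 <= #|S|.
Implicit Types (x y z u v w a b e : G) (s : G) (P Q R : seq G) (K U : {set G}).
Notation O := (odd_components S).
Notation E := (endpoints S).

Let connG : gconnected G := critG.1.
Let sepC z := fun (zS : z \in S) (zE : z \notin E) =>
  center_separates critG barS zS zE S2.

(** For an endpoint y beyond z, the two paths at z have total size 2p - 1 or p, counting z once, and
    at least one of them carries a bone. Hence both have p vertices. *)
Lemma center_sizeB z x P : z \in S -> z \notin E -> x \in E -> ipath x z P -> size P = p.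
Proof.
move=> zS zE xE hP; have xz : x != z by apply: contraNneq zE => <-.
have [y [yE yz sep]] : exists y, [/\ y \in E, y != z & y \notin component [set z] x].
  have [u [v [uE vE uz vz sep]]] := sepC zS zE.
  have [ux|ux] := boolP (u \in component [set z] x); last by exists u.
  by exists v; rewrite -(component_eq ux).
have [Q hQ] := gconnected_ipath connG z y.
have [R hR sR] := ipath_cat_size xz sep yz hP hQ.
have xy : x != y by apply: contraNneq sep => <-; apply: component_refl.
have AR := endpoints_size bonesA (extE_endpoints (S := S)) xE yE xy hR.
have sP := ipath_size2 hP xz; have zy : z != y by rewrite eq_sym.
have sQ := ipath_size2 hQ zy.
have h3 := leq_trans (adj_odd_ge3 barS minS zS) (subset_leq_card (out_cover zS xz yz sep)).
have h4 := leq_trans h3 (leq_card_setU _ _).1.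
have [o|o] := leqP 2 #|out S z x|.
  have := center_size bonesA zS xE xz o hP; move: AR sP sQ sR => /=.
  by move: (size P) (size Q) (size R) => a b c; clear -p3; lia.
have {}o : 2 <= #|out S z y|.
  by move: o h4; move: #|out S z x| #|out S z y| => a b; clear; lia.
have := center_size bonesA zS yE yz o (ipath_rev hQ); rewrite size_rev.
move: AR sP sQ sR => /=.
by move: (size P) (size Q) (size R) => a b c; clear -p3; lia.
Qed.

(** A path from an endpoint through z on to z' would have more than p vertices. *)
Lemma center_uniqB z z' : z \in S -> z \notin E -> z' \in S -> z' \notin E -> z = z'.
Proof.
move=> zS zE z'S z'E; apply/eqP; apply: contraT => zz; exfalso.
have z'z : z' != z by rewrite eq_sym.
have [x [xE xz sep]] : exists x, [/\ x \in E, x != z & z' \notin component [set z] x].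
  have [u [v [uE vE uz vz sep]]] := sepC zS zE.
  have [ux|ux] := boolP (z' \in component [set z] u); last by exists u.
  exists v; split=> //; apply: contra sep => h.
  by rewrite -(component_eq ux) (component_eq h) component_refl.
have [P hP] := gconnected_ipath connG x z; have [Q hQ] := gconnected_ipath connG z z'.
have [R hR sR] := ipath_cat_size xz sep z'z hP hQ.
have := center_sizeB zS zE xE hP; have := center_sizeB z'S z'E xE hR.
move: sR (ipath_size2 hQ zz).
by move: (size P) (size Q) (size R) => a b c; clear; lia.
Qed.

Lemma endpoints_leN : #|E| <= N.
Proof.
have [x xE] : exists x, x \in E.
  by apply/set0Pn; rewrite -card_gt0; apply: leq_trans (exists_two_endpoints critG barS S2).
have xS := subsetP (endpoints_sub S) _ xE.
have l2 : 2 <= local_indep G.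
  by apply: leq_trans (adj_odd_le S x); apply: ltnW; exact: (adj_odd_ge3 barS minS xS).
apply: leq_trans locN; apply: (@endpoints_le _ p _ p3 oddp bonesA _ connG) => // z zE.
have [a [b [ab za zb h]]] := endpoints_endpoint zE.
exists a, b; split=> // y yE; apply: h; exact: subsetP (endpoints_sub S) _ yE.
Qed.

Lemma full_spider : #|E| = N ->
  exists z leg, z \notin E /\ spider p E z E leg.
Proof.
move=> eN; apply: (spider_full p3 oddp bonesA _ connG); rewrite ?eN // => z zE.
have [a [b [ab za zb h]]] := endpoints_endpoint zE.
exists a, b; split=> // y yE; apply: h; exact: subsetP (endpoints_sub S) _ yE.
Qed.

(** With N endpoints the center of the spider must be z: otherwise z would sit on the p vertices
    from some endpoint to that center, strictly before its end, and thus too close to the endpoint.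
    A leaf of z would then add a neighbour to the N heads of the legs. *)
Lemma center_leaf0 z : z \in S -> z \notin E -> #|E| = N -> leaf S z = set0.
Proof.
move=> zS zE eN; have [c [leg [cE sp]]] := full_spider eN.
have [_ hleg szleg _] := sp.
have ec : c = z.
  apply/eqP; apply: contraT => cz; exfalso.
  have [x [xE xz sep]] : exists x, [/\ x \in E, x != z & c \notin component [set z] x].
    have [u [v [uE vE uz vz sep]]] := sepC zS zE.
    have [ux|ux] := boolP (c \in component [set z] u); last by exists u.
    exists v; split=> //; apply: contra sep => h.
    by rewrite -(component_eq ux) (component_eq h) component_refl.
  have hP := ipath_rev (hleg _ xE).
  have sP : size (rev (c :: leg x)) = p.
    by rewrite size_rev /= szleg //; clear -p3; lia.
  have zP : z \in rev (c :: leg x).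
    by apply: contraT => /(ipath_avoid hP) h; rewrite h in sep.
  case/splitPr: zP hP sP => P1 P2 hP sP; have [hP1 hP2] := ipath_split hP.
  have := center_sizeB zS zE xE hP1; rewrite size_rcons.
  have zc : z != c by rewrite eq_sym.
  have := ipath_size2 hP2 zc.
  by move: sP; rewrite size_cat /=; clear; lia.
subst c; apply/eqP; apply: contraT => /set0Pn[K KL].
have [KO _ /adjP[a aK za] _] := leafP KL.
have := @spider_card _ _ _ p3 z E leg [set a] sp; rewrite cards1 eN => h.
suff : N + 1 <= local_indep G by move: locN; clear; lia.
apply: h.
- by move=> u; rewrite inE => /eqP->.
- by move=> u v; rewrite !inE => /eqP-> /eqP->; rewrite eqxx.
move=> u x; rewrite in_set1 => /eqP-> xE.
apply: leaf_outS KL aK (subsetP (endpoints_sub S) _ xE) _.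
by apply: contraNneq zE => <-.
Qed.

(** The second alternative, a strict inequality, covers fewer than N endpoints or the absence of a
    center. Equality in the bound is thus possible only for N endpoints and a center of weight at
    most N. *)
Lemma weight_leB :
  [/\ 2 * (deficiency G + #|S|) <= \sum_(x in E) (#|adj_odd S x| + #|leaf S x|) + N,
      #|E| = N & #|S| = N.+1] \/ 2 * deficiency G + 1 <= 2 * (N ^ 2 - N - 1).
Proof.
have S0 : S != set0 by rewrite -card_gt0; apply: ltnW.
have hw := weight_sum critG barS S0.
have he := endpoints_weight_sum critG locN S2; have cS := cardE_setD S.
have eN := endpoints_leN.
have [eC|/set0Pn[z zC]] := eqVneq (S :\: E) set0.
  right; move: hw he eN; rewrite cS eC big_set0 cards0 -mulnn.
  by move: (\sum_(x in E) _) #|E| (deficiency G) => a m d; clear -N3; nia.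
have [zE zS] : z \notin E /\ z \in S by move: zC; rewrite inE => /andP[].
have eC : S :\: E = [set z].
  apply/setP => u; rewrite [RHS]in_set1; apply/idP/eqP => [|->//].
  by rewrite inE => /andP[uE uS]; apply: center_uniqB.
move: hw cS; rewrite eC big_set1 cards1 => hw cS.
have hz := leq_trans (adj_odd_le S z) locN.
have lz : #|leaf S z| <= 1.
  by rewrite leqNgt; move: zE; rewrite inE zS.
have [e|ne] := eqVneq #|E| N.
  left; split=> //; last by rewrite cS e addn1.
  move: hw; rewrite (center_leaf0 zS zE e) cards0 addn0 => hw.
  by apply: leq_trans hw _; rewrite leq_add2l.
right; move: hw he eN ne hz lz; rewrite cS -mulnn.
move: (\sum_(x in E) _) #|E| (deficiency G) #|adj_odd S z| #|leaf S z|.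
by move=> a m d b c; clear -N3; nia.
Qed.

Lemma deficiency_leB : deficiency G <= N ^ 2 - N - 1.
Proof.
have he := endpoints_weight_sum critG locN S2.
case: weight_leB => [[h eN cS]|]; last by clear; lia.
move: h he; rewrite eN cS -mulnn; move: (\sum_(x in E) _) (deficiency G).
by move=> a d; clear -N3; nia.
Qed.

(** Bounding all endpoints but x by 2N - 1 leaves no slack at x, so x has the maximal N - 1
    leaves. *)
Lemma deficiency_eqB : deficiency G = N ^ 2 - N - 1 ->
  exists z leg, [/\ #|E| = N, spider p E z E leg &
    {in E, forall x, #|leaf S x| = N.-1}].
Proof.
move=> dG; have he := endpoints_weight_sum critG locN S2.
case: weight_leB => [[h eN cS]|]; last by rewrite dG; clear; lia.
have [z [leg [zE sp]]] := full_spider eN.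
exists z, leg; split=> // x xE.
move: h; rewrite (bigD1 x) //= dG cS -mulnn.
have : \sum_(y in E | y != x) (#|adj_odd S y| + #|leaf S y|) <= N.-1 * (2 * N - 1).
  have -> : N.-1 = #|E :\ x| by move: eN; rewrite (cardsD1 x) xE => <-.
  rewrite -sum_nat_const; rewrite [leqRHS](eq_bigl (fun y => (y \in E) && (y != x))) => [|y].
    apply: leq_sum => y /andP[yE _].
    by have [h1 h2] := endpoint_weight critG locN S2 yE; move: h1 h2; clear; lia.
  by rewrite !inE andbC.
have [h1 h2] := endpoint_weight critG locN S2 xE; move: h1 h2.
move: (\sum_(y in E | y != x) _) #|adj_odd S x| #|leaf S x| => a b c.
by clear -N3; nia.
Qed.

End CaseB.

(** * The extremal graphs *)

Section Counts.

Lemma card_sum_pred (I J : finType) (c : pred (I + J)) :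
  #|c| = #|[pred i | c (inl i)]| + #|[pred j | c (inr j)]|.
Proof. by rewrite -!sum1_card [LHS](big_sumType _ c). Qed.

Lemma card_option_pred (I : finType) (c : pred (option I)) :
  #|c| = c None + #|[pred i | c (Some i)]|.
Proof.
rewrite (cardD1 None) /=; congr (_ + _).
have Si : injective (@Some I) by move=> i j [].
rewrite -(card_imset _ Si); apply: eq_card => x; rewrite [LHS]inE /=.
apply/andP/imsetP => [[xN cx]|[i]]; last by rewrite inE => ci ->.
by case: x xN cx => // i _ ci; exists i; rewrite ?inE.
Qed.

Lemma card_neq_pred (I : finType) (u : I) (c : pred I) :
  #|[pred y : {y : I | y != u} | c (val y)]| + c u = #|c|.
Proof.
rewrite [RHS](cardD1 u) addnC; congr (_ + _).
rewrite -(card_imset _ val_inj); apply: eq_card => x; rewrite !inE.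
apply/imsetP/andP => [[y]|[xu cx]].
  by rewrite inE => cy ->; split=> //; apply: valP y.
by exists (exist _ x xu).
Qed.

Lemma card_odd_ord m : #|[pred i : 'I_m | odd i]| = m./2.
Proof.
rewrite -sum1_card big_mkcond /=; elim: m => [|m IH]; first by rewrite big_ord0.
rewrite big_ord_recr /= IH uphalf_half addnC unfold_in /=.
by case: (odd m).
Qed.

Lemma card_predC_ord m (c : pred 'I_m) : #|[pred i | c i]| + #|[pred i | ~~ c i]| = m.
Proof. by rewrite -[RHS](card_ord m) -(cardC [pred i | c i]). Qed.

Lemma card_setX_pred (I J : finType) (c : pred J) :
  #|[pred x : I * J | c x.2]| = #|I| * #|c|.
Proof.
have -> : #|[pred x : I * J | c x.2]| = #|setX [set: I] [set x | c x]|.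
  by apply: eq_card => -[i j]; rewrite !inE.
by rewrite cardsX cardsT cardsE.
Qed.

(** The singletons of an independent set are odd sets whose neighbours all lie in the complementary
    class, which plays the barrier. *)
Lemma indep_deficiency (G H : sgraph) (c : pred H) :
  G ≅ H -> (forall x y, sedge x y -> ~~ (c x && c y)) ->
  #|c| <= #|[pred x | ~~ c x]| + deficiency G.
Proof.
move=> /gisoP[f bij mono] indep; have [g fK gK] := bij.
pose F := [set [set x] | x in [set x | c x]].
have cF : #|F| = #|c| by rewrite card_imset ?cardsE //; exact: set1_inj.
rewrite -cF -[X in X + _]cardsE; apply: (odd_family_le (bij_inj bij)).
- apply/trivIsetP => K L /imsetP[x _ ->] /imsetP[y _ ->] xy.
  rewrite -setI_eq0; apply/eqP/setP => z; rewrite !inE.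
  by apply: contraNF xy => /andP[/eqP<- /eqP<-].
- by move=> K /imsetP[x _ ->]; rewrite cards1.
- by move=> K u _ _; exists (g u); rewrite gK.
move=> K x y /imsetP[z]; rewrite inE => cz ->; rewrite inE => /eqP xz xy; right.
rewrite inE; have := indep z (f y); rewrite cz /=; apply.
by rewrite -xz mono.
Qed.

End Counts.

(** * Deficiency of the extremal graphs from two-colorings *)

Section Colorings.
Variables (k p : nat).
Hypothesis (p3 : 0 < p) (oddp : odd p).

(** The independent class of the broom. Positions 0 and p - 1 are both even since p is odd: the
    pendent vertices join the class, while the end stays outside it and can be shared by several
    brooms. *)
Definition broom_color (v : broom k p) := match v with inl i => odd i | inr _ => true end.

Lemma broom_color_end : broom_color (broom_end k p) = false.
Proof. by rewrite /= ; case: p oddp => //= m /negPf. Qed.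

Lemma broom_color_indep x y : sedge x y -> ~~ (broom_color x && broom_color y).
Proof.
case: x y => [i|i] [j|j] //=; last 2 first.
- by move/eqP->.
- by move/eqP->.
move=> h; have {h} : path_rel i j := h.
by rewrite /path_rel => /orP[]/eqP <- /=; rewrite ?andbN // andNb.
Qed.

Lemma card_broom_color : #|[pred y | broom_color y]| = p./2 + k.
Proof.
rewrite card_sum_pred card_odd_ord; congr (_ + _).
  by rewrite prednK.
by rewrite -[RHS](card_ord k); apply: eq_card.
Qed.

Lemma card_broom_colorN : #|[pred y | ~~ broom_color y]| = p./2 + 1.
Proof.
rewrite card_sum_pred [X in _ + X]eq_card0 // addn0.
have h := card_predC_ord (fun i : 'I_(p.-1.+1) => odd i).
have h1 := card_odd_ord p.-1.+1; have h2 := odd_double_half p; rewrite oddp /= in h2.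
suff : #|[pred i : 'I_(p.-1.+1) | ~~ odd i]| = p./2 + 1 by [].
have e : p.-1.+1 = p by rewrite prednK.
by move: h h1 h2 e; clear; lia.
Qed.

Definition T_color (v : T_graph k p) :=
  match v with
  | inl (inl (inl _)) => false
  | inl (inl (inr _)) => true
  | inl (inr y) | inr y => broom_color (val y)
  end.

Lemma T_color_indep x y : sedge x y -> ~~ (T_color x && T_color y).
Proof.
have i2 := broom_color_indep.
have e := broom_color_end.
case: x y => [[[i|i]|i]|i] [[[j|j]|j]|j] //=; rewrite ?andbF //; try by move/i2.
Qed.

(** The independent class has k + 2(p./2 + k) vertices, its complement 2 + 2(p./2). *)
Lemma T_deficiency (G : sgraph) : G ≅ T_graph k p -> 3 * k - 2 <= deficiency G.
Proof.
move=> iso; have := indep_deficiency iso T_color_indep.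
have c1 (c : pred {y | y != broom_end k p}) :
    c =1 (fun y => broom_color (val y)) -> #|c| = p./2 + k.
  move=> /eq_card->; have := card_neq_pred (broom_end k p) broom_color.
  by rewrite broom_color_end addn0 card_broom_color.
have c2 (c : pred {y | y != broom_end k p}) :
    c =1 (fun y => ~~ broom_color (val y)) -> #|c| = p./2.
  move=> /eq_card->; have := card_neq_pred (broom_end k p) (fun y => ~~ broom_color y).
  by rewrite broom_color_end card_broom_colorN => /addIn.
rewrite !card_sum_pred.
rewrite (eq_card0 (A := [pred i | _])) // add0n.
rewrite [X in X + _ + _ <= _](_ : _ = k); last by rewrite -[RHS](card_ord k); apply: eq_card.
rewrite [X in _ + X + _ <= _](_ : _ = p./2 + k); last exact: c1.
rewrite [X in _ + _ + X <= _](_ : _ = p./2 + k); last exact: c1.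
rewrite [X in _ <= X + _ + _ + _ + _](_ : _ = 2); last first.
  by rewrite -[RHS](card_ord 2); apply: eq_card.
rewrite [X in _ <= _ + X + _ + _ + _]eq_card0 // addn0.
rewrite [X in _ <= _ + X + _ + _](_ : _ = p./2); last exact: c2.
rewrite [X in _ <= _ + X + _](_ : _ = p./2); last exact: c2.
by clear; lia.
Qed.

Definition S_color (v : S_graph k.+1 p) :=
  match v with
  | None => false
  | Some (_, y) => broom_color (val y)
  end.

Lemma S_color_indep x y : sedge x y -> ~~ (S_color x && S_color y).
Proof.
have i2 := broom_color_indep.
case: x y => [[i x]|] [[j y]|] //=; rewrite ?andbF //; case/andP=> _; exact: i2.
Qed.

(** Each of the k + 1 brooms has k more independent vertices than others, not counting the common
    vertex, which accounts for the final - 1. *)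
Lemma S_deficiency (G : sgraph) : G ≅ S_graph k.+1 p -> k.+1 * k - 1 <= deficiency G.
Proof.
move=> iso; have := indep_deficiency iso S_color_indep.
have c1 (c : pred {y | y != broom_end k p}) :
    c =1 (fun y => broom_color (val y)) -> #|c| = p./2 + k.
  move=> /eq_card->; have := card_neq_pred (broom_end k p) broom_color.
  by rewrite broom_color_end addn0 card_broom_color.
have c2 (c : pred {y | y != broom_end k p}) :
    c =1 (fun y => ~~ broom_color (val y)) -> #|c| = p./2.
  move=> /eq_card->; have := card_neq_pred (broom_end k p) (fun y => ~~ broom_color y).
  by rewrite broom_color_end card_broom_colorN => /addIn.
have cS (c : pred {y | y != broom_end k p}) :
    #|[pred x : 'I_k.+1 * {y | y != broom_end k p} | c x.2]| = k.+1 * #|c|.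
  by rewrite card_setX_pred card_ord.
rewrite !card_option_pred /= add0n.
rewrite [X in X <= _](_ : _ = k.+1 * (p./2 + k)); last first.
  rewrite -(c1 (fun y => broom_color (val y)) (frefl _)) -cS.
  by apply: eq_card => -[].
rewrite [X in _ <= _ + X + _](_ : _ = k.+1 * p./2); last first.
  rewrite -(c2 (fun y => ~~ broom_color (val y)) (frefl _)) -cS.
  by apply: eq_card => -[].
by clear; nia.
Qed.

End Colorings.

(** * Connectivity of the extremal graphs *)

Section Connected.

Lemma gconnected_root (G : sgraph) (r : G) :
  (forall x, connect sedge r x) -> gconnected G.
Proof.
move=> con; apply/andP; split; first by apply/card_gt0P; exists r.
apply/forallP => x; apply/forallP => y; apply: (@connect_trans _ _ r) (con y).
by rewrite (sym_connect_sym (@sedge_sym G)).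
Qed.

Lemma gconnectedP (G : sgraph) x y : gconnected G -> connect (@sedge G) x y.
Proof. by case/andP=> _ /forallP/(_ x)/forallP/(_ y). Qed.

Lemma connect_morph (G H : sgraph) (h : G -> H) x y :
  (forall u v, sedge u v -> sedge (h u) (h v)) ->
  connect sedge x y -> connect sedge (h x) (h y).
Proof.
move=> hom /connectP[p pth ->]; elim: p x pth => //= a p IH x /andP[xa pth].
exact: connect_trans (connect1 (hom _ _ xa)) (IH _ pth).
Qed.

Lemma path_graph_connected p : gconnected (path_graph p).
Proof.
apply: (@gconnected_root _ (ord0 : path_graph p)) => -[i lt].
elim: i lt => [|i IH] lt; first by rewrite (_ : Ordinal lt = ord0) //; apply: val_inj.
apply: connect_trans (IH (ltnW lt)) (connect1 _).
by rewrite [sedge _ _]/(path_rel _ _) /path_rel /= eqxx.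
Qed.

Lemma pendent_connected (G : sgraph) (v : G) k : gconnected G -> gconnected (pendent v k).
Proof.
move=> cG; have con x : connect sedge (inl v : pendent v k) (inl x).
  by apply: (connect_morph (h := fun x => inl x : pendent v k)) (gconnectedP v x cG).
apply: (@gconnected_root _ (inl v : pendent v k)) => -[x|i]; first exact: con.
by apply: connect1; rewrite /= eqxx.
Qed.

Lemma attach_connected (G : sgraph) (v : G) (H : sgraph) (u : H) :
  gconnected G -> gconnected H -> gconnected (attach v u).
Proof.
move=> cG cH; apply: (@gconnected_root _ (inl v : attach v u)) => -[x|y].
  by apply: (connect_morph (h := fun x => inl x : attach v u)) (gconnectedP v x cG).
(* The quotient map of the gluing: [insub] fails exactly at u, which is sent to v. *)
pose h (y : H) : attach v u := if insub y is Some b then inr b else inl v.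
have := connect_morph (h := h) _ (gconnectedP u (val y) cH).
rewrite /h valK insubF ?eqxx //; apply=> a b ab.
case: insubP => [a' _ ea|]; case: insubP => [b' _ eb|] /=; rewrite ?negbK ?ea ?eb.
- by [].
- by move/eqP=> eb; rewrite eqxx -eb sedge_sym.
- by move/eqP=> ea; rewrite eqxx -ea.
- by move=> /eqP eb /eqP ea; rewrite eb ea sedge_irr in ab.
Qed.

Lemma bouquet_connected k (H : sgraph) (u : H) : gconnected H -> gconnected (bouquet k u).
Proof.
move=> cH; apply: (@gconnected_root _ (None : bouquet k u)) => -[[i y]|] //.
pose h (y : H) : bouquet k u := if insub y is Some b then Some (i, b) else None.
have := connect_morph (h := h) _ (gconnectedP u (val y) cH).
rewrite /h valK insubF ?eqxx //; apply=> a b ab.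
case: insubP => [a' _ ea|]; case: insubP => [b' _ eb|] /=; rewrite ?negbK ?ea ?eb ?eqxx //=.
- by move/eqP=> eb; rewrite -eb sedge_sym.
- by move/eqP=> ea; rewrite -ea.
- by move=> /eqP eb /eqP ea; rewrite eb ea sedge_irr in ab.
Qed.

Lemma biclique2_connected k : 0 < k -> gconnected (biclique 2 k).
Proof.
case: k => // k _; apply: (@gconnected_root _ (inr ord0 : biclique 2 k.+1)) => -[i|j].
  exact: connect1.
by apply: (@connect_trans _ _ (inl ord0 : biclique 2 k.+1)); apply: connect1.
Qed.

Lemma broom_connected k p : gconnected (broom k p).
Proof. exact/pendent_connected/path_graph_connected. Qed.

Lemma T_connected k p : 0 < k -> gconnected (T_graph k p).
Proof.
move=> k0; apply: attach_connected (broom_connected k p).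
exact: attach_connected (biclique2_connected k0) (broom_connected k p).
Qed.

Lemma S_connected k p : gconnected (S_graph k p).
Proof. exact: bouquet_connected (broom_connected k.-1 p). Qed.

End Connected.

(** * Induced copies of the extremal graphs *)

Section Embeddings.
Variable G : sgraph.
Implicit Types (x y z u v w a b : G) (P Q : seq G) (X Y M : {set G}).

Lemma emb_attach (K : sgraph) (c : K) (H : sgraph) (d : H) (f : K -> G) (g : H -> G) :
  emb f -> emb g -> f c = g d ->
  (forall k h, h != d -> k != c -> nonadj (f k) (g h)) ->
  emb (fun v : attach c d => match v with inl k => f k | inr h => g (val h) end).
Proof.
move=> [f_inj f_mono] [g_inj g_mono] fg na_fg.
have neq k (h : {y | y != d}) : f k != g (val h).
  have [->|kc] := eqVneq k c; last exact: nonadj_neq (na_fg _ _ (valP h) kc).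
  by rewrite fg (inj_eq g_inj) eq_sym (valP h).
have eE k (h : {y | y != d}) : sedge (f k) (g (val h)) = (k == c) && sedge d (val h).
  have [->|kc] := eqVneq k c; first by rewrite fg g_mono.
  exact: nonadj_edgeF (na_fg _ _ (valP h) kc).
split=> [[k|h] [k'|h'] //= e|[k|h] [k'|h'] /=].
- by rewrite (f_inj _ _ e).
- by move: (neq k h'); rewrite e eqxx.
- by move: (neq k' h); rewrite e eqxx.
- by congr inr; apply/val_inj/g_inj.
- exact: f_mono.
- exact: eE.
- by rewrite sedge_sym eE.
- exact: g_mono.
Qed.

Lemma emb_bouquet k (H : sgraph) (d : H) (f : 'I_k -> H -> G) z :
  (forall i, emb (f i)) -> (forall i, f i d = z) ->
  (forall i j h h', i != j -> h != d -> h' != d -> nonadj (f i h) (f j h')) -> 0 < k ->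
  emb (fun v : bouquet k d => match v with None => z | Some (i, h) => f i (val h) end).
Proof.
move=> f_emb fz naf k0.
have fe i := (f_emb i).2; have fi i := (f_emb i).1.
have neq i (h : {y | y != d}) : z != f i (val h).
  by rewrite -(fz i) (inj_eq (fi i)) eq_sym (valP h).
have zE i (h : {y | y != d}) : sedge z (f i (val h)) = sedge d (val h).
  by rewrite -(fz i) fe.
split=> [[[i h]|] [[j h']|] //= e|[[i h]|] [[j h']|] /=].
- have [ij|ij] := eqVneq i j.
    by subst j; congr (Some (_, _)); apply/val_inj/(fi i).
  by have := nonadj_neq (naf _ _ _ _ ij (valP h) (valP h')); rewrite e eqxx.
- by move: (neq i h); rewrite e eqxx.
- by move: (neq j h'); rewrite e eqxx.
- have [ij|ij] := eqVneq i j; first by subst j; rewrite fe.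
  exact: nonadj_edgeF (naf _ _ _ _ ij (valP h) (valP h')).
- by rewrite sedge_sym zE.
- exact: zE.
- by rewrite sedge_irr.
Qed.

Lemma emb_broom x a P X k p : ipath x a P -> 0 < p -> size P = p -> #|X| = k ->
  {in X &, forall u v, u != v -> nonadj u v} -> {in X, forall u, sedge x u} ->
  (forall u v, u \in P -> u != x -> v \in X -> nonadj u v) ->
  exists f : broom k p -> G, [/\ emb f, f (broom_end k p) = a &
    forall h, h != broom_end k p -> (f h \in P) && (f h != a) || (f h \in X)].
Proof.
move=> hP p0 sP cX naX xX naPX.
have [t [eP el h]] := ipathP _ _ _ hP.
have sP' : size P = p.-1.+1 by rewrite sP prednK.
have e1 := emb_path x h sP'.
pose g (i : 'I_k) := nth x (enum X) i.
have gX i : g i \in X by rewrite -mem_enum mem_nth // -cardE cX.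
have fP (i : path_graph p) : nth x P i \in P by rewrite mem_nth // sP'.
have f0 : nth x P (ord0 : path_graph p) = x by rewrite eP.
pose f (v : broom k p) := match v with inl i => nth x P i | inr j => g j end.
have fend : f (broom_end k p) = a.
  by rewrite /f /= -el (last_nth x) -eP (_ : size t = p.-1) // -sP eP.
have ef : emb f.
  apply: (emb_pendent e1).
  - move=> i j ij; apply: naX => //.
    rewrite nth_uniq ?enum_uniq // -?cardE ?cX //.
  - move=> i j; have [e|ne] := eqVneq (nth x P i) x.
      by rewrite e sedge_neq // xX.
    exact: nonadj_neq (naPX _ _ (fP i) ne (gX j)).
  - move=> i j; rewrite -(inj_eq e1.1) f0; have [e|ne] := eqVneq (nth x P i) x.
      by rewrite e xX.
    exact: nonadj_edgeF (naPX _ _ (fP i) ne (gX j)).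
exists f; split=> // v vN; rewrite -fend (inj_eq ef.1) vN andbT.
by case: v {vN} => [i|j]; rewrite /f ?fP ?gX ?orbT.
Qed.

Lemma emb_T k p : 0 < p -> T_pattern G k p -> exists f : T_graph k p -> G, emb f.
Proof.
move=> p0 [x [y [a [b [P [Q [M [X [Y [[hP hQ sP sQ] [cM cX cY] [naM naX naY]
  [Mab Xx Yy naPX naQY] [ab C1 C2]]]]]]]]]]].
have [f [ef fa fP]] := emb_broom hP p0 sP cX naX Xx naPX.
have [g [eg gb gQ]] := emb_broom hQ p0 sQ cY naY Yy naQY.
pose m (i : 'I_k) := nth a (enum M) i.
have mM i : m i \in M by rewrite -mem_enum mem_nth // -cardE cM.
have am i : sedge a (m i) by have /andP[] := Mab _ (mM i).
have bm i : sedge b (m i) by have /andP[] := Mab _ (mM i).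
pose f0 (v : biclique 2 k) := match v with inl i => if i == ord0 then a else b | inr j => m j end.
have ef0 : emb f0.
  have I2 (i : 'I_2) : i = ord0 \/ i = ord_max.
    by case: i => -[|[|//]] lt; [left|right]; apply: val_inj.
  have m_na i j : i != j -> nonadj (m i) (m j).
    by move=> ij; apply: naM => //; rewrite nth_uniq ?enum_uniq // -?cardE ?cM.
  have nab := nonadj_neq ab; have eab := nonadj_edgeF ab.
  split=> [[i|i] [j|j] /= e|[i|i] [j|j] /=].
  - by move: e; case: (I2 i) => ->; case: (I2 j) => -> //= e; move: nab; rewrite e eqxx.
  - by have := am j; have := bm j; move: e; case: (I2 i) => -> /= ->; rewrite sedge_irr.
  - by have := am i; have := bm i; move: e; case: (I2 j) => -> /= ->; rewrite sedge_irr.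
  - by congr inr; apply/eqP; apply: contraT => /m_na/nonadj_neq; rewrite e eqxx.
  - by case: (I2 i) => ->; case: (I2 j) => -> /=; rewrite ?sedge_irr // sedge_sym.
  - by case: (I2 i) => -> /=; rewrite ?am ?bm.
  - by rewrite sedge_sym; case: (I2 j) => -> /=; rewrite ?am ?bm.
  - have [->|ij] := eqVneq i j; first by rewrite sedge_irr.
    exact: nonadj_edgeF (m_na _ _ ij).
have e1 := emb_attach (c := inl ord0 : biclique 2 k) (d := broom_end k p) ef0 ef.
have {}e1 := e1 (esym fa).
eexists; apply: (emb_attach _ eg).
- apply: e1 => v h hN vN; rewrite nonadj_sym; apply: C1 (fP _ hN) _.
  case: v vN => [i|j] /= vN; last by left.
  by right; case: ifP vN => // /eqP->; rewrite eqxx.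
- by rewrite /= gb.
move=> [[i|j]|h'] h hN vN; rewrite nonadj_sym; apply: C2 (gQ _ hN) _ => /=.
- constructor 2; case: ifP => // iN; case/eqP: vN; congr (inl (inl _)).
  by case: i iN => -[|[|//]] lt // _; apply: val_inj.
- by constructor 1.
- have := fP _ (valP h'); case/orP=> [/andP[h1 _]|h1]; [by constructor 3|by constructor 4].
Qed.

Lemma emb_S (E : {set G}) z leg (X : G -> {set G}) k p : 1 < p -> #|E| = k.+1 ->
  spider p E z E leg -> {in E, forall x, #|X x| = k} ->
  {in E, forall x, {in X x &, forall u v, u != v -> nonadj u v}} ->
  {in E, forall x, {in X x, forall u, sedge x u}} ->
  {in E, forall x, forall u v, u \in z :: leg x -> u != x -> v \in X x -> nonadj u v} ->
  {in E &, forall x y, x != y -> forall u v, u \in X x -> v \in X y -> nonadj u v} ->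
  {in E &, forall x y, x != y -> forall u v, u \in X x -> v \in leg y -> nonadj u v} ->
  exists f : S_graph k.+1 p -> G, emb f.
Proof.
move=> p1 cE [_ hleg szleg naleg] cX naX xX naP naXX naXl.
have p0 : 0 < p by apply: ltnW.
pose ev (i : 'I_k.+1) := nth z (enum E) i.
have evE i : ev i \in E by rewrite -mem_enum mem_nth // -cardE cE.
have ev_inj i j : i != j -> ev i != ev j.
  by move=> ij; rewrite nth_uniq ?enum_uniq // -?cardE ?cE.
have ex i : exists f : broom k p -> G, [/\ emb f, f (broom_end k p) = z &
    forall h, h != broom_end k p -> (f h \in leg (ev i)) || (f h \in X (ev i))].
  have xE := evE i; have hP := ipath_rev (hleg _ xE).
  have sP : size (rev (z :: leg (ev i))) = p.
    by rewrite size_rev /= szleg // prednK.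
  have [|f [ef fz fP]] := emb_broom hP p0 sP (cX _ xE) (naX _ xE) (xX _ xE).
    by move=> u v; rewrite mem_rev; apply: naP.
  exists f; split=> // h /fP; rewrite mem_rev inE => /orP[/andP[/orP[/eqP->|->//] /eqP//]|->].
  by rewrite orbT.
have [f fP] : exists f : 'I_k.+1 -> broom k p -> G, forall i, [/\ emb (f i), f i (broom_end k p) = z &
    forall h, h != broom_end k p -> (f i h \in leg (ev i)) || (f i h \in X (ev i))].
  exact: (fin_all_exists ex).
exists (fun v : S_graph k.+1 p => match v with None => z | Some (i, h) => f i (val h) end).
apply: emb_bouquet => // [i|i|i j h h' ij hN hN'].
- by have [] := fP i.
- by have [] := fP i.
have [_ _ /(_ h hN) h1] := fP i; have [_ _ /(_ h' hN') h2] := fP j.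
have xy := ev_inj _ _ ij; have yx : ev j != ev i by rewrite eq_sym.
case/orP: h1 => h1; case/orP: h2 => h2.
- exact: naleg xy _ _ h1 h2.
- by rewrite nonadj_sym; apply: naXl yx _ _ h2 h1.
- exact: naXl xy _ _ h1 h2.
- exact: naXX xy _ _ h1 h2.
Qed.

End Embeddings.

Lemma giso_connected (G H : sgraph) : G ≅ H -> gconnected G -> gconnected H.
Proof.
case/gisoP=> f [g fK gK] mono cG; have [r _] := card_gt0P (andP cG).1.
apply: (@gconnected_root _ (f r)) => x; rewrite -(gK x).
by apply: connect_morph (gconnectedP r (g x) cG) => u v uv; rewrite mono.
Qed.

(** The image of f is a connected induced subgraph of no smaller deficiency, so by criticality it is
    everything. Quantifying over all K isomorphic to H lets the hypothesis apply to the image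
    itself. *)
Lemma critical_giso (G H : sgraph) (f : H -> G) :
  deficiency_critical G -> gconnected H -> emb f ->
  (forall K, K ≅ H -> deficiency G <= deficiency K) -> G ≅ H.
Proof.
move=> critG cH ef dH; have iso := emb_giso ef.
have cI := giso_connected (giso_sym iso) cH.
have [lt|nlt] := boolP (f @: setT \proper [set: G]).
  by have := critG.2 _ lt cI; rewrite ltnNge dH.
have fT : f @: setT = setT.
  by apply/eqP; move: nlt; rewrite properT negbK.
apply: giso_sym; apply/gisoP; exists f; last exact: ef.2.
by apply: inj_card_bij ef.1 _; rewrite -[X in _ <= X]cardsT -(card_imset _ ef.1) fT cardsT.
Qed.

(** A noncritical graph has a proper connected induced subgraph of at least the same deficiency;
    descend. Bones and induced stars of the subgraph are also induced in G, so the bounds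
    transfer. *)
Lemma exists_critical (G : sgraph) : gconnected G ->
  exists (H : sgraph) (f : H -> G),
    [/\ emb f, deficiency_critical H & deficiency G <= deficiency H].
Proof.
have [k] := ubnP #|G|; elim: k G => // k IH G lt cG.
have [/existsP[S /and3P[pS cS dS]]|/existsPn no] :=
  boolP [exists S : {set G}, [&& S \proper [set: G], gconnected (induced S) &
                              deficiency G <= deficiency (induced S)]].
  have [|H [f [ef critH dH]]] := IH (induced S) _ cS.
    rewrite card_sig; apply: leq_trans (proper_card pS) _; by rewrite cardsT -ltnS.
  exists H, (val \o f); split=> //; last exact: leq_trans dS dH.
  exact: emb_comp ef (emb_val S).
exists G, id; split=> //; split=> // S pS cS.
by have := no S; rewrite pS cS /= -ltnNge.
Qed.

Lemma exists_barrier (G : sgraph) : exists S : {set G},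
  deficiency G + #|S| <= #|odd_components S| /\
  forall T : {set G}, deficiency G + #|T| <= #|odd_components T| -> #|S| <= #|T|.
Proof.
have [S0 hS0] := tutte_berge G.
case: (arg_minnP (P := fun T : {set G} => deficiency G + #|T| <= #|odd_components T|)
  (fun T : {set G} => #|T|) hS0) => S hS minS.
by exists S.
Qed.

Section Critical.
Variables (G : sgraph) (N p : nat).
Hypothesis critG : deficiency_critical G.
Hypothesis (N3 : 3 <= N) (locN : local_indep G <= N).
Hypothesis (p3 : 3 <= p) (oddp : odd p).

Lemma critical_T :
  (forall i, 2 <= i -> has_induced G (bone i) -> pred2 p (2 * p + 1) i) ->
  deficiency G <= 3 * N - 5 /\
  (deficiency G = 3 * N - 5 -> exists f : T_graph N.-1 p -> G, emb f).
Proof.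
move=> bonesA; have [S [barS minS]] := exists_barrier G.
have [S1|S2] := leqP #|S| 1.
  have := deficiency_small critG barS N3 locN S1.
  by clear -N3 => h; split; [|move=> e; exfalso]; lia.
split; first exact: (deficiency_leA critG barS minS N3 locN p3 oddp bonesA S2).
move=> dG; apply: emb_T; first by apply: leq_trans p3.
exact: (deficiency_eqA critG barS minS N3 locN p3 oddp bonesA S2).
Qed.

Lemma critical_S :
  (forall i, 2 <= i -> has_induced G (bone i) -> pred2 p (2 * p - 1) i) ->
  deficiency G <= N ^ 2 - N - 1 /\
  (deficiency G = N ^ 2 - N - 1 -> exists f : S_graph N.-1.+1 p -> G, emb f).
Proof.
move=> bonesA; have [S [barS minS]] := exists_barrier G.
have [S1|S2] := leqP #|S| 1.
  have := deficiency_small critG barS N3 locN S1; rewrite -mulnn.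
  by clear -N3 => h; split; [|move=> e; exfalso]; nia.
split; first exact: (deficiency_leB critG barS minS N3 locN p3 oddp bonesA S2).
move=> dG.
have [z [leg [cE sp leafE]]] := deficiency_eqB critG barS minS N3 locN p3 oddp bonesA S2 dG.
have ES := subsetP (endpoints_sub S).
have [X XP] := fin_all_exists (fun x : G => exists_leaf_reps S x).
have otherE x : x \in endpoints S -> exists2 y, y \in endpoints S & x != y.
  by apply: exists_other; rewrite cE; apply: leq_trans N3.
have Xne x y u : x \in endpoints S -> y \in endpoints S -> x != y -> u \in X x -> u != y.
  move=> xE yE xy uX; have [_ _ out _] := XP x; rewrite eq_sym in xy.
  by apply: contraNneq (out _ _ uX (ES _ yE) xy) => ->; apply: component_refl.
have Xout x y u v : x \in endpoints S -> y \in endpoints S -> x != y -> u \in X x ->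
    v \in component [set x] y -> nonadj u v.
  move=> xE yE xy uX; have [_ Xx out _] := XP x; rewrite eq_sym in xy.
  apply: (component_out xy _ (out _ _ uX (ES _ yE) xy)).
  by rewrite eq_sym sedge_neq // Xx.
have p1 : 1 < p by apply: leq_trans p3.
apply: (emb_S (X := X) p1 _ sp).
- by rewrite cE prednK //; apply: leq_trans N3.
- by move=> x xE; have [-> _ _ _] := XP x; apply: leafE.
- by move=> x _; have [] := XP x.
- by move=> x _; have [] := XP x.
- move=> x xE u v uP ux vX; have [y yE xy] := otherE _ xE.
  rewrite nonadj_sym; apply: (Xout x y) => //.
  apply: ipath_component (spider_path sp xE yE xy) _ ux.
  by move: uP; rewrite mem_cat mem_rev !inE => /orP[]->; rewrite ?orbT.
- move=> x y xE yE xy u v uX vX; apply: (Xout x y) => //.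
  have yx : y != x by rewrite eq_sym.
  have [_ Xy _ _] := XP y.
  apply: (component1_step yx (component_refl _ _) _ (Xy _ vX)).
  exact: (Xne y x v yE xE yx vX).
move=> x y xE yE xy u v uX vl; apply: (Xout x y) => //.
apply: ipath_component (spider_path sp xE yE xy) _ _.
  by rewrite mem_cat inE vl !orbT.
have [_ hleg szleg naleg] := sp.
have xl : x \in leg x.
  have := ipath_last (hleg _ xE); rewrite inE eq_sym.
  by rewrite (negPf (spider_ncenter p3 sp xE)).
by rewrite eq_sym; apply: nonadj_neq (naleg _ _ xE yE xy _ _ xl vl).
Qed.

End Critical.

Theorem theorem1p8 (n p q : nat) (G : sgraph)
    (n_gt3 : 3 < n) (p_ge3 : 3 <= p) (p_odd : odd p)
    (G_bones : bone_family (pred2 p q) G) (G_loc : local_indep G < n) :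
  (q = 2 * p + 1 ->
     deficiency G <= 3 * n - 8 /\
     (deficiency_critical G ->
        (deficiency G = 3 * n - 8 <-> G ≅ T_graph (n - 2) p))) /\
  (q = 2 * p - 1 ->
     deficiency G <= n ^ 2 - 3 * n + 1 /\
     (deficiency_critical G ->
        (deficiency G = n ^ 2 - 3 * n + 1 <-> G ≅ S_graph (n - 1) p))).
Proof.
have [cG bones] := G_bones; have [H [f [ef critH dH]]] := exists_critical cG.
(* In terms of N the bounds 3n - 8 and n^2 - 3n + 1 become 3N - 5 and N^2 - N - 1. The inequalities
   are obtained from the critical subgraph H, the equality cases from G itself. *)
pose N := n.-1; have N3 : 3 <= N by rewrite /N; lia.
have locG : local_indep G <= N by rewrite /N; lia.
have locH := leq_trans (local_indep_emb ef) locG.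
have p0 : 0 < p by apply: leq_trans p_ge3.
have bonesG i : 2 <= i -> has_induced G (bone i) -> pred2 p q i.
  by move=> i2 hi; have := bones i i2 hi; rewrite inE.
have bonesH i : 2 <= i -> has_induced H (bone i) -> pred2 p q i.
  by move=> i2 hi; apply: bonesG i2 _; apply: emb_has_induced ef hi.
split=> e; subst q.
  have -> : 3 * n - 8 = 3 * N - 5 by rewrite /N; lia.
  have -> : n - 2 = N.-1 by rewrite /N; lia.
  split; first exact: leq_trans dH (critical_T critH N3 locH p_ge3 p_odd bonesH).1.
  move=> critG; have [le em] := critical_T critG N3 locG p_ge3 p_odd bonesG.
  split=> [dG|iso]; last first.
    apply/eqP; rewrite eqn_leq le /=; apply: leq_trans (T_deficiency p0 p_odd iso).
    by move: N3; clear; lia.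
  have [h eh] := em dG; apply: (critical_giso critG _ eh).
    by apply: T_connected; move: N3; clear; lia.
  move=> K iso; apply: leq_trans (T_deficiency p0 p_odd iso).
  by rewrite dG; move: N3; clear; lia.
have -> : n ^ 2 - 3 * n + 1 = N ^ 2 - N - 1.
  by rewrite /N -!mulnn; move: n_gt3; clear; case: n => // m; nia.
have -> : n - 1 = N.-1.+1 by rewrite /N; lia.
have eN : N ^ 2 - N - 1 = N.-1.+1 * N.-1 - 1.
  by rewrite -mulnn; move: N3; clear; case: N => // m; nia.
split; first exact: leq_trans dH (critical_S critH N3 locH p_ge3 p_odd bonesH).1.
move=> critG; have [le em] := critical_S critG N3 locG p_ge3 p_odd bonesG.
split=> [dG|iso]; last first.
  by apply/eqP; rewrite eqn_leq le eN /=; apply: (S_deficiency p0 p_odd iso).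
have [h eh] := em dG; apply: (critical_giso critG (S_connected _ _) eh) => K iso.
by rewrite dG eN; apply: (S_deficiency p0 p_odd iso).
Qed.
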